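(* Let $p$ be an odd prime and let $\Pi$ be a depth zero supercuspidal representation of $GL_2(\mathbb{Q}_p)$ with trivial central character, associated to a character $\nu:\mathbb{F}_{p^2}^*\to\mathbb{C}^*$ with $\nu\neq\nu^p$; thus $\nu=\nu(a,b)$, and $\nu,\nu^p$ are labelled so that $a>b$ (and then $a+b=p-1$). Let $K/\mathbb{Q}_p$ be the unramified quadratic extension, and let $\chi$ denote a character of $K^*/\mathbb{Q}_p^*(1+p\mathcal{O}_K)$, identified with a character of $\mathbb{F}_{p^2}^*/\mathbb{F}_p^*$. Then: 1. The vector $v_{\mathrm{triv}}$ is a test vector for the trivial character $\chi=1$ if and only if $\epsilon_p(\chi)\neq\epsilon_p(\nu)$. The character $\chi=1$ is of Type 2. 2. The vector $v_{\mathrm{quad}}$ is a test vector for the nontrivial quadratic character $\chi$ of $K^*/\mathbb{Q}_p^*(1+p\mathcal{O}_K)$ if and only if $\epsilon_p(\chi)\neq\epsilon_p(\nu)$. The nontrivial quadratic character $\chi$ is of Type 1. 3. More generally, $v_{\mathrm{triv}}$ is a test vector for all Type 2 characters $\chi$ such that $\epsilon_p(\chi)\neq\epsilon_p(\nu)$, and $v_{\mathrm{quad}}$ is a test vector for all Type 1 characters $\chi$ such that $\epsilon_p(\chi)\neq\epsilon_p(\nu)$. 4. Neither $v_{\mathrm{triv}}$ nor $v_{\mathrm{quad}}$ is a test vector for any character $\chi$ with $\epsilon_p(\chi)=\epsilon_p(\nu)$.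
   Context: Representations. For a character $\nu:\mathbb{F}_{p^2}^*\to\mathbb{C}^*$ with $\nu\ne\nu^p$, $\rho(\nu)$ is the irreducible cuspidal complex representation of $GL_2(\mathbb{F}_p)$ of dimension $p-1$ attached to $\nu$ (central character $\nu|_{\mathbb{F}_p^*}$; trace $-(\nu(z)+\nu(z)^p)$ at an element with eigenvalues $z,z^p$, $z\in\mathbb{F}_{p^2}\setminus\mathbb{F}_p$); $\rho(\nu)\cong\rho(\nu^p)$. Given a character $\omega$ of $\mathbb{Q}_p^*$ whose restriction to $\mathbb{Z}_p^*$ is the inflation of $\nu|_{\mathbb{F}_p^*}$, the depth zero supercuspidal representation $\Pi$ associated to $\nu$ (and $\omega$) is the irreducible smooth admissible supercuspidal representation of $GL_2(\mathbb{Q}_p)$ with central character $\omega$ whose type $V(\Pi)$, i.e. its space of vectors fixed by the matrices in $GL_2(\mathbb{Z}_p)$ congruent to $1$ modulo $p$, is as a representation of $GL_2(\mathbb{Z}_p)$ the inflation of $\rho(\nu)$. Here $\omega$ is trivial. Torus and test vectors. Fix a non-square unit $\xi\in\mathbb{Z}_p^*$ (also viewed in $\mathbb{F}_p^*$). $T=K^*$ is embedded in $GL_2(\mathbb{Q}_p)$ as the matrices $\begin{pmatrix} x&y\\ y\xi&x\end{pmatrix}$; reduction mod $p$ embeds $\mathbb{F}_{p^2}^*$ in $GL_2(\mathbb{F}_p)$. A vector $v\in V(\Pi)$ is a test vector for $\chi$ if its projection to the $\chi$-eigenspace of $T$ in $\Pi$ is nonzero (equivalently, a nonzero $T$-equivariant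 functional $\ell_\chi:\Pi\to\chi$ exists and $\ell_\chi(v)\neq0$). For a character $\mu$ of $\mathbb{F}_p^*$, $v_\mu\in V(\Pi)$ is a nonzero vector, unique up to scalar, on which $\begin{pmatrix} x&0\\0&1\end{pmatrix}$, $x\in\mathbb{F}_p^*$, acts by $\mu(x)$ via $\rho(\nu)$; $v_{\mathrm{triv}}$ and $v_{\mathrm{quad}}$ are the vectors $v_\mu$ for $\mu=1$ and for $\mu$ the nontrivial quadratic character. Labelling. Fix a prime of $\overline{\mathbb{Q}}$ above $p$, so that the complex $(p^2-1)$-th roots of unity are identified with $\mathbb{F}_{p^2}^*$. Every character $\chi$ of $\mathbb{F}_{p^2}^*$ is then $x\mapsto x^{r+ps}$ with $0\le r,s\le p-1$, unique once $(p-1,p-1)$ is excluded in favour of $(0,0)$; write $\chi=\chi(r,s)$ and $k_\chi=r+ps$. With $\nu=\nu(a,b)$, $a>b$, one has $k_\nu=a+pb<k_{\nu^p}=b+pa$. The character $\chi$ is of Type 1 if $k_\nu<k_\chi<k_{\nu^p}$, and of Type 2 otherwise. Signs. Let $\psi$ be a nontrivial additive character of $\mathbb{F}_p$ and $G(\chi)=\sum_{u\in\mathbb{F}_{p^2}^*}\chi(u)\psi(\mathrm{tr}(u))$. For $\chi$ trivial on $\mathbb{F}_p^*$ and not factoring through the norm $\mathbb{F}_{p^2}^*\to\mathbb{F}_p^*$, $\epsilon_p(\chi)=G(\chi)/p$, which equals $\chi(\sqrt\xi)$, where $\sqrt\xi\in\mathbb{F}_{p^2}^*$ is a trace zero element with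 square $\xi$. If $\chi$ is trivial or the nontrivial quadratic character, set $\epsilon_p(\chi)=\chi(\sqrt\xi)$. *)

(* Defs.v *)
From HB Require Import structures.
From mathcomp Require Import all_boot all_order all_algebra all_fingroup.
From mathcomp Require Import all_field all_character.
From mathcomp Require Import boolp reals.
From mathcomp Require Import complex.
From mathcomp Require Import zify.

Set Implicit Arguments.
Unset Strict Implicit.
Unset Printing Implicit Defensive.

Import Order.TTheory GRing.Theory Num.Theory.
Local Open Scope ring_scope.

(* Z_p as the inverse limit of the rings Z/p^n: a p-adic integer is the       *)
(* sequence of its representatives in [0, p^n), n >= 0.                       *)
Record padic_int (p : nat) (p_pr : prime p) := PadicInt {
  padic_digits : nat -> int;
  padic_compat : forall n,
    (padic_digits n.+1 %% (p ^ n)%N%:Z)%Z = padic_digits n }.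

Section PadicInt.
Variables (p : nat) (p_pr : prime p).
Local Notation Zp := (padic_int p_pr).

HB.instance Definition _ := gen_eqMixin Zp.
HB.instance Definition _ := gen_choiceMixin Zp.

Local Notation "q ^:Z" := ((p ^ q)%N%:Z) (at level 2).

Lemma padic_intP (x y : Zp) : padic_digits x =1 padic_digits y -> x = y.
Proof.
case: x y => [x cx] [y cy] /= /funext exy; rewrite -exy in cy *.
by congr PadicInt; apply: Prop_irrelevance.
Qed.

Lemma padic_digits_mod (x : Zp) n :
  (padic_digits x n %% n^:Z)%Z = padic_digits x n.
Proof. by rewrite -(padic_compat x n) modz_mod. Qed.

Lemma modz_pow_le (m n : nat) (a : int) :
  (m <= n)%N -> ((a %% n^:Z)%Z = a %[mod m^:Z])%Z.
Proof.
move=> le_mn; rewrite [in RHS](divz_eq a n^:Z).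
by rewrite -[in X in (_ * X)%R](subnK le_mn) expnD PoszM mulrA modzMDl.
Qed.

Lemma padic_digits_le (x : Zp) (m n : nat) :
  (m <= n)%N -> (padic_digits x n %% m^:Z)%Z = padic_digits x m.
Proof.
move=> le_mn; rewrite -(subnK le_mn).
elim: (n - m)%N => [|k IHk]; first by rewrite padic_digits_mod.
rewrite -[in RHS]IHk -(padic_compat x (k + m)).
by rewrite modz_pow_le ?leq_addl.
Qed.

Fact padic_of_subproof (f : nat -> int)
    (cf : forall n, (f n.+1 = f n %[mod n^:Z])%Z) n :
  ((f n.+1 %% n.+1^:Z)%Z %% n^:Z)%Z = (f n %% n^:Z)%Z.
Proof. by rewrite modz_pow_le ?cf. Qed.

Definition padic_of f cf : Zp := PadicInt p_pr (@padic_of_subproof f cf).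

Fact padic_const_subproof (a : int) (n : nat) : (a = a %[mod n^:Z])%Z.
Proof. by []. Qed.

Fact padic_add_subproof (x y : Zp) n :
  (padic_digits x n.+1 + padic_digits y n.+1
     = padic_digits x n + padic_digits y n %[mod n^:Z])%Z.
Proof. by rewrite -modzDm !padic_compat. Qed.

Fact padic_opp_subproof (x : Zp) n :
  (- padic_digits x n.+1 = - padic_digits x n %[mod n^:Z])%Z.
Proof. by rewrite -modzNm padic_compat. Qed.

Fact padic_mul_subproof (x y : Zp) n :
  (padic_digits x n.+1 * padic_digits y n.+1
     = padic_digits x n * padic_digits y n %[mod n^:Z])%Z.
Proof. by rewrite -modzMm !padic_compat. Qed.

Definition padic_add x y := padic_of (padic_add_subproof x y).
Definition padic_opp x := padic_of (padic_opp_subproof x).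
Definition padic_mul x y := padic_of (padic_mul_subproof x y).
Definition padic_zero := padic_of (padic_const_subproof 0).
Definition padic_one := padic_of (padic_const_subproof 1).

Fact padic_addA : associative padic_add.
Proof.
by move=> x y z; apply: padic_intP => n /=; rewrite modzDmr modzDml addrA.
Qed.

Fact padic_addC : commutative padic_add.
Proof. by move=> x y; apply: padic_intP => n /=; rewrite addrC. Qed.

Fact padic_add0 : left_id padic_zero padic_add.
Proof.
by move=> x; apply: padic_intP => n /=; rewrite modzDml add0r padic_digits_mod.
Qed.

Fact padic_addN : left_inverse padic_zero padic_opp padic_add.
Proof. by move=> x; apply: padic_intP => n /=; rewrite modzDml addNr. Qed.

HB.instance Definition _ :=
  GRing.isZmodule.Build Zp padic_addA padic_addC padic_add0 padic_addN.

Fact padic_mulA : associative padic_mul.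
Proof.
by move=> x y z; apply: padic_intP => n /=; rewrite modzMmr modzMml mulrA.
Qed.

Fact padic_mulC : commutative padic_mul.
Proof. by move=> x y; apply: padic_intP => n /=; rewrite mulrC. Qed.

Fact padic_mul1 : left_id padic_one padic_mul.
Proof.
by move=> x; apply: padic_intP => n /=; rewrite modzMml mul1r padic_digits_mod.
Qed.

Fact padic_mulD : left_distributive padic_mul padic_add.
Proof.
move=> x y z; apply: padic_intP => n /=.
by rewrite modzMml modzDml modzDmr mulrDl.
Qed.

Fact padic_one_neq0 : padic_one != 0.
Proof.
apply/eqP => /(congr1 (fun x => padic_digits x 1%N)) /=.
rewrite expn1 mod0z => /dvdz_mod0P; rewrite dvdzE /= dvdn1 => /eqP p1.
by move: p_pr; rewrite p1.
Qed.

HB.instance Definition _ := GRing.Zmodule_isComNzRing.Build Zp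
  padic_mulA padic_mulC padic_mul1 padic_mulD padic_one_neq0.

Definition padic_unit : {pred Zp} :=
  fun x => `[< exists y : Zp, y * x = 1 >].

Definition padic_inv (x : Zp) : Zp :=
  if pselect (exists y : Zp, y * x = 1) is left e then sval (cid e)
  else x.

Fact padic_mulV : {in padic_unit, left_inverse 1 padic_inv *%R}.
Proof.
move=> x /asboolP ux; rewrite /padic_inv.
by case: pselect => // e; case: (cid e).
Qed.

Fact padic_unitP (x y : Zp) : y * x = 1 -> padic_unit x.
Proof. by move=> yx1; apply/asboolP; exists y. Qed.

Fact padic_inv_out : {in [predC padic_unit], padic_inv =1 id}.
Proof.
move=> x; rewrite /padic_inv inE => /negP nux.
by case: pselect => // ux; case: nux; apply/asboolP.
Qed.

HB.instance Definition _ := GRing.ComNzRing_hasMulInverse.Build Zp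
  padic_mulV padic_unitP padic_inv_out.

Lemma padic_neq0 (x : Zp) :
  x != 0 ->
  exists n, forall m, (n <= m)%N -> ~~ (p ^ n %| `|padic_digits x m|)%N.
Proof.
move=> x0; have [n xn] : exists n, padic_digits x n != 0.
  apply: contrapT => nx; case/eqP: x0; apply: padic_intP => n /=.
  rewrite mod0z; apply: contrapT => xn; apply: nx; exists n; exact/eqP.
exists n => m le_nm; apply: contra xn => dvd.
by rewrite -(padic_digits_le x le_nm); apply/eqP/dvdz_mod0P; rewrite dvdzE.
Qed.

Fact padic_integral : GRing.integral_domain_axiom Zp.
Proof.
move=> x y xy0; apply: contrapT => /negP; rewrite negb_or => /andP[x0 y0].
have [m xm] := padic_neq0 x0; have [n yn] := padic_neq0 y0.
have {xm} := xm _ (leq_addr n m); have {yn} := yn _ (leq_addl m n).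
have := congr1 (fun z => padic_digits z (m + n)) xy0.
rewrite /= mod0z => /dvdz_mod0P; rewrite dvdzE abszM /=.
set a := absz _; set b := absz _ => ab yb xa.
have a0 : (0 < a)%N by case: a xa {ab} => //; rewrite dvdn0.
have b0 : (0 < b)%N by case: b yb {ab} => //; rewrite dvdn0.
move: ab xa yb; rewrite !pfactor_dvdn ?muln_gt0 ?a0 // lognM //; lia.
Qed.

HB.instance Definition _ :=
  GRing.ComUnitRing_isIntegral.Build Zp padic_integral.

Definition padic_residue (x : Zp) : 'F_p := (padic_digits x 1%N)%:~R.

Lemma intr_modFp (a : int) : ((a %% p%:Z)%Z)%:~R = a%:~R :> 'F_p.
Proof.
rewrite /modz intrD mulrNz intrM -pmulrn.
by rewrite (pcharf0 (pchar_Fp p_pr)) mulr0 subr0.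
Qed.

Fact padic_residue_is_zmod_morphism : zmod_morphism padic_residue.
Proof.
move=> x y; rewrite /padic_residue /= expn1 intr_modFp intrD.
by rewrite intr_modFp mulrNz.
Qed.

Fact padic_residue_is_monoid_morphism : monoid_morphism padic_residue.
Proof.
by split=> [|x y]; rewrite /padic_residue /= expn1 intr_modFp ?intrM.
Qed.

HB.instance Definition _ := GRing.isZmodMorphism.Build Zp 'F_p
  padic_residue padic_residue_is_zmod_morphism.
HB.instance Definition _ := GRing.isMonoidMorphism.Build Zp 'F_p
  padic_residue padic_residue_is_monoid_morphism.

End PadicInt.

Notation padic p_pr := {fraction padic_int p_pr}.

Definition mx2 (F : pzRingType) (a b c d : F) : 'M[F]_2 :=
  \matrix_(i < 2, j < 2)
    if i == 0 then (if j == 0 then a else b) else (if j == 0 then c else d).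

Section Characters.
Variables (F C : fieldType).

(* A character of F^* with values in C^*, extended by 0 at 0.                 *)
Definition mulchar (c : F -> C) : Prop :=
  [/\ c 0 = 0, c 1 = 1 & forall x y, c (x * y) = c x * c y].

Definition triv_char (x : F) : C := (x != 0)%:R.

Definition quad_char (c : F -> C) : Prop :=
  [/\ mulchar c, c <> triv_char & (fun x => c x ^+ 2) = triv_char].

Definition addchar (psi : F -> C) : Prop :=
  psi 0 = 1 /\ forall x y, psi (x + y) = psi x * psi y.

End Characters.

Arguments triv_char : clear implicits.

Section FiniteField.
Variables (C : fieldType) (p : nat) (Fq : finFieldType).
Variable iota : {rmorphism 'F_p -> Fq}.

(* For #|Fq| = p^2, the trace of u to F_p, as u + u^p lies in F_p.            *)
Definition trace_Fp (u : Fq) : 'F_p :=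
  odflt 0 [pick t | iota t == u + u ^+ p].

Definition gauss_sum (psi : 'F_p -> C) (chi : Fq -> C) : C :=
  \sum_(u | u != 0) chi u * psi (trace_Fp u).

(* sqrtxi is a trace zero element of Fq. A character that is trivial on F_p^* *)
(* factors through the norm exactly when it is trivial or quadratic.          *)
Definition epsilon (psi : 'F_p -> C) (sqrtxi : Fq) (chi : Fq -> C) : C :=
  if `[< chi = triv_char Fq C \/ quad_char chi >] then chi sqrtxi
  else gauss_sum psi chi / p%:R.

(* The cuspidal representation rho(nu), acting on column vectors.             *)
Record cuspidal_repr (nu : Fq -> C)
    (rho : mx_representation C [set: {'GL_2['F_p]}] p.-1) : Prop := {
  cuspidal_irr : mx_irreducible rho;
  cuspidal_unipotent : forall u : 'cV[C]_(p.-1),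
    (forall (g : {'GL_2['F_p]}) y, GLval g = mx2 1 y 0 1 -> rho g *m u = u) ->
    u = 0;
  cuspidal_central : forall (g : {'GL_2['F_p]}) x,
    GLval g = x%:M -> rho g = (nu (iota x))%:M;
  cuspidal_trace : forall (g : {'GL_2['F_p]}) z,
    z \notin codom iota -> eigenvalue (map_mx iota (GLval g)) z ->
    \tr (rho g) = - (nu z + nu z ^+ p) }.

End FiniteField.

Section Labelling.
Variables (C : fieldType) (p : nat) (Fq : finFieldType) (k : fieldType).

(* A prime above p of the ring of algebraic integers of C, given as the       *)
(* kernel of a morphism red to a field k containing the residue field; red is *)
(* unconstrained outside the algebraic integers.                              *)
Record prime_over (red : C -> k) : Prop := {
  prime_over1 : red 1 = 1;
  prime_overD : forall x y,
    integralOver (intr : int -> C) x -> integralOver (intr : int -> C) y ->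
    red (x + y) = red x + red y;
  prime_overM : forall x y,
    integralOver (intr : int -> C) x -> integralOver (intr : int -> C) y ->
    red (x * y) = red x * red y;
  prime_over_p : red p%:R = 0 }.

Variables (red : C -> k) (j : {rmorphism Fq -> k}).

(* chi = chi(r, s): roots of unity are identified with elements of Fq through *)
(* their images in k.                                                         *)
Definition label (chi : Fq -> C) (r s : nat) : Prop :=
  [/\ (r <= p.-1)%N, (s <= p.-1)%N, (r, s) != (p.-1, p.-1) &
      forall x, x != 0 -> red (chi x) = j x ^+ (r + p * s)].

(* Types relative to nu = nu(a, b) with a > b.                                *)
Definition type1 (a b : nat) (chi : Fq -> C) : Prop :=
  exists r s, label chi r s /\ (a + p * b < r + p * s < b + p * a)%N.

Definition type2 (a b : nat) (chi : Fq -> C) : Prop := ~ type1 a b chi.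

End Labelling.

Section Representations.
Variables (C : fieldType) (p : nat) (p_pr : prime p).
Local Notation Zp := (padic_int p_pr).
Local Notation Qp := (padic p_pr).
Variables (V : lmodType C) (Pi : 'M[Qp]_2 -> V -> V).

(* A representation of GL_2(Q_p); Pi g is irrelevant for g not invertible.    *)
Record is_repr : Prop := {
  repr_linear : forall g, g \in unitmx ->
    forall (a : C) u v, Pi g (a *: u + v) = a *: Pi g u + Pi g v;
  repr1 : forall v, Pi 1%:M v = v;
  reprM : forall g h, g \in unitmx -> h \in unitmx ->
    forall v, Pi (g *m h) v = Pi g (Pi h v) }.

Definition repr_irreducible : Prop :=
  (exists v : V, v != 0) /\
  forall W : V -> Prop,
    W 0 -> (forall (a : C) u v, W u -> W v -> W (a *: u + v)) ->
    (forall g v, g \in unitmx -> W v -> W (Pi g v)) ->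
    (forall v, W v -> v = 0) \/ (forall v, W v).

(* g in GL_2(Z_p) with g = 1 mod p^n.                                         *)
Definition congruence_subgroup (n : nat) (g : 'M[Zp]_2) : Prop :=
  g \in unitmx /\ exists X, g = 1%:M + (p ^ n)%:R *: X.

Definition fixed_vector (n : nat) (v : V) : Prop :=
  forall g, congruence_subgroup n g -> Pi (map_mx (@tofrac _) g) v = v.

Definition smooth : Prop := forall v, exists n, fixed_vector n v.

Definition admissible : Prop :=
  smooth /\
  forall n, exists d (e : 'I_d -> V), forall v, fixed_vector n v ->
    exists c : 'I_d -> C, v = \sum_(i < d) c i *: e i.

(* The Jacquet module along the upper triangular Borel subgroup vanishes.     *)
Definition supercuspidal : Prop :=
  forall v, exists d (x : 'I_d -> Qp) (w : 'I_d -> V),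
    v = \sum_(i < d) (Pi (mx2 1 (x i) 0 1) (w i) - w i).

Definition trivial_central_char : Prop :=
  forall x v, x != 0 -> Pi x%:M v = v.

(* The space of vectors fixed by the first congruence subgroup is isomorphic, *)
(* as a representation of GL_2(Z_p), to the inflation of rho.                 *)
Definition has_type
    (rho : mx_representation C [set: {'GL_2['F_p]}] p.-1) : Prop :=
  exists f : {linear 'cV[C]_(p.-1) -> V},
    [/\ injective f, forall v, fixed_vector 1 v <-> exists u, f u = v &
      forall (g : 'M[Zp]_2) (g' : {'GL_2['F_p]}), g \in unitmx ->
        GLval g' = map_mx (@padic_residue p p_pr) g ->
        forall u, Pi (map_mx (@tofrac _) g) (f u) = f (rho g' *m u)].

Record depth_zero_supercuspidal (Fq : finFieldType)
    (iota : {rmorphism 'F_p -> Fq}) (nu : Fq -> C) : Prop := {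
  depth_zero_repr : is_repr;
  depth_zero_irr : repr_irreducible;
  depth_zero_admissible : admissible;
  depth_zero_supercusp : supercuspidal;
  depth_zero_type : exists2 rho, cuspidal_repr iota nu rho & has_type rho }.

Definition mu_vector (mu : 'F_p -> C) (v : V) : Prop :=
  [/\ v != 0, fixed_vector 1 v &
    forall x : Zp, x \is a GRing.unit ->
      Pi (mx2 (tofrac x) 0 0 1) v = mu (padic_residue x) *: v].

Section Torus.
Variables (xi : Zp) (K : fieldExtType Qp) (sqrtxi : K).

(* w is in the chi-eigenspace of T = K^*, where x + y sqrtxi in K^* is        *)
(* embedded in GL_2(Q_p) as (x, y; y xi, x).                                  *)
Definition torus_eigenvector (chi : K -> C) (w : V) : Prop :=
  forall x y : Qp, (x, y) != (0, 0) ->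
    Pi (mx2 x y (y * tofrac xi) x) w = chi (x%:A + y *: sqrtxi) *: w.

(* v has a nonzero component w in the chi-eigenspace, in a decomposition of v *)
(* into eigenvectors of T. The component does not depend on the decomposition *)
(* as eigenspaces for distinct characters are in direct sum.                  *)
Definition test_vector (chi : K -> C) (v : V) : Prop :=
  exists w d (c : 'I_d -> K -> C) (u : 'I_d -> V),
    [/\ w != 0, torus_eigenvector chi w,
        forall i, [/\ mulchar (c i), c i <> chi & torus_eigenvector (c i) (u i)]
      & v = w + \sum_(i < d) u i].

(* chiK is a character of K^*/Q_p^*(1+pO_K), identified with the character    *)
(* chi of Fq^*/F_p^* through x + y sqrtxi |-> x + y s mod p on O_K^*, where   *)
(* s is a square root of xi mod p in Fq.                                      *)
Record tame_char (Fq : finFieldType) (iota : {rmorphism 'F_p -> Fq}) (s : Fq)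
    (chiK : K -> C) (chi : Fq -> C) : Prop := {
  tame_mulchar : mulchar chiK;
  tame_Qp : forall x : Qp, x != 0 -> chiK x%:A = 1;
  tame_one_units : forall z : K,
    integralOver (fun x : Zp => (tofrac x)%:A : K) z -> chiK (1 + p%:R * z) = 1;
  tame_residual_mulchar : mulchar chi;
  tame_residual : forall x y : Zp,
    (padic_residue x, padic_residue y) != (0, 0) ->
    chiK ((tofrac x)%:A + tofrac y *: sqrtxi) =
      chi (iota (padic_residue x) + iota (padic_residue y) * s) }.

End Torus.
End Representations.

(* Main.v *)
Require Import Defs.
From HB Require Import structures.
From mathcomp Require Import all_boot all_order all_algebra all_fingroup.
From mathcomp Require Import all_solvable all_field all_character.
From mathcomp Require Import boolp reals.
From mathcomp Require Import complex.
From mathcomp Require Import zify ring.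

Set Implicit Arguments.
Unset Strict Implicit.
Unset Printing Implicit Defensive.

Import Order.TTheory GRing.Theory Num.Theory UnityRootTheory.
Local Open Scope ring_scope.

(** The vectors fixed by the first congruence subgroup form the cuspidal
representation rho of GL_2(F_p), of dimension p - 1. On them K^* acts through
the nonsplit torus T = Fq^*, and diagonal matrices act through the split torus
D = F_p^*. The theorem asks whether the projection e_chi to the
chi-eigenspace of T kills the mu-eigenvector v_mu of D, where mu is trivial or
quadratic. Everything is read off the character theta of rho. Its values
outside the elliptic elements follow from the absence of vectors fixed by the
unipotent group U: the sum of theta over a coset of U in the Borel subgroup
is zero, and conjugation makes theta almost constant on such a coset.

Obstruction. The projection e_mu to the mu-eigenspace of D has trace 1, hence
rank 1. The matrix w of s = sqrt(xi) in T normalises D and preserves this line,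
because mu is its own inverse. The eigenvalue of w on it is the trace of
w e_mu, an average of values of theta at trace zero matrices, up to signs: 0 at
those that split and - 2 nu(s) at those conjugate to a scalar multiple of w,
where mu is 1. As the eigenvalue
is a sign, it is - nu(s) (w_split_proj_eigen). A Gauss sum evaluation gives
eps(chi) = chi(s) (epsilonE). So if eps(chi) = eps(nu), then w acts on v_mu by
- chi(s), and v_mu has no component along chi.

Nonvanishing. As e_mu has rank 1, it is enough that e_chi e_mu has nonzero
trace. Up to a factor, this trace is the sum of chi(t)^-1 mu(x) theta(t d(x))
over t in T and d(x) in D, a sum of algebraic integers, and its reduction
modulo the prime above p is computed. There theta becomes the character of
(Sym^(a-b-2) tensor det^(b+1)) + (Sym^(2b) tensor det^a), see theta_red. The
i-th diagonal coefficient of Sym^n(t d(x)) is x^i times a function of t, so that the sum over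
x selects a middle coefficient: of the first summand for mu quadratic, of the
second one for mu trivial. This coefficient is a combination of monomials in t
and t^p, the sum over t selects one of them, and its coefficient is a value of
a Krawtchouk polynomial, nonzero modulo p by a two-term recurrence (kraw_neq0).
If chi reduces to t^((p-1) e), then chi is of Type 1 exactly when
b + 1 < e < a + 1 (type1E), and chi(s) <> nu(s) fixes the parity of e: together
these say that the monomial is there (nonvanishing_quad, nonvanishing_triv).

In Pi, the eigencomponents of v_mu for T become eigenvectors of K^*, once the
characters of Fq^* trivial on F_p^* are lifted to K^* along the reduction of
primitive elements X + Y sqrt(xi); eigenvectors for distinct characters of K^*
are independent, so that the component of v_mu along chi is well defined. *)

(** * The trace of a symmetric power of a 2 x 2 matrix *)

Section SymTrace.
Variables (F : comNzRingType) (a b c d x : F).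

(** The i-th diagonal coefficient of Sym^n of the matrix with rows (a, b) and
(c, d), in the monomial basis X^i Y^(n-i), with Y = 1. *)
Definition sym_coef (n i : nat) : F :=
  ((a%:P * 'X + b%:P) ^+ i * (c%:P * 'X + d%:P) ^+ (n - i))`_i.

(** The trace of Sym^n of the matrix with rows (a x, b) and (c x, d): scaling the
first column by x multiplies the i-th diagonal coefficient by x^i. *)
Definition sym_trace (n : nat) : F := \sum_(i < n.+1) x ^+ i * sym_coef n i.

Lemma lead_linear_exp (u v : F) n : ((u%:P * 'X + v%:P) ^+ n)`_n = u ^+ n.
Proof.
suff: forall m, (((u%:P * 'X + v%:P) ^+ n)`_(n + m) = u ^+ n *+ (m == 0)%N).
  by move/(_ 0%N); rewrite addn0 eqxx mulr1n.
elim: n => [|n IHn] m; first by rewrite !expr0 coef1 add0n; case: m.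
rewrite exprS mulrDl coefD -mulrA !coefCM coefXM addSn /=.
by rewrite IHn -addnS IHn mulr0 addr0 exprS mulrnAr.
Qed.

Lemma sym_coef0 n : sym_coef n 0 = d ^+ n.
Proof.
by rewrite /sym_coef expr0 mul1r subn0 -horner_coef0 horner_exp !hornerE.
Qed.

Lemma sym_coef_last n : sym_coef n n = a ^+ n.
Proof. by rewrite /sym_coef subnn expr0 mulr1 lead_linear_exp. Qed.

(** With L1 = a X + b and L2 = c X + d one has
L1 L2 = d L1 + a X L2 - (a d - b c) X: multiply by L1^i L2^(n-i) and compare the
coefficients of X^(i+1). *)
Lemma sym_coef_rec n i : (i <= n)%N ->
  sym_coef n.+2 i.+1 =
    d * sym_coef n.+1 i.+1 + a * sym_coef n.+1 i - (a * d - b * c) * sym_coef n i.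
Proof.
move=> le_in; rewrite /sym_coef.
have -> : (n.+2 - i.+1 = (n - i).+1)%N by lia.
have -> : (n.+1 - i.+1 = n - i)%N by lia.
have -> : (n.+1 - i = (n - i).+1)%N by lia.
set L1 := a%:P * _ + _; set L2 := c%:P * _ + _.
set G := L1 ^+ i * L2 ^+ (n - i).
have -> : L1 ^+ i.+1 * L2 ^+ (n - i).+1
  = d%:P * (L1 ^+ i.+1 * L2 ^+ (n - i))
    + (a%:P * (L1 ^+ i * L2 ^+ (n - i).+1) - (a * d - b * c)%:P * G) * 'X.
  by rewrite !exprS /G /L1 /L2 polyCB !polyCM; ring.
by rewrite coefD coefCM coefMX /= coefB !coefCM /G addrA.
Qed.

Lemma sym_trace_rec n : sym_trace n.+2 =
  (a * x + d) * sym_trace n.+1 - x * (a * d - b * c) * sym_trace n.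
Proof.
rewrite {1}/sym_trace big_ord_recl big_ord_recr /= expr0 mul1r sym_coef0.
rewrite /bump /= !add1n sym_coef_last.
under eq_bigr => i _ do rewrite /bump /= add1n sym_coef_rec -1?ltnS //.
have E1 : d * sym_trace n.+1 =
    d ^+ n.+2 + \sum_(i < n.+1) x ^+ i.+1 * (d * sym_coef n.+1 i.+1).
  rewrite /sym_trace big_ord_recl /= expr0 mul1r sym_coef0 mulrDr -exprS.
  by rewrite mulr_sumr; congr (_ + _); apply: eq_bigr => i _; rewrite /bump add1n; ring.
have E2 : a * x * sym_trace n.+1 =
    x ^+ n.+2 * a ^+ n.+2 + \sum_(i < n.+1) x ^+ i.+1 * (a * sym_coef n.+1 i).
  rewrite /sym_trace big_ord_recr /= sym_coef_last mulrDr addrC; congr (_ + _).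
    by rewrite !exprS; ring.
  by rewrite mulr_sumr; apply: eq_bigr => i _; rewrite exprS; ring.
have E3 : x * (a * d - b * c) * sym_trace n =
    \sum_(i < n.+1) x ^+ i.+1 * ((a * d - b * c) * sym_coef n i).
  by rewrite mulr_sumr; apply: eq_bigr => i _; rewrite exprS; ring.
rewrite [in RHS]mulrDl E1 E2 E3.
rewrite [X in _ + (X + _)](_ : _ =
  \sum_(i < n.+1) x ^+ i.+1 * (d * sym_coef n.+1 i.+1)
  + \sum_(i < n.+1) x ^+ i.+1 * (a * sym_coef n.+1 i)
  - \sum_(i < n.+1) x ^+ i.+1 * ((a * d - b * c) * sym_coef n i)).
  ring.
by rewrite -sumrN -!big_split /=; apply: eq_bigr => i _; ring.
Qed.

(** The complete homogeneous symmetric polynomial of degree n in z and z'. *)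
Definition hsum (z z' : F) n := \sum_(i < n.+1) z ^+ i * z' ^+ (n - i).

Lemma hsumS z z' n : hsum z z' n.+1 = z' * hsum z z' n + z ^+ n.+1.
Proof.
rewrite /hsum big_ord_recr /= subnn expr0 mulr1 mulr_sumr; congr (_ + _).
apply: eq_bigr => i _; rewrite subSn -1?ltnS // exprS; ring.
Qed.

(** The trace of Sym^n as a function of the eigenvalues. Both sides satisfy the
recurrence given by the characteristic polynomial of the matrix. *)
Lemma sym_traceE z z' n : z + z' = a * x + d -> z * z' = x * (a * d - b * c) ->
  sym_trace n = hsum z z' n.
Proof.
move=> sum_z prod_z.
have [//] : sym_trace n = hsum z z' n /\ sym_trace n.+1 = hsum z z' n.+1.
elim: n => [|n [IH1 IH2]]; split => //.
- by rewrite /sym_trace /hsum !big_ord1 sym_coef0 !expr0.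
- rewrite /sym_trace big_ord_recl big_ord1 /= sym_coef0 sym_coef_last.
  by rewrite hsumS /hsum big_ord1 /= !expr0 !expr1 !mulr1 mul1r [z' + z]addrC sum_z; ring.
- by rewrite sym_trace_rec IH1 IH2 -sum_z -prod_z !hsumS !exprS; ring.
Qed.

Lemma hsum_telescope z z' n : (z - z') * hsum z z' n = z ^+ n.+1 - z' ^+ n.+1.
Proof.
elim: n => [|n IHn]; first by rewrite /hsum big_ord1 /= !expr0 !mulr1 !expr1.
rewrite hsumS mulrDr mulrCA IHn [in RHS]exprS [X in _ = _ - X]exprS; ring.
Qed.

Lemma hsum_diag z n : hsum z z n = z ^+ n *+ n.+1.
Proof.
rewrite /hsum (eq_bigr (fun=> z ^+ n)) ?sumr_const ?card_ord // => i _.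
by rewrite -exprD subnKC // -ltnS.
Qed.

End SymTrace.

(** * Values of Krawtchouk polynomials modulo p *)

Section Krawtchouk.
Variable F : fieldType.

(** A value of a Krawtchouk polynomial, up to a power of u. *)
Definition kraw (u : F) (m l : nat) : F :=
  (('X + u%:P) ^+ (2 * l) * ('X - u%:P) ^+ (2 * (m - l)))`_m.

(** For F = (X + u)^A (X - u)^B with A + B = 2 m, the coefficient of X^m in
m F - X F' is zero, and
- 2 (m F - X F') = (X + u)^(A-1) (X - u)^(B-1) (A (X - u)^2 + B (X + u)^2).
Here A = 2 l + 1. *)
Lemma kraw_rec (u : F) (m l : nat) : (2 : F) != 0 -> (l < m)%N ->
  kraw u m l *+ (2 * l).+1 + kraw u m l.+1 *+ (2 * (m - l)).-1 = 0.
Proof.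
move=> two_neq0 lt_lm; set A := (2 * l)%N; set B := (2 * (m - l.+1))%N.
have eB : ((2 * (m - l)).-1 = B.+1)%N by rewrite /B; lia.
have eB2 : (2 * (m - l) = B.+2)%N by rewrite /B; lia.
have eA2 : (2 * l.+1 = A.+2)%N by rewrite /A; lia.
have em : (m * 2 = A.+1 + B.+1)%N by rewrite /A /B; lia.
rewrite /kraw eB eB2 eA2 -/A -/B.
set P := 'X + u%:P; set Q := 'X - u%:P.
pose f := P ^+ A.+1 * Q ^+ B.+1.
have euler : (f *+ m - 'X * f^`())`_m = 0.
  rewrite coefB coefMn coefXM; case: (m) => [|m']; first by rewrite mulr0n subr0.
  by rewrite coef_deriv subrr.
have key : P ^+ A * Q ^+ B.+2 *+ A.+1 + P ^+ A.+2 * Q ^+ B *+ B.+1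
   = - ((f *+ m - 'X * f^`()) *+ 2).
  have dP : P^`() = 1 by rewrite /P derivD derivX derivC addr0.
  have dQ : Q^`() = 1 by rewrite /Q derivB derivX derivC subr0.
  have em' : m%:R + m%:R = A.+1%:R + B.+1%:R :> {poly F}.
    by rewrite -!natrD -em; congr (_%:R); lia.
  rewrite /f derivM !deriv_exp dP dQ /= !mul1r.
  transitivity (- (P ^+ A.+1 * Q ^+ B.+1 * (m%:R + m%:R) -
      2 * ('X * (P ^+ A * A.+1%:R * Q ^+ B.+1 + P ^+ A.+1 * (Q ^+ B * B.+1%:R))))).
    by rewrite em' !exprS /P /Q; ring.
  by ring.
by rewrite -!coefMn -coefD key coefN coefMn euler mul0rn oppr0.
Qed.

Lemma kraw0 u m : kraw u m 0 = (- u) ^+ m *+ 'C(2 * m, m).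
Proof.
rewrite /kraw muln0 expr0 mul1r subn0 -polyCN exprDn coef_sum.
have lt_m : (m < (2 * m).+1)%N by lia.
rewrite (bigD1 (Ordinal lt_m)) //= big1 ?addr0 => [|i /eqP neq_im].
  by rewrite coefMn -polyC_exp coefMC coefXn (_ : _ == _ = true) ?mul1r //; lia.
rewrite coefMn -polyC_exp coefMC coefXn (_ : _ == _ = false) ?mul0r ?mul0rn //.
by apply/eqP => eq_m; apply: neq_im; apply: val_inj => /=; case: i eq_m => /=; lia.
Qed.

Lemma natr_pchar_neq0 (p n : nat) : p \in [pchar F] -> (0 < n < p)%N ->
  n%:R != 0 :> F.
Proof.
move=> charF /andP[n_gt0 lt_np]; rewrite -(dvdn_pcharf charF).
by apply: contraL lt_np => /dvdn_leq; rewrite -leqNgt; apply.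
Qed.

Lemma bin_pchar_neq0 (p n k : nat) : p \in [pchar F] -> (n < p)%N ->
  (k <= n)%N -> 'C(n, k)%:R != 0 :> F.
Proof.
move=> charF lt_np le_kn.
have fact_neq0 : n`!%:R != 0 :> F.
  elim: n lt_np {le_kn} => [|n IHn] lt_np; first by rewrite fact0 oner_eq0.
  rewrite factS natrM mulf_neq0 ?IHn 1?ltnW //.
  by apply: natr_pchar_neq0 charF _; rewrite lt_np.
by apply: contraNneq fact_neq0 => C0; rewrite -(bin_fact le_kn) natrM C0 mul0r.
Qed.

(** By the recurrence, whose coefficients are odd and smaller than p, it is
enough to treat l = 0, where the value is a central binomial coefficient up to
a power of u. *)
Lemma kraw_neq0 u m l p : p \in [pchar F] -> (2 * m < p)%N -> (2 < p)%N ->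
  u != 0 -> (l <= m)%N -> kraw u m l != 0.
Proof.
move=> charF lt_mp p_gt2 u_neq0; elim: l => [|l IHl] le_lm.
  rewrite kraw0 -mulr_natr mulf_neq0 ?expf_neq0 ?oppr_eq0 //.
  by apply: bin_pchar_neq0 charF lt_mp _; lia.
have two_neq0 : (2 : F) != 0 by apply: natr_pchar_neq0 charF _.
have := kraw_rec u two_neq0 le_lm; apply: contra_eq_neq => ->.
rewrite mul0rn addr0 -mulr_natr mulf_neq0 ?IHl 1?ltnW //.
by apply: natr_pchar_neq0 charF _; lia.
Qed.
End Krawtchouk.

(** * Power sums over a finite field *)

Section PowerSums.
Variable F : finFieldType.

Lemma expf_card1 (x : F) : x != 0 -> x ^+ #|F|.-1 = 1.
Proof.
move=> x0; apply: (mulfI x0); rewrite -exprS prednK ?expf_card ?mulr1 //.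
by rewrite ltnW ?finNzRing_gt1.
Qed.

Lemma card_finField_neq0 : #|[pred x : F | x != 0]| = #|F|.-1.
Proof. by rewrite -(cardC1 (0 : F)); apply: eq_card. Qed.

Lemma finField_generator : exists g : F, #|F|.-1.-primitive_root g.
Proof.
have card_gt1 : (1 < #|F|)%N := finNzRing_gt1 F.
have q_gt0 : (0 < #|F|.-1)%N by rewrite -ltnS prednK // ltnW.
have all_roots : all #|F|.-1.-unity_root (enum [pred x : F | x != 0]).
  apply/allP => x; rewrite mem_enum inE => x0; apply/unity_rootP.
  exact: expf_card1.
have := has_prim_root q_gt0 all_roots (enum_uniq _).
rewrite -cardE card_finField_neq0 leqnn => /(_ isT).
by case/hasP => g _ gP; exists g.
Qed.

Lemma card_finField_natr : #|F|%:R = 0 :> F.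
Proof.
apply: (@addrI _ (\sum_(x : F) x)); rewrite addr0 -sumr_const -big_split /=.
rewrite (reindex_inj (addrI (-1 : F))) /=.
by apply: eq_bigr => x _; rewrite addrAC addNr add0r.
Qed.

Lemma reindex_mulf (V : nmodType) (c : F) (f : F -> V) : c != 0 ->
  \sum_(x : F | x != 0) f (c * x) = \sum_(x : F | x != 0) f x.
Proof.
move=> c0; rewrite [RHS](reindex_inj (mulfI c0)) /=; apply: eq_bigl => x.
by rewrite mulf_eq0 (negPf c0).
Qed.

Lemma sum_powers e :
  \sum_(x : F | x != 0) x ^+ e = if (#|F|.-1 %| e)%N then -1 else 0.
Proof.
have [g gP] := finField_generator; case: ifP => [/dvdnP[k ->]|ndvd].
  rewrite (eq_bigr (fun=> 1)) => [|x x0]; last first.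
    by rewrite mulnC exprM expf_card1 ?expr1n.
  rewrite sumr_const card_finField_neq0; apply: (@addIr _ 1).
  by rewrite addNr -mulrSr prednK ?card_finField_natr // ltnW ?finNzRing_gt1.
have g0 : g != 0 by rewrite (prim_root_eq0 gP) -lt0n (prim_order_gt0 gP).
have : (g ^+ e - 1) * \sum_(x : F | x != 0) x ^+ e = 0.
  rewrite mulrBl mul1r -[X in _ - X](reindex_mulf _ g0) mulr_sumr.
  by apply/eqP; rewrite subr_eq0; apply/eqP; apply: eq_bigr => x _; rewrite exprMn.
move/eqP; rewrite mulf_eq0 subr_eq0 -(prim_order_dvd gP) ndvd.
by move/eqP.
Qed.
End PowerSums.

(** * Power sums along the nonsplit torus *)

Section TorusSum.
Variables (F : finFieldType) (p : nat) (s : F).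
Hypotheses (p_odd : odd p) (charF : p \in [pchar F]) (cardF : #|F| = (p ^ 2)%N).
Hypotheses (s_neq0 : s != 0) .

(** The coordinates of t in the basis (1, s), when s^p = - s. *)
Definition re_part (t : F) := (t + t ^+ p) / 2.
Definition im_part (t : F) := (t - t ^+ p) / (2 * s).

Lemma p_gt2 : (2 < p)%N.
Proof. by have := prime_gt1 (pcharf_prime charF); move: p_odd; case: (p) => [|[|[|]]]. Qed.

Lemma two_neq0 : 2 != 0 :> F.
Proof. by apply: (natr_pchar_neq0 charF); rewrite p_gt2. Qed.

(** The middle coefficient of Sym^(2m) at an element t of the torus. In the
variables X + 1/s and X - 1/s the two rows of the matrix of t become
proportional to the sum and the difference of t (X + 1/s) and t^p (X - 1/s), so
that their product is a difference of two squares. *)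
Lemma sym_coef_torus (t : F) m :
  sym_coef (re_part t) (im_part t) (im_part t * s ^+ 2) (re_part t) (2 * m) m =
  (s / 4) ^+ m * \sum_(l < m.+1)
    (kraw s^-1 m l *+ 'C(m, l)) * (-1) ^+ (m - l)
      * t ^+ (2 * l + 2 * p * (m - l)).
Proof.
rewrite /sym_coef (_ : (2 * m - m = m)%N); last by lia.
set L1 := _ + _; set L2 := _ + _.
set P := 'X + (s^-1)%:P; set Q := 'X - (s^-1)%:P.
have four_neq0 : 4 != 0 :> F.
  by rewrite (_ : 4 = 2 * 2) ?mulf_neq0 ?two_neq0 // -natrM.
pose h : F := 2^-1; pose u := s^-1; pose t' := t ^+ p.
have eL1 : L1 = h%:P * (t%:P * P + t'%:P * Q).
  have -> : L1 = (h * (t + t'))%:P * 'X + (h * (t - t') * u)%:P.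
    by congr (_%:P * _ + _%:P); rewrite /re_part /im_part /h /u /t'; field;
      rewrite ?s_neq0 ?two_neq0.
  by rewrite /P /Q -/u !polyCM polyCB polyCD; ring.
have eL2 : L2 = (s * h)%:P * (t%:P * P - t'%:P * Q).
  have -> : L2 = (s * h * (t - t'))%:P * 'X + (s * h * (t + t') * u)%:P.
    by congr (_%:P * _ + _%:P); rewrite /re_part /im_part /h /u /t'; field;
      rewrite ?s_neq0 ?two_neq0.
  by rewrite /P /Q -/u !polyCM polyCB polyCD; ring.
have eL : L1 * L2 = (s / 4)%:P * (- (t' ^+ 2)%:P * Q ^+ 2 + (t ^+ 2)%:P * P ^+ 2).
  have -> : s / 4 = h * (s * h) by rewrite /h; field; rewrite ?two_neq0.
  by rewrite eL1 eL2 !polyCM !polyC_exp; ring.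
rewrite -exprMn eL exprMn -polyC_exp coefCM; congr (_ * _).
rewrite exprDn coef_sum; apply: eq_bigr => i _.
rewrite coefMn -polyCN; have -> : forall c d : F,
    (c%:P * Q ^+ 2) ^+ (m - i) * (d%:P * P ^+ 2) ^+ i =
    (c ^+ (m - i) * d ^+ i)%:P * (P ^+ (2 * i) * Q ^+ (2 * (m - i))).
  move=> c d; rewrite !exprMn polyCM -!polyC_exp !(exprM _ 2) mulrACA.
  by congr (_ * _); rewrite -!expr2 -!exprM ![(2 * _)%N]mulnC mulrC.
rewrite coefCM -/(kraw _ _ _) -mulrnAr mulrC -!mulrA; congr (_ * _).
rewrite [in LHS]exprNn -mulrA; congr (_ * _).
rewrite /t' -!exprM mulrC -exprD; congr (_ ^+ _).
by rewrite [(p * 2)%N]mulnC.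
Qed.

(** The sum over t keeps the only monomial whose exponent is divisible by
p^2 - 1. *)
Lemma torus_sum (e m l0 : nat) : (2 * m < p)%N -> (l0 <= m)%N ->
  (forall l, (l <= m)%N -> (p ^ 2 - 1 %| e + 2 * l + 2 * p * (m - l))%N = (l == l0)) ->
  \sum_(t : F | t != 0) t ^+ e *
    sym_coef (re_part t) (im_part t) (im_part t * s ^+ 2) (re_part t) (2 * m) m != 0.
Proof.
move=> lt_mp le_l0 dvd_l.
under eq_bigr => t _ do rewrite sym_coef_torus mulrCA mulr_sumr.
rewrite -mulr_sumr exchange_big /= mulf_neq0 //.
  apply: expf_neq0; rewrite mulf_neq0 // invr_eq0.
  by rewrite (_ : 4 = 2 * 2) ?mulf_neq0 ?two_neq0 // -natrM.
rewrite (bigD1 (Ordinal (le_l0 : l0 < m.+1)%N)) //= [X in _ + X]big1 ?addr0 => [|l neq_l].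
  under eq_bigr => t _ do rewrite mulrCA -exprD addnA.
  rewrite -mulr_sumr sum_powers cardF -subn1 dvd_l // eqxx.
  rewrite -mulr_natr !mulf_neq0 ?expf_neq0 ?oppr_eq0 ?oner_eq0 //.
    by rewrite (kraw_neq0 charF) ?p_gt2 ?invr_eq0.
  by rewrite (bin_pchar_neq0 charF) //; lia.
under eq_bigr => t _ do rewrite mulrCA -exprD addnA.
rewrite -mulr_sumr sum_powers cardF -subn1 dvd_l -1?ltnS //.
by rewrite -val_eqE /= in neq_l; rewrite (negPf neq_l) mulr0.
Qed.
End TorusSum.

(** * Matrices of size 2 *)

Section Mx2.
Variable F : comNzRingType.
Implicit Types a b c d e x y : F.

Lemma ord2P (P : 'I_2 -> Prop) : P 0 -> P 1 -> forall i, P i.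
Proof.
move=> P0 P1 [[|[|]]] // lt_i; first by congr P: P0; apply: val_inj.
by congr P: P1; apply: val_inj.
Qed.

Lemma mx2E (A : 'M[F]_2) : A = mx2 (A 0 0) (A 0 1) (A 1 0) (A 1 1).
Proof.
by apply/matrixP; apply: ord2P; apply: ord2P; rewrite !mxE.
Qed.

Lemma mx2_entry a b c d : (mx2 a b c d 0 0 = a) * (mx2 a b c d 0 1 = b) *
  (mx2 a b c d 1 0 = c) * (mx2 a b c d 1 1 = d).
Proof. by rewrite !mxE. Qed.

Lemma mx2M a b c d a' b' c' d' : mx2 a b c d *m mx2 a' b' c' d' =
  mx2 (a * a' + b * c') (a * b' + b * d') (c * a' + d * c') (c * b' + d * d').
Proof.
apply/matrixP => i k; rewrite !mxE big_ord_recl big_ord1 !mxE /=.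
by case: (i == 0); case: (k == 0).
Qed.

Lemma det_mx2 a b c d : \det (mx2 a b c d) = a * d - b * c.
Proof.
rewrite (expand_det_row _ 0) big_ord_recl big_ord1 /cofactor !det_mx11 !mxE /=.
by rewrite /bump /= !expr0 !mul1r expr1 mulN1r mulrN.
Qed.

Lemma scalar_mx2 a : a%:M = mx2 a 0 0 a.
Proof. by apply/matrixP; apply: ord2P; apply: ord2P; rewrite !mxE. Qed.

Lemma scalar_mul_mx2 e a b c d :
  e%:M *m mx2 a b c d = mx2 (e * a) (e * b) (e * c) (e * d).
Proof. by rewrite scalar_mx2 mx2M !mul0r !addr0 !add0r. Qed.

Lemma tr_mx2 a b c d : \tr (mx2 a b c d) = a + d.
Proof. by rewrite /mxtrace big_ord_recl big_ord1 !mxE. Qed.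

Lemma mx2_unipotentM a b d y :
  mx2 1 y 0 1 *m mx2 a b 0 d = mx2 a (b + y * d) 0 d.
Proof. by rewrite mx2M; congr mx2; ring. Qed.

Lemma mx2_diagM x y : mx2 (x * y) 0 0 1 = mx2 x 0 0 1 *m mx2 y 0 0 1.
Proof. by rewrite mx2M; congr mx2; ring. Qed.

Lemma mx2_mul_split a b c d x :
  mx2 a b c d *m mx2 x 0 0 1 = mx2 (a * x) b (c * x) d.
Proof. by rewrite mx2M; congr mx2; ring. Qed.

Lemma mx2_antidiag_split e x :
  mx2 0 1 e 0 *m mx2 x 0 0 1 = mx2 0 1 (e * x) 0.
Proof. by rewrite mx2M; congr mx2; ring. Qed.

Lemma mx2_antidiag_sqr e : mx2 0 1 e 0 *m mx2 0 1 e 0 = e%:M.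
Proof. by rewrite mx2M scalar_mx2; congr mx2; ring. Qed.
End Mx2.

(* Keeps conversion from computing in a prime field when it compares two *)
(* explicit matrices.                                                    *)
Opaque mx2.

Section Mx2Field.
Variable F : fieldType.
Implicit Types a b c d e l m x y : F.

Lemma mx2_unit a b c d : (mx2 a b c d \in unitmx) = (a * d - b * c != 0).
Proof. by rewrite unitmxE det_mx2 unitfE. Qed.

Lemma unipotent_unit y : mx2 1 y 0 1 \in unitmx.
Proof. by rewrite mx2_unit !mulr1 mulr0 subr0 oner_eq0. Qed.

Lemma upper_unit a b d : (mx2 a b 0 d \in unitmx) = (a * d != 0).
Proof. by rewrite mx2_unit mulr0 subr0. Qed.

Lemma scalar_unit x : x != 0 -> (x%:M : 'M_2) \in unitmx.
Proof. by move=> x0; rewrite unitmxE det_scalar unitfE expf_neq0. Qed.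

Lemma unipotent_conj a b d y : a != d ->
  mx2 1 ((y - b) / (a - d)) 0 1 *m mx2 a y 0 d
    = mx2 a b 0 d *m mx2 1 ((y - b) / (a - d)) 0 1.
Proof.
by rewrite -subr_eq0 => ad0; rewrite !mx2M; congr mx2; field.
Qed.

Lemma diag_conj a b y : y != 0 ->
  mx2 (b / y) 0 0 1 *m mx2 a y 0 a = mx2 a b 0 a *m mx2 (b / y) 0 0 1.
Proof. by move=> y0; rewrite !mx2M; congr mx2; field. Qed.

Lemma antidiag_split_comm e x : x != 0 ->
  mx2 0 1 e 0 *m mx2 x 0 0 1 = x%:M *m (mx2 x^-1 0 0 1 *m mx2 0 1 e 0).
Proof. by move=> x0; rewrite scalar_mx2 !mx2M; congr mx2; field. Qed.

(** If c is nonzero, the row (c, l - a) is an eigenvector for l, and becomes the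
second vector of a basis where the matrix is upper triangular. *)
Lemma triangularize a b c d l m : l + m = a + d -> l * m = a * d - b * c ->
  (c = 0 /\ ((a, d) = (l, m) \/ (a, d) = (m, l))) \/
  (c != 0 /\ mx2 0 1 c (l - a) *m mx2 a b c d = mx2 m 1 0 l *m mx2 0 1 c (l - a)).
Proof.
move=> sum_lm prod_lm; have [c0 | c_neq0] := eqVneq c 0; [left | right].
  split => //; move: prod_lm; rewrite c0 mulr0 subr0 => prod_lm.
  have : (a - l) * (a - m) = 0.
    have -> : (a - l) * (a - m) = a * a - a * (l + m) + l * m by ring.
    by rewrite sum_lm prod_lm; ring.
  have -> : d = l + m - a by rewrite sum_lm addrAC subrr add0r.
  move/eqP; rewrite mulf_eq0 !subr_eq0 => /orP[] /eqP ->.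
    by left; rewrite addrAC subrr add0r.
  by right; rewrite addrK.
split => //; have em : m = a + d - l by rewrite -sum_lm addrAC subrr add0r.
move: prod_lm; rewrite em => prod_lm.
have eb : b * c = a * d - l * (a + d - l) by rewrite prod_lm; ring.
by rewrite !mx2M; congr mx2; rewrite ?[c * b]mulrC ?eb; ring.
Qed.

End Mx2Field.

Lemma map_mx2 (F F' : comNzRingType) (f : {rmorphism F -> F'}) a b c d :
  map_mx f (mx2 a b c d) = mx2 (f a) (f b) (f c) (f d).
Proof. by apply/matrixP => i k; rewrite !mxE; do 2!case: (_ == _). Qed.

(** * The quadratic extension of a prime field and its torus *)

(** Gathers the standing hypotheses, so that each lemma below depends on a
single one. *)
Record quadratic_data (p : nat) (Fq : finFieldType)
    (iota : {rmorphism 'F_p -> Fq}) (xi : 'F_p) (s : Fq) : Prop := {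
  qd_prime : prime p;
  qd_odd : odd p;
  qd_card : #|Fq| = (p ^ 2)%N;
  qd_sqr : s ^+ 2 = iota xi;
  qd_trace : s + s ^+ p = 0;
  qd_neq0 : xi != 0 }.

Section QuadraticExtension.
Variables (p : nat) (Fq : finFieldType).
Variables (iota : {rmorphism 'F_p -> Fq}) (xi : 'F_p) (s : Fq).
Hypothesis quadH : quadratic_data iota xi s.
Local Notation p_pr := (qd_prime quadH).
Local Notation p_odd := (qd_odd quadH).
Local Notation cardFq := (qd_card quadH).
Local Notation s2 := (qd_sqr quadH).
Local Notation s_tr0 := (qd_trace quadH).
Local Notation xi_neq0 := (qd_neq0 quadH).

Lemma Fq_char : p \in [pchar Fq].
Proof. exact: card_finPcharP cardFq p_pr. Qed.

Lemma Fp_two_neq0 : 2 != 0 :> 'F_p.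
Proof.
by apply: (natr_pchar_neq0 (pchar_Fp p_pr)); rewrite (p_gt2 p_odd Fq_char).
Qed.

Lemma Fq_two_neq0 : 2 != 0 :> Fq.
Proof. exact: two_neq0 p_odd Fq_char. Qed.

Lemma Fp_expf (x : 'F_p) : x ^+ p = x.
Proof. by rewrite -[X in _ ^+ X](card_Fp p_pr) expf_card. Qed.

Lemma frobD (x y : Fq) : (x + y) ^+ p = x ^+ p + y ^+ p.
Proof. by rewrite -!(GRing.pFrobenius_autE Fq_char) rmorphD. Qed.

Lemma frobN (x : Fq) : (- x) ^+ p = - x ^+ p.
Proof. by rewrite -!(GRing.pFrobenius_autE Fq_char) rmorphN. Qed.

Lemma frobK (x : Fq) : x ^+ p ^+ p = x.
Proof. by rewrite -exprM mulnn -cardFq expf_card. Qed.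

Lemma frob_iota (x : 'F_p) : iota x ^+ p = iota x.
Proof. by rewrite -rmorphXn Fp_expf. Qed.

(** The polynomial X^p - X has at most p roots, and the prime field gives p of
them. *)
Lemma frob_fixed (x : Fq) : x ^+ p = x -> exists y, x = iota y.
Proof.
move=> xp; have [/codomP[y ->]|x_out] := boolP (x \in codom iota); first by exists y.
have p_gt1 := prime_gt1 p_pr.
have sz_pol : size ('X^p - 'X : {poly Fq}) = p.+1.
  by rewrite size_polyDl size_polyXn // size_polyN size_polyX.
have /max_poly_roots/(_ _)/(_ _) : ('X^p - 'X : {poly Fq}) != 0.
  by rewrite -size_poly_eq0 sz_pol.
move/(_ (x :: codom iota)).
rewrite sz_pol /= size_codom (card_Fp p_pr) ltnn x_out map_inj_uniq ?enum_uniq; last first.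
  exact: fmorph_inj.
move=> contra; suff: false by []; apply: contra => //.
rewrite rootE !hornerE xp subrr eqxx /=; apply/allP => _ /codomP[y ->].
by rewrite rootE !hornerE frob_iota subrr.
Qed.

Lemma s_neq0 : s != 0.
Proof.
apply: contraNneq xi_neq0 => s0; have := s2.
by rewrite s0 expr0n /= => /esym/eqP; rewrite fmorph_eq0.
Qed.

Lemma frob_s : s ^+ p = - s.
Proof. by apply/eqP; rewrite -addr_eq0 addrC s_tr0. Qed.

Lemma re_part_fixed t : exists a, re_part p t = iota a.
Proof.
apply: frob_fixed; rewrite /re_part exprMn frobD frobK exprVn addrC.
by rewrite -[2](rmorph_nat iota) frob_iota.
Qed.

Lemma im_part_fixed t : exists a, im_part p s t = iota a.
Proof.
apply: frob_fixed; rewrite /im_part exprMn frobD frobN frobK exprVn.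
rewrite exprMn frob_s -[in LHS](rmorph_nat iota) frob_iota rmorph_nat.
by rewrite mulrN invrN mulrN -mulNr opprB.
Qed.

Definition reF (t : Fq) : 'F_p := odflt 0 [pick a | iota a == re_part p t].
Definition imF (t : Fq) : 'F_p := odflt 0 [pick a | iota a == im_part p s t].

Lemma iota_reF t : iota (reF t) = re_part p t.
Proof.
rewrite /reF; case: pickP => [a /eqP //|none].
by have [a ea] := re_part_fixed t; have := none a; rewrite ea eqxx.
Qed.

Lemma iota_imF t : iota (imF t) = im_part p s t.
Proof.
rewrite /imF; case: pickP => [a /eqP //|none].
by have [a ea] := im_part_fixed t; have := none a; rewrite ea eqxx.
Qed.

Lemma Fq_coord t : t = iota (reF t) + iota (imF t) * s.
Proof.
rewrite iota_reF iota_imF /re_part /im_part; field.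
by rewrite s_neq0 Fq_two_neq0.
Qed.

Lemma frob_coord a b : (iota a + iota b * s) ^+ p = iota a - iota b * s.
Proof. by rewrite frobD exprMn !frob_iota frob_s mulrN. Qed.

Lemma coord_reF a b : reF (iota a + iota b * s) = a.
Proof.
apply: (fmorph_inj iota); rewrite iota_reF /re_part frob_coord; field.
exact: Fq_two_neq0.
Qed.

Lemma coord_imF a b : imF (iota a + iota b * s) = b.
Proof.
apply: (fmorph_inj iota); rewrite iota_imF /im_part frob_coord; field.
by rewrite s_neq0 Fq_two_neq0.
Qed.

Lemma coord_eq0 a b : iota a + iota b * s = 0 -> a = 0 /\ b = 0.
Proof.
move=> ab0; have e0 : iota 0 + iota 0 * s = 0 by rewrite rmorph0 mul0r addr0.
split; first by rewrite -(coord_reF a b) ab0 -e0 coord_reF.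
by rewrite -(coord_imF a b) ab0 -e0 coord_imF.
Qed.

(** The nonzero elements of the prime field are the powers of g^(p+1), for g a
generator of Fq^*, and p + 1 is even. *)
Lemma iota_sqrt (x : 'F_p) : exists z, z ^+ 2 = iota x.
Proof.
have [-> | x0] := eqVneq x 0; first by exists 0; rewrite rmorph0 expr0n.
have [g gP] := finField_generator Fq.
have ix0 : iota x != 0 by rewrite fmorph_eq0.
have [[i _] /= ei] := prim_rootP gP (expf_card1 ix0).
have : (#|Fq|.-1 %| i * p.-1)%N.
  rewrite (prim_order_dvd gP) exprM -ei -rmorphXn.
  by rewrite -[p.-1](congr1 predn (card_Fp p_pr)) expf_card1 ?rmorph1.
have p_gt1 := prime_gt1 p_pr.
have -> : #|Fq|.-1 = (p.+1 * p.-1)%N.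
  by rewrite cardFq -subn1 -[X in (_ - X)%N](exp1n 2) subn_sqr -!subn1 addn1 mulnC.
rewrite dvdn_pmul2r => [dvd_i|]; last by lia.
have : (2 %| i)%N by apply: dvdn_trans dvd_i; rewrite dvdn2 /= p_odd.
by case/dvdnP => h eh; exists (g ^+ h); rewrite -exprM -eh.
Qed.

(** The quadratic formula, with a square root of the discriminant given by
iota_sqrt. *)
Lemma char_roots (T D : 'F_p) : exists z z', z + z' = iota T /\ z * z' = iota D.
Proof.
have [d d2] := iota_sqrt (T ^+ 2 - 4 * D).
have two0 := Fq_two_neq0.
exists ((iota T + d) / 2), ((iota T - d) / 2); split; first by field.
apply: (mulfI (mulf_neq0 two0 two0)).
have -> : 2 * 2 * ((iota T + d) / 2 * ((iota T - d) / 2)) = iota T ^+ 2 - d ^+ 2.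
  by field.
by rewrite d2 rmorphB rmorphXn rmorphM rmorph_nat; ring.
Qed.

(** The matrix of the multiplication by t on Fq, in the basis (1, s). *)
Definition torus_mx (t : Fq) : 'M['F_p]_2 := mx2 (reF t) (imF t) (imF t * xi) (reF t).

Lemma torus_mxM t t' : torus_mx (t * t') = torus_mx t *m torus_mx t'.
Proof.
have coordM : t * t' = iota (reF t * reF t' + imF t * imF t' * xi) +
    iota (reF t * imF t' + imF t * reF t') * s.
  rewrite {1}[t]Fq_coord {1}[t']Fq_coord !rmorphD !rmorphM -s2; ring.
rewrite /torus_mx coordM coord_reF coord_imF mx2M; congr mx2; ring.
Qed.

Lemma iota_det_torus t : iota (\det (torus_mx t)) = t * t ^+ p.
Proof.
rewrite det_mx2 rmorphB !rmorphM -s2 [in RHS](Fq_coord t) frob_coord; ring.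
Qed.

Lemma torus_unit t : t != 0 -> torus_mx t \in unitmx.
Proof.
move=> t0; rewrite unitmxE unitfE -(fmorph_eq0 iota) iota_det_torus.
by rewrite mulf_neq0 ?expf_neq0.
Qed.

Lemma torus_mx_iota x : torus_mx (iota x) = x%:M.
Proof.
have e : iota x = iota x + iota 0 * s by rewrite rmorph0 mul0r addr0.
by rewrite /torus_mx e coord_reF coord_imF mul0r scalar_mx2.
Qed.

Lemma torus_mx_s : torus_mx s = mx2 0 1 xi 0.
Proof.
have e : s = iota 0 + iota 1 * s by rewrite rmorph0 rmorph1 mul1r add0r.
by rewrite /torus_mx [X in reF X]e [X in imF X]e coord_reF coord_imF mul1r.
Qed.

End QuadraticExtension.

(** * Projectors of rank one *)

Lemma trace_idempotent (K : fieldType) n (A : 'M[K]_n) :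
  A *m A = A -> \tr A = (\rank A)%:R.
Proof.
move=> AA; have [C CB] := row_fullP (col_base_full A).
have [D RD] := row_freeP (row_base_free A).
move: (col_base A) (row_base A) (mulmx_base A) CB RD => c r crA CB RD.
have rc : r *m c = 1%:M.
  have : C *m (c *m r *m (c *m r)) *m D = C *m (c *m r) *m D by rewrite crA AA.
  by rewrite !mulmxA CB mul1mx -!mulmxA RD mulmx1.
by rewrite -{1}crA mxtrace_mulC rc mxtrace1.
Qed.

(** In characteristic zero such a projector A is a column times a row. *)
Lemma idempotent_tr1_sandwich (K : numFieldType) n (A M : 'M[K]_n) :
  A *m A = A -> \tr A = 1 -> A *m M *m A = \tr (M *m A) *: A.
Proof.
move=> AA trA; have rA : \rank A = 1%N.
  by apply/eqP; rewrite -(eqr_nat K) -trace_idempotent ?trA.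
have [c [r ->]] : exists (c : 'cV[K]_n) (r : 'rV[K]_n), A = c *m r.
  by move: (mulmx_base A); move: (col_base A) (row_base A); rewrite rA => c r <-; exists c, r.
have -> : c *m r *m M *m (c *m r) = c *m (r *m M *m c) *m r by rewrite !mulmxA.
rewrite [r *m M *m c]mx11_scalar mul_mx_scalar -scalemxAl; congr (_ *: _).
by rewrite mulmxA mxtrace_mulC mulmxA /mxtrace big_ord1.
Qed.

(** * The character of the cuspidal representation *)

Lemma mulcharM (F K : fieldType) (c : F -> K) : mulchar c ->
  forall x y, c (x * y) = c x * c y.
Proof. by case. Qed.

Lemma mulcharX (F K : fieldType) (c : F -> K) x n : mulchar c ->
  c (x ^+ n) = c x ^+ n.
Proof.
by move=> [_ c1 cM]; elim: n => [|n IHn]; rewrite ?expr0 ?c1 // !exprS cM IHn.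
Qed.

Lemma triv_mulchar (F C : fieldType) : mulchar (triv_char F C).
Proof.
split; rewrite /triv_char ?eqxx ?oner_eq0 // => z z'.
by rewrite mulf_eq0 negb_or -natrM mulnb.
Qed.

Record cuspidal_data (p : nat) (Fq : finFieldType)
    (iota : {rmorphism 'F_p -> Fq}) (xi : 'F_p) (s : Fq)
    (C : numFieldType) (nu : Fq -> C)
    (rho : mx_representation C [set: {'GL_2['F_p]}] p.-1) : Prop := {
  cd_quad : quadratic_data iota xi s;
  cd_char : mulchar nu;
  cd_iota : forall x : 'F_p, x != 0 -> nu (iota x) = 1;
  cd_cusp : cuspidal_repr iota nu rho }.

Section Cuspidal.
Variables (p : nat) (Fq : finFieldType).
Variables (iota : {rmorphism 'F_p -> Fq}) (xi : 'F_p) (s : Fq).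
Variables (C : numFieldType) (nu : Fq -> C).
Variable rho : mx_representation C [set: {'GL_2['F_p]}] p.-1.
Hypothesis cuspH : cuspidal_data iota xi s nu rho.
Local Notation quadH := (cd_quad cuspH).
Local Notation p_pr := (qd_prime quadH).
Local Notation xi_neq0 := (qd_neq0 quadH).
Local Notation s2 := (qd_sqr quadH).
Local Notation nu_char := (cd_char cuspH).
Local Notation nu_iota := (cd_iota cuspH).
Local Notation rho_cusp := (cd_cusp cuspH).

(** Total, with value 1 at singular matrices, to avoid carrying invertibility
proofs inside terms. *)
Definition gl (A : 'M['F_p]_2) : {'GL_2['F_p]} := insubd (1%g : {'GL_2['F_p]}) A.
Definition rhoM (A : 'M['F_p]_2) : 'M[C]_(p.-1) := rho (gl A).

Lemma glK A : A \in unitmx -> GLval (gl A) = A.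
Proof. by move=> uA; apply: (insubdK (1%g : {'GL_2['F_p]})). Qed.

Lemma GLvalK (g : {'GL_2['F_p]}) : gl (GLval g) = g.
Proof. exact: valKd. Qed.

Lemma rhoM_GLval (g : {'GL_2['F_p]}) : rhoM (GLval g) = rho g.
Proof. by rewrite /rhoM GLvalK. Qed.

Lemma rhoM_mul A B : A \in unitmx -> B \in unitmx ->
  rhoM (A *m B) = rhoM A *m rhoM B.
Proof.
move=> uA uB; rewrite /rhoM -repr_mxM ?inE //; congr (rho _).
by apply: val_inj; rewrite /= glK ?unitmx_mul ?uA // -[in LHS](glK uA) -[in LHS](glK uB).
Qed.

Lemma rhoM_scalar x : x != 0 -> rhoM x%:M = 1%:M.
Proof.
move=> x0; have ux : (x%:M : 'M['F_p]_2) \in unitmx.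
  by rewrite unitmxE det_scalar unitfE expf_neq0.
by rewrite /rhoM (cuspidal_central rho_cusp (glK ux)) nu_iota.
Qed.

(* Keeps conversion from unfolding rhoM on explicit matrices. *)
Opaque rhoM.

Lemma rhoM1 : rhoM 1%:M = 1%:M.
Proof. by rewrite rhoM_scalar ?oner_eq0. Qed.

Definition theta A := \tr (rhoM A).

Lemma theta_conj P A B : P \in unitmx -> A \in unitmx -> B \in unitmx ->
  P *m A = B *m P -> theta A = theta B.
Proof.
move=> uP uA uB PA; rewrite /theta.
have uV : invmx P \in unitmx by rewrite unitmx_inv.
have -> : A = invmx P *m (B *m P) by rewrite -PA mulKmx.
rewrite rhoM_mul ?unitmx_mul ?uB // rhoM_mul // mxtrace_mulC -mulmxA.
by rewrite -rhoM_mul // mulmxV // rhoM1 mulmx1.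
Qed.

(** The columns of this sum are fixed by the upper unipotent group. *)
Lemma unipotent_sum : \sum_(y : 'F_p) rhoM (mx2 1 y 0 1) = 0.
Proof.
have shift (z : 'F_p) : rhoM (mx2 1 z 0 1) *m (\sum_(y : 'F_p) rhoM (mx2 1 y 0 1))
    = \sum_(y : 'F_p) rhoM (mx2 1 y 0 1).
  rewrite mulmx_sumr [RHS](reindex_inj (addrI z)) /=; apply: eq_bigr => y _.
  rewrite -(rhoM_mul (unipotent_unit z) (unipotent_unit y)).
  by rewrite mx2_unipotentM mulr1 addrC.
have col0 k : (\sum_(y : 'F_p) rhoM (mx2 1 y 0 1)) *m delta_mx k (0 : 'I_1) = 0.
  apply: (cuspidal_unipotent rho_cusp) => g z eg.
  by rewrite mulmxA -rhoM_GLval eg shift.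
apply/matrixP => i k; have := congr1 (fun M : 'cV_ _ => M i 0) (col0 k).
by rewrite -colE !mxE.
Qed.

Lemma theta_upper_sum (a d : 'F_p) : a * d != 0 ->
  \sum_(y : 'F_p) theta (mx2 a y 0 d) = 0.
Proof.
move=> ad0; have d0 : d != 0 by move: ad0; rewrite mulf_eq0 negb_or => /andP[].
have uD : mx2 a 0 0 d \in unitmx by rewrite upper_unit.
rewrite (reindex_inj (mulIf d0)) /=.
have step (y : 'F_p) : theta (mx2 a (y * d) 0 d) =
    \tr (rhoM (mx2 1 y 0 1) *m rhoM (mx2 a 0 0 d)).
  by rewrite -(rhoM_mul (unipotent_unit y) uD) mx2_unipotentM add0r.
under eq_bigr => y _ do rewrite step.
by rewrite -raddf_sum -mulmx_suml unipotent_sum mul0mx raddf0.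
Qed.

(** All the upper triangular matrices with these diagonal entries are
conjugate, and theta sums to zero over them. *)
Lemma theta_split_upper (a b d : 'F_p) : a * d != 0 -> a != d ->
  theta (mx2 a b 0 d) = 0.
Proof.
move=> ad0 neq_ad.
have all_eq (y : 'F_p) : theta (mx2 a y 0 d) = theta (mx2 a b 0 d).
  by apply: theta_conj (unipotent_conj b y neq_ad);
    rewrite ?unipotent_unit ?upper_unit.
have := theta_upper_sum ad0; under eq_bigr do rewrite all_eq.
rewrite sumr_const => /eqP; rewrite mulrn_eq0 (card_Fp p_pr).
by rewrite (gtn_eqF (prime_gt0 p_pr)) => /eqP.
Qed.

Lemma theta_scalar (x : 'F_p) : x != 0 -> theta x%:M = p.-1%:R.
Proof. by move=> x0; rewrite /theta rhoM_scalar // mxtrace1. Qed.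

(** The p - 1 matrices with diagonal (a, a) and nonzero upper right entry are
conjugate, and together with the scalar matrix they contribute zero. *)
Lemma theta_unipotent (a b : 'F_p) : a != 0 -> b != 0 -> theta (mx2 a b 0 a) = -1.
Proof.
move=> a0 b0; have aa0 : a * a != 0 by rewrite mulf_neq0.
have := theta_upper_sum aa0; rewrite (bigD1 0) //= -scalar_mx2 theta_scalar //.
have all_eq (y : 'F_p) : y != 0 -> theta (mx2 a y 0 a) = theta (mx2 a b 0 a).
  move=> y0; apply: theta_conj (diag_conj a b y0);
    by rewrite upper_unit // mulr1 mulf_neq0 ?invr_eq0.
rewrite (eq_bigr _ all_eq) sumr_const card_finField_neq0 (card_Fp p_pr) => /eqP.
rewrite -mulrnDl mulrn_eq0 gtn_eqF /=.
  by rewrite addrC addr_eq0 => /eqP.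
by rewrite -subn1 subn_gt0 (prime_gt1 p_pr).
Qed.

Lemma theta_triangularize A (l m : 'F_p) : A \in unitmx ->
  l + m = \tr A -> l * m = \det A ->
  exists a b d, theta A = theta (mx2 a b 0 d) /\
    ((a, d) = (l, m) \/ (a, d) = (m, l)).
Proof.
rewrite (mx2E A); move: (A 0 0) (A 0 1) (A 1 0) (A 1 1) => a b c d uA.
rewrite tr_mx2 det_mx2 => sum_lm prod_lm.
have [[c0 ad]|[c0 conj]] := triangularize sum_lm prod_lm.
  by exists a, b, d; rewrite c0.
exists m, 1, l; split; last by right.
have uP : mx2 0 1 c (l - a) \in unitmx by rewrite mx2_unit mul0r mul1r sub0r oppr_eq0.
have uB : mx2 m 1 0 l \in unitmx.
  by rewrite upper_unit (mulrC m l) prod_lm -(mx2_unit a b c d); exact: uA.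
exact: theta_conj uP uA uB conj.
Qed.

Lemma theta_split A l m : A \in unitmx -> l + m = \tr A -> l * m = \det A ->
  l != m -> theta A = 0.
Proof.
move=> uA sum_lm prod_lm neq_lm; have lm0 : l * m != 0.
  by rewrite prod_lm -unitfE -unitmxE.
have [a [b [d [-> [] [-> ->]]]]] := theta_triangularize uA sum_lm prod_lm.
  by rewrite theta_split_upper.
by rewrite theta_split_upper 1?mulrC // eq_sym.
Qed.

Lemma theta_double A l : A \in unitmx -> l + l = \tr A -> l * l = \det A ->
  theta A = p.-1%:R \/ theta A = -1.
Proof.
move=> uA sum_lm prod_lm; have l0 : l != 0.
  by move: uA; rewrite unitmxE -prod_lm unitfE mulf_eq0 orbb.
have [a [b [d [-> eq_ad]]]] := theta_triangularize uA sum_lm prod_lm.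
have {eq_ad} [-> ->] : a = l /\ d = l by case: eq_ad => -[].
have [-> | b0] := eqVneq b 0; last by right; apply: theta_unipotent.
by left; rewrite -scalar_mx2 theta_scalar.
Qed.

(** The row (c, z - a) is an eigenvector for z, nonzero as z is not in the prime
field. *)
Lemma theta_elliptic A z : A \in unitmx -> z \notin codom iota ->
  z ^+ 2 - iota (\tr A) * z + iota (\det A) = 0 ->
  theta A = - (nu z + nu z ^+ p).
Proof.
move=> uA z_out root_z; have := cuspidal_trace rho_cusp z_out (g := gl A).
rewrite -rhoM_GLval (glK uA); apply.
move: uA root_z; rewrite (mx2E A).
move: (A 0 0) (A 0 1) (A 1 0) (A 1 1) => a b c d _.
rewrite tr_mx2 det_mx2 map_mx2 rmorphD rmorphB !rmorphM => root_z.
have e : iota b * iota c = z ^+ 2 - (iota a + iota d) * z + iota a * iota d.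
  by rewrite -[RHS]subr0 -root_z; ring.
apply/eigenvalueP; exists (\row_k (if k == 0 then iota c else z - iota a)).
  apply/rowP; apply: ord2P; rewrite !mxE big_ord_recl big_ord1 !mx2_entry !mxE /=.
    by ring.
  by rewrite [iota c * _]mulrC e; ring.
apply/eqP => /rowP/(_ 1); rewrite !mxE /= => /eqP; rewrite subr_eq0 => /eqP za.
by rewrite za codom_f in z_out.
Qed.

(** * The element w on the eigenlines of the split torus *)

Definition split_mx (x : 'F_p) : 'M['F_p]_2 := mx2 x 0 0 1.
Local Notation w := (mx2 0 1 xi 0 : 'M['F_p]_2).

Lemma split_unit x : x != 0 -> split_mx x \in unitmx.
Proof. by move=> x0; rewrite upper_unit mulr1. Qed.

Lemma w_unit : w \in unitmx.
Proof. by rewrite mx2_unit mulr0 mul1r sub0r oppr_eq0 xi_neq0. Qed.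

Lemma split_mxM x y : split_mx (x * y) = split_mx x *m split_mx y.
Proof. exact: mx2_diagM. Qed.

Lemma nu_s_sqr : nu s ^+ 2 = 1.
Proof. by rewrite -(mulcharX _ _ nu_char) s2 nu_iota ?xi_neq0. Qed.

(** Let z be a square root of xi x in Fq, hence an eigenvalue of w d(x). If z is
in the prime field then w d(x) is split. Otherwise z/s is fixed by Frobenius, so
that z is s up to the prime field, where nu is trivial, and x is a square. *)
Lemma theta_w_split x : x != 0 ->
  theta (w *m split_mx x) = 0 \/
  theta (w *m split_mx x) = - (nu s *+ 2) /\ exists y, x = y ^+ 2.
Proof.
move=> x0; have uA : w *m split_mx x \in unitmx.
  by rewrite unitmx_mul w_unit split_unit.
have xix0 : xi * x != 0 by rewrite mulf_neq0 ?xi_neq0.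
have e : w *m split_mx x = mx2 0 1 (xi * x) 0 by exact: mx2_antidiag_split.
have [z z2] := iota_sqrt quadH (xi * x).
have z0 : z != 0.
  by apply: contraNneq xix0 => z0; move: z2; rewrite z0 expr0n /= => /esym/eqP; rewrite fmorph_eq0.
have : (z ^+ p) ^+ 2 = z ^+ 2 by rewrite exprAC z2 (frob_iota quadH).
move/eqP; rewrite eqf_sqr => /orP[] /eqP zp.
  have [y ey] := frob_fixed quadH zp; left.
  have y0 : y != 0 by rewrite -(fmorph_eq0 iota) -ey.
  have y2 : y ^+ 2 = xi * x by apply: (fmorph_inj iota); rewrite rmorphXn -ey.
  apply: (theta_split uA (l := y) (m := - y)).
  - by rewrite e tr_mx2 subrr addr0.
  - by rewrite e det_mx2 mulrN -expr2 y2 mul0r sub0r mul1r.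
  rewrite -addr_eq0 -mulr2n -mulr_natl mulf_neq0 //.
  exact: Fp_two_neq0 quadH.
right.
have z_out : z \notin codom iota.
  apply/negP => /codomP[y ey]; move: zp; rewrite ey (frob_iota quadH) -ey => /eqP.
  rewrite -addr_eq0 -mulr2n -mulr_natl mulf_eq0 (negPf z0) orbF.
  by rewrite (negPf (Fq_two_neq0 quadH)).
have [y ey] : exists y, z / s = iota y.
  apply: (frob_fixed quadH); rewrite exprMn exprVn zp (frob_s quadH).
  by rewrite invrN mulrNN.
have s0 := s_neq0 quadH.
have {}ey : z = iota y * s by rewrite -ey divfK.
have y0 : y != 0 by apply: contraNneq z0 => y0; rewrite ey y0 rmorph0 mul0r.
have nuz : nu z = nu s by rewrite ey (mulcharM nu_char) nu_iota // mul1r.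
split; last first.
  exists y; apply: (mulfI xi_neq0); apply: (fmorph_inj iota).
  by rewrite -z2 ey exprMn s2 -rmorphXn -rmorphM mulrC.
rewrite (theta_elliptic uA z_out); last first.
  by rewrite e tr_mx2 det_mx2 addr0 rmorph0 mul0r subr0 mulr0 sub0r rmorphN mul1r z2 subrr.
rewrite -(mulcharX _ _ nu_char) zp.
have -> : - z = iota (-1) * z by rewrite rmorphN1 mulN1r.
rewrite (mulcharM nu_char).
by rewrite nu_iota ?oppr_eq0 ?oner_eq0 // mul1r nuz mulr2n.
Qed.

Section SplitProjector.
Variable mu : 'F_p -> C.
Hypotheses (mu_char : mulchar mu) (mu_sqr : forall x, x != 0 -> mu x ^+ 2 = 1).

(** The projector to the mu-eigenspace of the split torus, as mu is its own
inverse. *)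
Definition split_proj : 'M[C]_(p.-1) :=
  p.-1%:R^-1 *: \sum_(x | x != 0) mu x *: rhoM (split_mx x).

Lemma mu_inv x : x != 0 -> mu x^-1 = mu x.
Proof.
move=> x0; apply: (@mulfI _ (mu x)).
  by apply: contra_eq_neq (mu_sqr x0) => ->; rewrite expr0n /= eq_sym oner_eq0.
by rewrite -mulcharM // divff // -expr2 mu_sqr //; case: mu_char.
Qed.

Lemma pred_p_neq0 : p.-1%:R != 0 :> C.
Proof. by rewrite pnatr_eq0 -lt0n -subn1 subn_gt0 (prime_gt1 p_pr). Qed.

Lemma split_proj_absorb x : x != 0 ->
  rhoM (split_mx x) *m split_proj = mu x *: split_proj.
Proof.
move=> x0; rewrite /split_proj -scalemxAr [RHS]scalerA mulrC -scalerA; congr (_ *: _).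
rewrite mulmx_sumr -[in RHS](reindex_mulf _ x0) scaler_sumr; apply: eq_bigr => y y0.
rewrite -scalemxAr -rhoM_mul ?split_unit // -split_mxM scalerA; congr (_ *: _).
by rewrite mulcharM // mulrA -expr2 mu_sqr // mul1r.
Qed.

Lemma split_proj_idem : split_proj *m split_proj = split_proj.
Proof.
rewrite {1}/split_proj -scalemxAl mulmx_suml.
under eq_bigr => x x0 do rewrite -scalemxAl split_proj_absorb // scalerA -expr2 mu_sqr // scale1r.
rewrite sumr_const card_finField_neq0 (card_Fp p_pr) -scaler_nat scalerA mulVf ?scale1r //.
exact: pred_p_neq0.
Qed.

Lemma split_proj_fix (u : 'cV[C]_(p.-1)) :
  (forall x, x != 0 -> rhoM (split_mx x) *m u = mu x *: u) -> split_proj *m u = u.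
Proof.
move=> u_mu; rewrite /split_proj -scalemxAl mulmx_suml.
under eq_bigr => x x0 do rewrite -scalemxAl u_mu // scalerA -expr2 mu_sqr // scale1r.
rewrite sumr_const card_finField_neq0 (card_Fp p_pr) -scaler_nat scalerA mulVf ?scale1r //.
exact: pred_p_neq0.
Qed.

(** Only x = 1 contributes, since theta is zero at the other diag(x, 1). *)
Lemma split_proj_tr : \tr split_proj = 1.
Proof.
rewrite /split_proj mxtraceZ raddf_sum (bigD1 1) ?oner_eq0 //= big1 => [|x /andP[x0 x1]].
  rewrite mxtraceZ addr0 (_ : mu 1 = 1); last by case: mu_char.
  by rewrite mul1r /split_mx -scalar_mx2 -/(theta _) (theta_scalar (oner_neq0 _)) mulVf // pred_p_neq0.
by rewrite mxtraceZ -/(theta _) theta_split_upper ?mulr0 ?mulr1.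
Qed.

Lemma w_split x : x != 0 -> w *m split_mx x = x%:M *m (split_mx x^-1 *m w).
Proof.
exact: antidiag_split_comm.
Qed.

(** Conjugation by w maps diag(x, 1) to x diag(x^-1, 1), and scalars act
trivially. *)
Lemma w_split_proj : rhoM w *m split_proj = split_proj *m rhoM w.
Proof.
rewrite /split_proj -scalemxAr -scalemxAl; congr (_ *: _).
rewrite mulmx_sumr mulmx_suml [RHS](reindex_inj invr_inj) /=.
rewrite [RHS](eq_bigl (fun x => x != 0)); last by move=> x; rewrite invr_eq0.
apply: eq_bigr => x x0; rewrite -scalemxAr -scalemxAl (mu_inv x0).
have ux := scalar_unit x0.
have uV : split_mx x^-1 \in unitmx by rewrite split_unit ?invr_eq0.
have uVw : split_mx x^-1 *m w \in unitmx by rewrite unitmx_mul uV w_unit.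
have split_eq : rhoM (w *m split_mx x) = rhoM (split_mx x^-1) *m rhoM w.
  by rewrite (w_split x0) (rhoM_mul ux uVw) (rhoM_scalar x0) mul1mx (rhoM_mul uV w_unit).
apply: (congr1 (fun M => mu x *: M)).
exact: etrans (esym (rhoM_mul w_unit (split_unit x0))) split_eq.
Qed.

(** The eigenvalue la of w on the line squares to 1, because w^2 is scalar. By
theta_w_split, la nu(s) is an average of the values 0 and - 2, so that
la nu(s) = - 1. *)
Lemma w_split_proj_eigen : rhoM w *m split_proj = - nu s *: split_proj.
Proof.
have proj_neq0 : split_proj != 0.
  apply/eqP => proj0; have := split_proj_tr; rewrite proj0 mxtrace0 => /eqP.
  by rewrite eq_sym oner_eq0.
pose la := \tr (rhoM w *m split_proj).
have la_eq : rhoM w *m split_proj = la *: split_proj.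
  rewrite -(idempotent_tr1_sandwich _ split_proj_idem split_proj_tr).
  by rewrite -w_split_proj -mulmxA split_proj_idem.
have la_sqr : la ^+ 2 = 1.
  have : rhoM w *m (rhoM w *m split_proj) = split_proj.
    rewrite mulmxA -rhoM_mul ?w_unit // mx2_antidiag_sqr.
    by rewrite rhoM_scalar ?xi_neq0 // mul1mx.
  rewrite la_eq -scalemxAr la_eq scalerA -expr2 => /eqP.
  rewrite -subr_eq0 -[X in _ - X]scale1r -scalerBl scaler_eq0 (negPf proj_neq0) orbF.
  by rewrite subr_eq0 => /eqP.
have la_nu : la * nu s <= 0.
  rewrite /la /split_proj -scalemxAr mxtraceZ mulmx_sumr raddf_sum /= -mulrA mulr_suml.
  rewrite pmulr_rle0 ?invr_gt0 ?lt0r ?pred_p_neq0 ?ler0n //.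
  apply: sumr_le0 => x x0; rewrite -scalemxAr mxtraceZ -rhoM_mul ?w_unit ?split_unit //.
  rewrite -/(theta _); have [-> | [-> [y ey]]] := theta_w_split x0.
    by rewrite mulr0 mul0r.
  have y0 : y != 0 by apply: contraNneq x0 => y0; rewrite ey y0 expr0n.
  rewrite ey mulcharX // mu_sqr // mul1r mulNr mulrnAl -expr2 nu_s_sqr.
  by rewrite oppr_le0 ler0n.
rewrite la_eq; congr (_ *: _).
have : (la * nu s) ^+ 2 = 1 ^+ 2 by rewrite exprMn la_sqr nu_s_sqr mulr1 expr1n.
move/eqP; rewrite eqf_sqr => /orP[] /eqP la1.
  by move: la_nu; rewrite la1 ler10.
by rewrite -[LHS]mulr1 -nu_s_sqr expr2 mulrA la1 mulN1r.
Qed.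

End SplitProjector.
End Cuspidal.

(** * Reduction of algebraic integers *)

Section ReductionBasics.
Variables (C : numFieldType) (k : fieldType) (p : nat) (red : C -> k).
Hypothesis redH : prime_over p red.
Local Notation int_over := (integralOver (intr : int -> C)).

Lemma red0 : red 0 = 0.
Proof.
apply: (@addrI _ (red 0)); rewrite addr0 -(prime_overD redH) ?addr0 //;
  exact: (integral0 intr).
Qed.

Lemma integral_unity_root (x : C) n : (0 < n)%N -> x ^+ n = 1 -> int_over x.
Proof.
move=> n_gt0 xn; apply: (@integral_root_monic _ _ _ _ ('X^n - 1)).
- by rewrite -[1]polyC1 monicXnsubC.
- by rewrite rootE !hornerE xn subrr.
apply/integral_poly => i; rewrite coefB coefXn coef1.
by apply: integral_sub; apply: integral_nat.
Qed.

Lemma red_sum (I : Type) (r : seq I) (P : pred I) (f : I -> C) :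
  (forall i, P i -> int_over (f i)) ->
  int_over (\sum_(i <- r | P i) f i) /\
  red (\sum_(i <- r | P i) f i) = \sum_(i <- r | P i) red (f i).
Proof.
move=> int_f; elim: r => [|i r [IH1 IH2]].
  by rewrite !big_nil red0; split => //; apply: (integral0 intr).
rewrite !big_cons; case: ifP => // Pi; split.
  exact: (integral_add (int_f _ Pi)).
by rewrite (prime_overD redH) ?IH2 //; apply: int_f.
Qed.

Lemma redN x : int_over x -> red (- x) = - red x.
Proof.
move=> int_x; apply/eqP; rewrite -addr_eq0 addrC.
rewrite -(prime_overD redH) ?subrr ?red0 //; exact: integral_opp.
Qed.

Lemma redX x n : int_over x -> red (x ^+ n) = red x ^+ n.
Proof.
move=> int_x; suff [] : int_over (x ^+ n) /\ red (x ^+ n) = red x ^+ n by [].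
elim: n => [|n [IH1 IH2]].
  by rewrite !expr0 (prime_over1 redH); split => //; apply: (integral1 intr).
rewrite !exprS (prime_overM redH) ?IH2 //; split => //.
exact: integral_mul.
Qed.

Lemma red_pred_p : (0 < p)%N -> red p.-1%:R = -1.
Proof.
move=> p_gt0; apply/eqP; rewrite -addr_eq0 -(prime_over1 redH).
rewrite -(prime_overD redH) -?mulrSr ?prednK ?(prime_over_p redH) //.
  exact: (integral_nat intr).
exact: (integral1 intr).
Qed.

End ReductionBasics.

(** * Labels of the characters trivial on the prime field *)

Section Labels.
Variables (p : nat) (Fq : finFieldType).
Variables (iota : {rmorphism 'F_p -> Fq}) (xi : 'F_p) (s : Fq).
Hypothesis quadH : quadratic_data iota xi s.
Local Notation p_pr := (qd_prime quadH).
Local Notation p_odd := (qd_odd quadH).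
Local Notation cardFq := (qd_card quadH).
Variables (C : numFieldType) (k : fieldType) (red : C -> k).
Variable (j : {rmorphism Fq -> k}).
Hypothesis redH : prime_over p red.
Local Notation int_over := (integralOver (intr : int -> C)).

Lemma integral_mulchar (F : finFieldType) (chi : F -> C) x : mulchar chi -> int_over (chi x).
Proof.
move=> chi_char; have [-> | x0] := eqVneq x 0.
  by case: chi_char => -> _ _; apply: (integral0 intr).
apply: (@integral_unity_root _ _ #|F|.-1).
  by rewrite -subn1 subn_gt0 finNzRing_gt1.
by rewrite -(mulcharX _ _ chi_char) expf_card1 //; case: chi_char.
Qed.

Lemma pred_card_Fq : #|Fq|.-1 = (p.-1 * p.+1)%N.
Proof.
rewrite cardFq -subn1 -[X in (_ - X)%N](exp1n 2) subn_sqr subn1 addn1.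
by rewrite mulnC.
Qed.

Definition trivial_on_Fp (chi : Fq -> C) := forall x : 'F_p, x != 0 -> chi (iota x) = 1.

(** A character trivial on the prime field factors through t |-> t^(p-1), hence
the factor p - 1 in the exponent; then 0 <= e <= p determines e. *)
Definition red_exponent (chi : Fq -> C) (e : nat) :=
  forall t, t != 0 -> red (chi t) = j t ^+ (p.-1 * e).

Lemma norm_in_Fp t : exists x, t ^+ p.+1 = iota x.
Proof.
by apply: (frob_fixed quadH); rewrite exprS exprMn (frobK quadH) mulrC.
Qed.

(** For a generator g of Fq^*, red (chi g) is a (p+1)-st root of unity, hence a
power of the image of g^(p-1), which is a primitive one. *)
Lemma exponent_exists chi : mulchar chi -> trivial_on_Fp chi ->
  exists2 e, (e <= p)%N & red_exponent chi e.
Proof.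
move=> chi_char chi_Fp; have [g gP] := finField_generator Fq.
have p1_gt0 : (0 < p.-1)%N by rewrite -subn1 subn_gt0 (prime_gt1 p_pr).
have gpP : p.+1.-primitive_root (j g ^+ p.-1).
  rewrite -rmorphXn fmorph_primitive_root.
  have -> : p.-1 = (#|Fq|.-1 %/ p.+1)%N by rewrite pred_card_Fq mulnK.
  by apply: (dvdn_prim_root gP); rewrite pred_card_Fq dvdn_mull.
have g0 : g != 0 by rewrite (prim_root_eq0 gP) -lt0n (prim_order_gt0 gP).
have red_g : red (chi g) ^+ p.+1 = 1.
  rewrite -(redX redH _ (integral_mulchar g chi_char)) -(mulcharX _ _ chi_char).
  have [x ex] := norm_in_Fp g.
  rewrite ex chi_Fp ?(prime_over1 redH) //.
  by rewrite -(fmorph_eq0 iota) -ex expf_neq0.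
have [[e lt_e] /= ee] := prim_rootP gpP red_g.
exists e => // t t0; have [[i _] /= ei] := prim_rootP gP (expf_card1 t0).
rewrite ei (mulcharX _ _ chi_char) (redX redH _ (integral_mulchar g chi_char)) ee rmorphXn.
by rewrite -!exprM mulnA mulnC.
Qed.

Lemma j_generator_eq (e e' : nat) : (e < #|Fq|.-1)%N -> (e' < #|Fq|.-1)%N ->
  (forall t, t != 0 -> j t ^+ e = j t ^+ e') -> e = e'.
Proof.
move=> lt_e lt_e' eq_j; have [g gP] := finField_generator Fq.
have g0 : g != 0 by rewrite (prim_root_eq0 gP) -lt0n (prim_order_gt0 gP).
have := eq_j g g0; rewrite -!rmorphXn => /fmorph_inj/eqP.
by rewrite (eq_prim_root_expr gP) !modn_small // => /eqP.
Qed.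

Lemma label_bound r r' : (r <= p.-1)%N -> (r' <= p.-1)%N ->
  (r, r') != (p.-1, p.-1) -> (r + p * r' < #|Fq|.-1)%N.
Proof.
move=> le_r le_r' neq; rewrite pred_card_Fq.
have p_gt1 := prime_gt1 p_pr.
have [p' ep] : exists p', p = p'.+1 by exists p.-1; lia.
have : (r < p.-1)%N || (r' < p.-1)%N.
  by apply: contraNT neq; rewrite negb_or xpair_eqE; lia.
by rewrite ep /= in le_r le_r' * => /orP[]; nia.
Qed.

(** Both exponents are less than the order of Fq^*. *)
Lemma label_exponent chi r r' e : (e <= p)%N -> red_exponent chi e ->
  label p red j chi r r' -> (r + p * r' = p.-1 * e)%N.
Proof.
move=> le_e exp_e [le_r le_r' neq lab]; apply: j_generator_eq.
- exact: label_bound.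
- rewrite pred_card_Fq ltn_pmul2l ?ltnS // -subn1 subn_gt0; exact: prime_gt1 p_pr.
- by move=> t t0; rewrite -lab // exp_e.
Qed.

(** For e > 0, take (r, s) = (p - e, e - 1). *)
Lemma exponent_label chi e : (e <= p)%N -> red_exponent chi e ->
  exists r r', label p red j chi r r' /\ (r + p * r' = p.-1 * e)%N.
Proof.
move=> le_e exp_e; have p_gt1 := prime_gt1 p_pr.
have [e0 | e_gt0] := posnP e.
  exists 0%N, 0%N; rewrite e0 !muln0; split => //; split => //.
    by rewrite xpair_eqE; apply/negP => /andP[/eqP]; lia.
  by move=> t t0; rewrite exp_e // e0 !muln0.
have eE : (p - e + p * e.-1 = p.-1 * e)%N.
  have [d ed] : exists d, p = (e + d)%N by exists (p - e)%N; lia.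
  case: (e) e_gt0 ed => // e' _ ed; rewrite ed; nia.
exists (p - e)%N, e.-1; split => //; split; try lia.
  by rewrite xpair_eqE; apply/negP => /andP[/eqP]; lia.
by move=> t t0; rewrite exp_e // eE.
Qed.

Lemma j_neg1 : (-1 : k) != 1.
Proof.
rewrite -subr_eq0 -opprD oppr_eq0 -[1 + 1]/(2%:R) -[2](rmorph_nat j) fmorph_eq0.
exact: Fq_two_neq0 quadH.
Qed.

(** Indeed s^(p-1) = - 1. *)
Lemma red_at_s chi e : red_exponent chi e -> red (chi s) = (-1) ^+ e.
Proof.
move=> exp_e; rewrite exp_e ?(s_neq0 quadH) // exprM; congr (_ ^+ _).
have p_gt0 := prime_gt0 p_pr; have s0 := s_neq0 quadH.
rewrite -rmorphXn -[RHS](rmorphN1 j); congr (j _); apply: (mulfI s0).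
by rewrite -exprS prednK // (frob_s quadH) mulrN1.
Qed.

Lemma chi_s_sqr (chi : Fq -> C) : mulchar chi -> trivial_on_Fp chi -> chi s ^+ 2 = 1.
Proof.
move=> chi_char chi_Fp; rewrite -(mulcharX _ _ chi_char) (qd_sqr quadH).
by rewrite chi_Fp // (qd_neq0 quadH).
Qed.

(** Both values are signs, and signs are determined by their reductions, which
red_at_s computes from the exponents. *)
Lemma chi_s_neq (chi1 chi2 : Fq -> C) e1 e2 :
  mulchar chi1 -> trivial_on_Fp chi1 -> red_exponent chi1 e1 ->
  mulchar chi2 -> trivial_on_Fp chi2 -> red_exponent chi2 e2 ->
  chi1 s != chi2 s -> odd e1 != odd e2.
Proof.
move=> c1 t1 x1 c2 t2 x2; apply: contraNN => /eqP eq_odd.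
have : red (chi1 s) = red (chi2 s).
  by rewrite (red_at_s x1) (red_at_s x2) -signr_odd eq_odd signr_odd.
have pm chi : mulchar chi -> trivial_on_Fp chi -> chi s = 1 \/ chi s = -1.
  move=> cc tc; have /eqP := chi_s_sqr cc tc; rewrite sqrf_eq1.
  by case/orP => /eqP; [left|right].
have r1 := prime_over1 redH.
have rN1 : red (-1) = -1 by rewrite (redN redH) ?r1 //; apply: (integral1 intr).
have n1 := j_neg1.
case: (pm _ c1 t1) => ->; case: (pm _ c2 t2) => -> //; rewrite r1 rN1 => eq1.
  by move: n1; rewrite -eq1 eqxx.
by move: n1; rewrite eq1 eqxx.
Qed.

End Labels.

(** * The character of the cuspidal representation modulo p *)

Record reduction_data (p : nat) (Fq : finFieldType)
    (iota : {rmorphism 'F_p -> Fq}) (xi : 'F_p) (s : Fq)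
    (C : numFieldType) (nu : Fq -> C)
    (rho : mx_representation C [set: {'GL_2['F_p]}] p.-1)
    (k : fieldType) (red : C -> k) (j : {rmorphism Fq -> k}) (a b : nat) : Prop := {
  rd_cusp : cuspidal_data iota xi s nu rho;
  rd_red : prime_over p red;
  rd_nu : forall t, t != 0 -> red (nu t) = j t ^+ (a + p * b);
  rd_sum : (a + b = p.-1)%N;
  rd_lt : (b < a)%N }.

Section Reduction.
Variables (p : nat) (Fq : finFieldType).
Variables (iota : {rmorphism 'F_p -> Fq}) (xi : 'F_p) (s : Fq).
Variables (C : numFieldType) (nu : Fq -> C).
Variable rho : mx_representation C [set: {'GL_2['F_p]}] p.-1.
Variables (k : fieldType) (red : C -> k) (j : {rmorphism Fq -> k}) (a b : nat).
Hypothesis rdH : reduction_data iota xi s nu rho red j a b.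
Local Notation cuspH := (rd_cusp rdH).
Local Notation redH := (rd_red rdH).
Local Notation quadH := (cd_quad cuspH).
Local Notation nu_char := (cd_char cuspH).
Local Notation p_pr := (qd_prime quadH).
Local Notation int_over := (integralOver (intr : int -> C)).
Local Notation theta := (theta rho).
Local Notation rhoM := (rhoM rho).

Lemma half_diff : exists m, a = (b + 2 * m + 2)%N /\ p = (2 * b + 2 * m + 3)%N.
Proof.
have := rd_sum rdH; have := rd_lt rdH; have := qd_odd quadH; have := prime_gt1 p_pr.
by exists ((a - b)./2.-1); lia.
Qed.

(** The trace of Sym^(a-b-2) tensor det^(b+1) plus Sym^(2b) tensor det^a at an
element with eigenvalues z and z'. These are the constituents of the reduction
of the cuspidal representation modulo p. *)
Definition brauer_trace (z z' : Fq) : Fq :=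
  hsum z z' (a - b - 2) * (z * z') ^+ b.+1 + hsum z z' (2 * b) * (z * z') ^+ a.

(** Telescoping the two geometric sums, then using a + 2 b + 1 = p + b. *)
Lemma brauer_traceE z z' : (z - z') * brauer_trace z z' =
  z ^+ a * z' ^+ b.+1 - z' ^+ a * z ^+ b.+1
  + (z ^+ b * z ^+ p * z' ^+ a - z' ^+ b * z' ^+ p * z ^+ a).
Proof.
have [m [ea ep]] := half_diff.
rewrite /brauer_trace mulrDr !mulrA !hsum_telescope.
have -> : (a - b - 2).+1 = (2 * m).+1 by lia.
congr (_ + _); rewrite mulrBl !exprMn.
  have -> : a = (b.+1 + (2 * m).+1)%N by lia.
  by rewrite !exprD; ring.
have ->: z ^+ b * z ^+ p = z ^+ a * z ^+ (2 * b).+1 by rewrite -!exprD; congr (_ ^+ _); lia.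
have ->: z' ^+ b * z' ^+ p = z' ^+ a * z' ^+ (2 * b).+1 by rewrite -!exprD; congr (_ ^+ _); lia.
by ring.
Qed.

(** For z <> z', compare both sides after multiplication by z - z', using
z^p = z and z'^p = z' if the element is split, and z^p = z' if it is elliptic.
For z = z', both values of theta reduce to - 1, and brauer_trace is
(2 b + 1) + (a - b - 1) = p - 1. *)
Lemma theta_red A z z' : A \in unitmx ->
  z + z' = iota (\tr A) -> z * z' = iota (\det A) ->
  int_over (theta A) /\ red (theta A) = j (brauer_trace z z').
Proof.
move=> uA sum_z prod_z; have [m [ea ep]] := half_diff.
have red1 := prime_over1 redH; have int1 := integral1 (intr : {rmorphism int -> C}).
have [/codomP[l el] | z_out] := boolP (z \in codom iota).
  pose l' := \tr A - l.
  have el' : z' = iota l' by rewrite rmorphB -sum_z el addrC addKr.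
  have prod_l : l * l' = \det A.
    by apply: (fmorph_inj iota); rewrite rmorphM -el -el' prod_z.
  have sum_l : l + l' = \tr A by rewrite /l' addrC subrK.
  have zp : z ^+ p = z by rewrite el (frob_iota quadH).
  have zp' : z' ^+ p = z' by rewrite el' (frob_iota quadH).
  have [eq_l | neq_l] := eqVneq l l'; last first.
    rewrite (theta_split cuspH uA sum_l prod_l neq_l) (red0 redH); split.
      exact: (integral0 intr).
    suff -> : brauer_trace z z' = 0 by rewrite rmorph0.
    have zz' : z - z' != 0 by rewrite subr_eq0 el el' (inj_eq (fmorph_inj iota)).
    by apply: (mulfI zz'); rewrite brauer_traceE zp zp' mulr0 !exprS; ring.
  have -> : brauer_trace z z' = -1.
    have z0 : z != 0.
      rewrite el fmorph_eq0; apply: contraTneq uA => l0.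
      by rewrite unitmxE -prod_l l0 mul0r unitr0.
    have zp1 : z ^+ p.-1 = 1.
      apply: (mulfI z0); rewrite -exprS prednK ?zp ?mulr1 //; exact: prime_gt0 p_pr.
    rewrite /brauer_trace el' -eq_l -el !hsum_diag -!expr2 -!exprM.
    rewrite !mulrnAl -!exprD.
    have -> : (a - b - 2 + 2 * b.+1 = p.-1)%N by lia.
    have -> : (2 * b + 2 * a = p.-1 * 2)%N by lia.
    rewrite exprM zp1 expr1n -mulrnDr; apply: (@addIr _ 1).
    rewrite addNr -mulrSr -(pcharf0 (Fq_char quadH)); congr (_%:R); lia.
  rewrite rmorphN1 -eq_l in sum_l prod_l *.
  have p_gt0 := prime_gt0 p_pr.
  case: (theta_double cuspH uA sum_l prod_l) => ->; split.
  - exact: (integral_nat intr).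
  - exact: red_pred_p redH p_gt0.
  - exact: (integral_opp int1).
  - by rewrite (redN redH int1) red1.
have root_z : z ^+ 2 - iota (\tr A) * z + iota (\det A) = 0.
  by rewrite -sum_z -prod_z; ring.
have zpz : z ^+ p - z != 0.
  rewrite subr_eq0; apply: contraNneq z_out => /(frob_fixed quadH)[l ->].
  exact: codom_f.
have zp : z ^+ p = z'.
  apply/eqP; rewrite -subr_eq0 -(mulrI_eq0 _ (mulfI zpz)); apply/eqP.
  have : (z ^+ 2 - iota (\tr A) * z + iota (\det A)) ^+ p = 0.
    by rewrite root_z expr0n gtn_eqF // (prime_gt0 p_pr).
  rewrite !(frobD quadH) (frobN quadH) exprAC [(iota _ * z) ^+ p]exprMn !(frob_iota quadH) => <-.
  by rewrite -sum_z -prod_z; ring.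
have zp' : z' ^+ p = z by rewrite -zp (frobK quadH).
have z0 : z != 0 by apply: contraNneq z_out => ->; rewrite -(rmorph0 iota) codom_f.
have int_z := integral_mulchar z nu_char.
have int_zp : int_over (nu z ^+ p).
  by rewrite -(mulcharX _ _ nu_char); apply: integral_mulchar nu_char.
rewrite (theta_elliptic cuspH uA z_out root_z); split.
  by apply: integral_opp; apply: integral_add.
rewrite (redN redH) ?(prime_overD redH) //; last exact: integral_add.
rewrite (redX redH) // (rd_nu rdH) // -rmorphXn -rmorphXn -rmorphD -rmorphN.
congr (j _); apply: (@mulfI _ (z - z')); first by rewrite -oppr_eq0 opprB -zp.
rewrite brauer_traceE zp zp' exprD exprM zp exprMn -exprM mulnC exprM zp.
by rewrite -[z' ^+ b ^+ p]exprM mulnC exprM zp' !exprS; ring.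
Qed.
End Reduction.

(** * Sums over the two tori modulo p *)

Section TorusSplitSums.
Variables (p : nat) (Fq : finFieldType).
Variables (iota : {rmorphism 'F_p -> Fq}) (xi : 'F_p) (s : Fq).
Hypothesis quadH : quadratic_data iota xi s.
Local Notation p_pr := (qd_prime quadH).

Lemma sum_Fp_powers e : \sum_(x : 'F_p | x != 0) iota x ^+ e =
  if (p.-1 %| e)%N then -1 else 0.
Proof.
under eq_bigr do rewrite -rmorphXn.
rewrite -rmorph_sum sum_powers (card_Fp p_pr).
by case: ifP => _; rewrite ?rmorphN1 ?rmorph0.
Qed.

Definition torus_sym_trace (t X : Fq) n :=
  sym_trace (re_part p t) (im_part p s t) (im_part p s t * s ^+ 2) (re_part p t) X n.

Definition torus_sym_coef (t : Fq) n i :=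
  sym_coef (re_part p t) (im_part p s t) (im_part p s t * s ^+ 2) (re_part p t) n i.

(** The sum over x of a power of x is - 1 or 0, according to whether p - 1
divides the exponent, so only the i0-th diagonal coefficient remains. *)
Lemma split_sum_some t n c h i0 : (i0 <= n)%N ->
  (forall i, (i <= n)%N -> (p.-1 %| i + (c + h))%N = (i == i0)) ->
  \sum_(x : 'F_p | x != 0)
     iota x ^+ h * (torus_sym_trace t (iota x) n * (iota x * (t * t ^+ p)) ^+ c)
  = - ((t * t ^+ p) ^+ c * torus_sym_coef t n i0).
Proof.
move=> le_i0 dvd_i.
under eq_bigr => x _ do rewrite /torus_sym_trace /sym_trace exprMn !mulr_suml mulr_sumr.
rewrite exchange_big /= (bigD1 (Ordinal (le_i0 : i0 < n.+1)%N)) //=.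
rewrite [X in _ + X]big1 ?addr0 => [|i neq_i].
  under eq_bigr => x _.
    rewrite (_ : _ * _ = ((t * t ^+ p) ^+ c * torus_sym_coef t n i0)
      * iota x ^+ (i0 + (c + h))); last by rewrite !exprD /torus_sym_coef; ring.
    over.
  by rewrite -mulr_sumr sum_Fp_powers dvd_i // eqxx mulrN1.
under eq_bigr => x _.
  rewrite (_ : _ * _ = ((t * t ^+ p) ^+ c * torus_sym_coef t n i)
    * iota x ^+ (i + (c + h))); last by rewrite !exprD /torus_sym_coef; ring.
  over.
rewrite -mulr_sumr sum_Fp_powers dvd_i -1?ltnS //.
by rewrite -val_eqE /= in neq_i; rewrite (negPf neq_i) mulr0.
Qed.

Lemma split_sum_none t n c h :
  (forall i, (i <= n)%N -> ~~ (p.-1 %| i + (c + h))%N) ->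
  \sum_(x : 'F_p | x != 0)
     iota x ^+ h * (torus_sym_trace t (iota x) n * (iota x * (t * t ^+ p)) ^+ c)
  = 0.
Proof.
move=> ndvd_i.
under eq_bigr => x _ do rewrite /torus_sym_trace /sym_trace exprMn !mulr_suml mulr_sumr.
rewrite exchange_big /= big1 // => i _.
under eq_bigr => x _.
  rewrite (_ : _ * _ = ((t * t ^+ p) ^+ c * torus_sym_coef t n i)
    * iota x ^+ (i + (c + h))); last by rewrite !exprD /torus_sym_coef; ring.
  over.
by rewrite -mulr_sumr sum_Fp_powers (negPf (ndvd_i _ _)) ?mulr0 // -ltnS.
Qed.

(** Turns the negative power of t coming from chi(t)^-1 into a positive one. *)
Lemma inv_torus_power (t : Fq) e : t != 0 -> (e <= p)%N ->
  t^-1 ^+ (p.-1 * e) = t ^+ (p.-1 * (p.+1 - e)).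
Proof.
move=> t0 le_e; apply: (@mulIf _ (t ^+ (p.-1 * e))); first by rewrite expf_neq0.
rewrite -exprMn mulVf // expr1n -exprD -mulnDr subnK ?(leqW le_e) //.
by rewrite -(pred_card_Fq quadH) expf_card1.
Qed.

(** The exponents of t are the multiples (p - 1) (Q + 2 l0 - 2 l) of p - 1. As
p + 1 divides Q and |2 l0 - 2 l| is less than p + 1, the exponent is divisible
by p^2 - 1 for l = l0 only. *)
Lemma full_sum_neq0 e c m l0 Q : (e <= p)%N -> (2 * m < p)%N -> (l0 <= m)%N ->
  (p.+1 %| Q)%N -> (2 * m <= Q)%N ->
  (forall l, (l <= m)%N ->
    p.-1 * (p.+1 - e) + p.+1 * c + 2 * l + 2 * p * (m - l)
      = p.-1 * (Q + 2 * l0 - 2 * l))%N ->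
  \sum_(t : Fq | t != 0) t^-1 ^+ (p.-1 * e)
    * - ((t * t ^+ p) ^+ c * torus_sym_coef t (2 * m) m) != 0.
Proof.
move=> le_e lt_m le_l0 dvdQ le_Q expE; have p_gt1 := prime_gt1 p_pr.
under eq_bigr => t t0.
  rewrite inv_torus_power // -exprS -exprM mulrN mulrA -exprD.
  over.
rewrite sumrN oppr_eq0; apply: (@torus_sum Fq p s (qd_odd quadH) (Fq_char quadH) (qd_card quadH)
  (s_neq0 quadH) _ _ l0) => // l le_l; rewrite expE //.
have -> : (p ^ 2 - 1 = p.-1 * p.+1)%N.
  by rewrite -(pred_card_Fq quadH) (qd_card quadH) subn1.
rewrite dvdn_pmul2l; last by lia.
have [-> | neq_l] := eqVneq l l0; first by rewrite addnK.
apply/negP => dvd_l; move/eqP: neq_l; apply.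
have [lt_l | le_l0l] := ltnP l l0.
  have : (p.+1 %| 2 * l0 - 2 * l)%N.
    by rewrite -(dvdn_addr _ dvdQ); have -> : (Q + (2 * l0 - 2 * l) = Q + 2 * l0 - 2 * l)%N by lia.
  by case/dvdnP => [[|q]]; lia.
have : (p.+1 %| 2 * l - 2 * l0)%N.
  rewrite -(dvdn_addr _ dvd_l); have -> : (Q + 2 * l0 - 2 * l + (2 * l - 2 * l0) = Q)%N by lia.
  exact: dvdQ.
by case/dvdnP => [[|q]]; lia.
Qed.

End TorusSplitSums.

(** * Nonvanishing of the product of the two projectors *)

Section Nonvanishing.
Variables (p : nat) (Fq : finFieldType).
Variables (iota : {rmorphism 'F_p -> Fq}) (xi : 'F_p) (s : Fq).
Variables (C : numFieldType) (nu : Fq -> C).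
Variable rho : mx_representation C [set: {'GL_2['F_p]}] p.-1.
Variables (k : fieldType) (red : C -> k) (j : {rmorphism Fq -> k}) (a b : nat).
Hypothesis rdH : reduction_data iota xi s nu rho red j a b.
Local Notation cuspH := (rd_cusp rdH).
Local Notation redH := (rd_red rdH).
Local Notation quadH := (cd_quad cuspH).
Local Notation p_pr := (qd_prime quadH).
Local Notation int_over := (integralOver (intr : int -> C)).
Local Notation theta := (theta rho).
Local Notation rhoM := (rhoM rho).
Local Notation torus_mx := (torus_mx iota xi s).

(** The projector to the chi-eigenspace of the nonsplit torus, up to the factor
p^2 - 1. *)
Definition torus_sum_op (chi : Fq -> C) : 'M[C]_(p.-1) :=
  \sum_(t | t != 0) chi t^-1 *: rhoM (torus_mx t).

(** The reduction of theta at the product of t and diag(X, 1), as a function of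
t and X. *)
Definition torus_brauer (t X : Fq) : Fq :=
  torus_sym_trace p s t X (a - b - 2) * (X * (t * t ^+ p)) ^+ b.+1 +
  torus_sym_trace p s t X (2 * b) * (X * (t * t ^+ p)) ^+ a.

Lemma torus_split_unit t x : t != 0 -> x != 0 -> torus_mx t *m split_mx x \in unitmx.
Proof.
by move=> t0 x0; rewrite unitmx_mul (torus_unit quadH t0) (split_unit x0).
Qed.

Lemma theta_torus_split t x : t != 0 -> x != 0 ->
  int_over (theta (torus_mx t *m split_mx x)) /\
  red (theta (torus_mx t *m split_mx x)) = j (torus_brauer t (iota x)).
Proof.
move=> t0 x0.
have [z [z' [sum_z prod_z]]] := char_roots quadH
  (\tr (torus_mx t *m split_mx x)) (\det (torus_mx t *m split_mx x)).
have := theta_red rdH (torus_split_unit t0 x0) sum_z prod_z.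
suff -> : brauer_trace a b z z' = torus_brauer t (iota x) by [].
have prodE : z * z' = iota x * (t * t ^+ p).
  rewrite prod_z det_mulmx rmorphM (iota_det_torus quadH) mulrC; congr (_ * _).
  by rewrite det_mx2 mulr1 mulr0 subr0.
have sE := qd_sqr quadH.
have detE : t * t ^+ p = re_part p t * re_part p t - im_part p s t * (im_part p s t * s ^+ 2).
  rewrite -(iota_det_torus quadH) det_mx2 rmorphB !rmorphM.
  by rewrite (iota_reF quadH) (iota_imF quadH) sE.
have sumE : z + z' = re_part p t * iota x + re_part p t.
  rewrite sum_z mx2_mul_split tr_mx2 rmorphD rmorphM.
  by rewrite (iota_reF quadH).
have hsE n : hsum z z' n = torus_sym_trace p s t (iota x) n.
  by apply/esym/sym_traceE; rewrite ?prodE ?detE.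
by rewrite /brauer_trace /torus_brauer !hsE prodE.
Qed.

Section SplitCharacter.
Variables (chi : Fq -> C) (e : nat) (mu : 'F_p -> C) (h : nat).
Hypotheses (chi_char : mulchar chi) (chi_exp : red_exponent p red j chi e).
Hypotheses (mu_char : mulchar mu).
Hypothesis mu_red : forall x, x != 0 -> red (mu x) = j (iota x ^+ h).

Lemma tr_torus_split_proj : \tr (torus_sum_op chi *m split_proj rho mu) =
  p.-1%:R^-1 * \sum_(t | t != 0) \sum_(x | x != 0)
     chi t^-1 * (mu x * theta (torus_mx t *m split_mx x)).
Proof.
rewrite /split_proj -scalemxAr mxtraceZ; congr (_ * _).
rewrite /torus_sum_op mulmx_suml raddf_sum /=; apply: eq_bigr => t t0.
rewrite mulmx_sumr raddf_sum /=; apply: eq_bigr => x x0.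
rewrite -scalemxAr -scalemxAl !mxtraceZ mulrCA; congr (_ * (_ * _)).
by rewrite -(rhoM_mul rho (torus_unit quadH t0) (split_unit x0)).
Qed.

(** The sum in the hypothesis is the reduction of p - 1 times the trace of this
product. *)
Lemma torus_split_proj_neq0 :
  \sum_(t : Fq | t != 0) t^-1 ^+ (p.-1 * e) *
     \sum_(x : 'F_p | x != 0) iota x ^+ h * torus_brauer t (iota x) != 0 ->
  torus_sum_op chi *m split_proj rho mu != 0.
Proof.
apply: contra_neq => prod0; have := tr_torus_split_proj.
rewrite prod0 mxtrace0 => /esym/eqP; rewrite mulf_eq0 invr_eq0.
rewrite (negPf (pred_p_neq0 cuspH)) /= => /eqP sum0.
have int_term t x : t != 0 -> x != 0 ->
    int_over (chi t^-1 * (mu x * theta (torus_mx t *m split_mx x))) /\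
    red (chi t^-1 * (mu x * theta (torus_mx t *m split_mx x))) =
    j (t^-1 ^+ (p.-1 * e) * (iota x ^+ h * torus_brauer t (iota x))).
  move=> t0 x0; have [int_th red_th] := theta_torus_split t0 x0.
  have int_mu := integral_mulchar x mu_char.
  have int_chi := integral_mulchar t^-1 chi_char.
  have int_mt := integral_mul int_mu int_th.
  split; first exact: integral_mul.
  rewrite (prime_overM redH) // (prime_overM redH) // red_th mu_red //.
  by rewrite chi_exp ?invr_eq0 // -rmorphXn -!rmorphM.
apply: (fmorph_inj j); rewrite rmorph0 -(red0 redH) -sum0.
pose term t := \sum_(x | x != 0) chi t^-1 * (mu x * theta (torus_mx t *m split_mx x)).
have red_term t : t != 0 -> int_over (term t) /\ red (term t) =
    j (t^-1 ^+ (p.-1 * e) * \sum_(x : 'F_p | x != 0) iota x ^+ h * torus_brauer t (iota x)).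
  move=> t0; have [int_t ->] := red_sum redH (index_enum _) (fun x x0 => (int_term t x t0 x0).1).
  split => //; rewrite mulr_sumr rmorph_sum; apply: eq_bigr => x x0.
  exact: (int_term t x t0 x0).2.
have [_ ->] := red_sum redH (index_enum _) (fun t t0 => (red_term t t0).1).
rewrite rmorph_sum; apply: eq_bigr => t t0; exact/esym/(red_term t t0).2.
Qed.

End SplitCharacter.

(** Let a - b - 2 = 2 m. The weights of diag(x, 1) are b + 1, ..., a - 1 on the
first constituent and a, ..., a + 2 b on the second one. Only the middle weight
(p - 1)/2 of the first one cancels the quadratic character. Then the sum over t
selects l with 2 l = a - e. *)
Lemma nonvanishing_quad chi e mu : mulchar chi -> red_exponent p red j chi e ->
  mulchar mu -> (forall x, x != 0 -> red (mu x) = j (iota x ^+ (p.-1)./2)) ->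
  (b.+1 < e < a.+1)%N -> odd e = odd b ->
  torus_sum_op chi *m split_proj rho mu != 0.
Proof.
move=> chi_char chi_exp mu_char mu_red /andP[lt_be lt_ea] odd_e.
have [m [ea ep]] := half_diff rdH.
apply: (torus_split_proj_neq0 chi_char chi_exp mu_char mu_red).
have hE : p.-1./2 = (b + m + 1)%N by lia.
have sum1 t : \sum_(x : 'F_p | x != 0) iota x ^+ p.-1./2 * torus_brauer t (iota x) =
    - ((t * t ^+ p) ^+ b.+1 * torus_sym_coef p s t (2 * m) m).
  under eq_bigr do rewrite mulrDr.
  have -> : (a - b - 2 = 2 * m)%N by lia.
  rewrite big_split /= (@split_sum_some _ _ _ _ _ quadH t _ _ _ m) ?(split_sum_none quadH) ?addr0 //.
  - move=> i le_i; apply/negP => /dvdnP[q]; rewrite hE ep ea.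
    by case: q => [|[|[|q]]]; lia.
  - lia.
  move=> i le_i; apply/idP/eqP => [/dvdnP[q]|->].
    by rewrite hE; case: q => [|[|q]]; lia.
  by apply/dvdnP; exists 1%N; lia.
under eq_bigr do rewrite sum1.
apply: (@full_sum_neq0 _ _ _ _ _ quadH _ _ _ (a - e)./2 p.+1) => //; try lia.
move=> l le_l.
have [d ed] : exists d, m = (l + d)%N by exists (m - l)%N; lia.
have [f ef] : exists f, (a - e)./2 = f /\ (e + 2 * f)%N = a.
  by exists (a - e)./2; lia.
case: ef => -> ef.
have -> : (p.+1 - e = b + 2 + 2 * f)%N by lia.
have -> : (m - l = d)%N by lia.
have -> : (p.+1 + 2 * f - 2 * l = 2 * b + 2 * d + 4 + 2 * f)%N by lia.
have -> : p.-1 = (2 * b + 2 * (l + d) + 2)%N by lia.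
rewrite ep ed; nia.
Qed.

(** Only the middle weight a + b = p - 1 of the second constituent is trivial.
Then the sum over t selects l with 2 l = b - e if e <= b, and with
2 l = p + 1 + b - e if e >= a + 2; by parity e is not a + 1 or b + 1. *)
Lemma nonvanishing_triv chi e mu : mulchar chi -> red_exponent p red j chi e ->
  mulchar mu -> (forall x, x != 0 -> red (mu x) = 1) ->
  (e <= p)%N -> ~~ (b.+1 < e < a.+1)%N -> odd e = odd b ->
  torus_sum_op chi *m split_proj rho mu != 0.
Proof.
move=> chi_char chi_exp mu_char mu_red le_ep e_out odd_e.
have [m [ea ep]] := half_diff rdH.
have {}mu_red x : x != 0 -> red (mu x) = j (iota x ^+ 0).
  by move=> x0; rewrite mu_red // expr0 rmorph1.
apply: (torus_split_proj_neq0 chi_char chi_exp mu_char mu_red).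
have sum1 t : \sum_(x : 'F_p | x != 0) iota x ^+ 0 * torus_brauer t (iota x) =
    - ((t * t ^+ p) ^+ a * torus_sym_coef p s t (2 * b) b).
  under eq_bigr do rewrite mulrDr.
  rewrite big_split /= (split_sum_none quadH) ?add0r.
    rewrite (@split_sum_some _ _ _ _ _ quadH t _ _ _ b) //; first by lia.
    move=> i le_i; apply/idP/eqP => [/dvdnP[q]|->].
      by case: q => [|[|q]]; rewrite ?mulSn; try move: (q * p.-1)%N => u; lia.
    by apply/dvdnP; exists 1%N; lia.
  by move=> i le_i; apply/negP => /dvdnP[[|q]]; rewrite ?mulSn; try move: (q * p.-1)%N => u; lia.
under eq_bigr do rewrite sum1.
(* Q is the part of the exponent divisible by p + 1; it differs in the cases *)
(* e <= b and e >= a + 2.                                                    *)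
have [Q [l0 [dvdQ le_l0 le_Q eQ]]] : exists Q l0,
    [/\ (p.+1 %| Q)%N, (l0 <= b)%N, (2 * b <= Q)%N & (Q + 2 * l0 + e = 2 * p.+1 + b)%N].
  have [le_eb | gt_ea] : (e <= b)%N \/ (a.+2 <= e)%N by lia.
    by exists (2 * p.+1)%N, (b - e)./2; split; rewrite ?dvdn_mull //; lia.
  by exists p.+1, (p.+1 + b - e)./2; split; rewrite ?dvdnn //; lia.
apply: (@full_sum_neq0 _ _ _ _ _ quadH _ _ _ l0 Q) => //; first by lia.
move=> l le_l.
have [d ed] : exists d, b = (l + d)%N by exists (b - l)%N; lia.
have [f ef] : exists f, (f + e = p.+1)%N by exists (p.+1 - e)%N; lia.
have -> : (p.+1 - e = f)%N by lia.
have -> : (b - l = d)%N by lia.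
have -> : (Q + 2 * l0 - 2 * l = p.+1 + f + d - l)%N by lia.
have -> : (p.+1 + f + d - l = 2 * m + l + 3 * d + 4 + f)%N by lia.
have -> : p.-1 = (2 * b + 2 * m + 2)%N by lia.
rewrite ep ea ed; nia.
Qed.

End Nonvanishing.

(** * The sign of a character by a Gauss sum *)

Section GaussSum.
Variables (p : nat) (Fq : finFieldType).
Variables (iota : {rmorphism 'F_p -> Fq}) (xi : 'F_p) (s : Fq).
Hypothesis quadH : quadratic_data iota xi s.
Local Notation p_pr := (qd_prime quadH).
Variables (C : numFieldType) (psi : 'F_p -> C).
Hypotheses (psi_char : addchar psi) (psi_nontriv : exists x, psi x <> 1).

Lemma iota_trace_Fp u : iota (trace_Fp iota u) = u + u ^+ p.
Proof.
rewrite /trace_Fp; case: pickP => [t /eqP //|none].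
have [t et] : exists t, u + u ^+ p = iota t.
  by apply: (frob_fixed quadH); rewrite (frobD quadH) (frobK quadH) addrC.
by have := none t; rewrite et eqxx.
Qed.

Lemma trace_Fp_scale c u : trace_Fp iota (iota c * u) = c * trace_Fp iota u.
Proof.
apply: (fmorph_inj iota); rewrite rmorphM !iota_trace_Fp exprMn.
by rewrite (frob_iota quadH) mulrDr.
Qed.

Lemma trace_Fp_eq0 u : (trace_Fp iota u == 0) = (u == iota (imF iota s u) * s).
Proof.
rewrite -(fmorph_eq0 iota) iota_trace_Fp {3}[u](Fq_coord quadH) (iota_reF quadH).
rewrite -[in RHS]subr_eq0 addrK.
by rewrite /re_part mulf_eq0 invr_eq0 (negPf (Fq_two_neq0 quadH)) orbF.
Qed.

Lemma sum_addchar y : \sum_(c : 'F_p | c != 0) psi (c * y) = (y == 0)%:R * p%:R - 1.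
Proof.
have [psi0 psiD] := psi_char.
have -> : \sum_(c : 'F_p | c != 0) psi (c * y) = \sum_(c : 'F_p) psi (c * y) - 1.
  by rewrite [X in _ = X - _](bigD1 0) //= mul0r psi0 addrC addrK.
congr (_ - 1); have [-> | y0] := eqVneq y 0.
  under eq_bigr do rewrite mulr0 psi0.
  by rewrite sumr_const (card_Fp p_pr) mul1r.
rewrite mul0r; transitivity (\sum_c psi c).
  by rewrite [RHS](reindex_inj (mulIf y0)).
have [x /eqP psi_x] := psi_nontriv.
have : (psi x - 1) * (\sum_c psi c) = 0.
  rewrite mulrBl mul1r [X in _ - X](reindex_inj (addrI x)) /= mulr_sumr.
  by apply/eqP; rewrite subr_eq0; apply/eqP; apply: eq_bigr => c _; rewrite psiD.
by move/eqP; rewrite mulf_eq0 subr_eq0 (negPf psi_x) => /eqP.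
Qed.

Lemma sum_mulchar (F : finFieldType) (chi : F -> C) : mulchar chi ->
  chi <> triv_char F C -> \sum_(u : F | u != 0) chi u = 0.
Proof.
move=> chi_char chi_nontriv; have [chi0 chi1 chiM] := chi_char.
have [v v0 /eqP chi_v] : exists2 v, v != 0 & chi v <> 1.
  apply: contrapT => none; apply: chi_nontriv; apply/funext => v; rewrite /triv_char.
  have [-> //| v0] := eqVneq v 0.
  by apply: contrapT => chi_v; apply: none; exists v.
have : (chi v - 1) * (\sum_(u : F | u != 0) chi u) = 0.
  rewrite mulrBl mul1r -[X in _ - X](reindex_mulf _ v0) mulr_sumr.
  by apply/eqP; rewrite subr_eq0; apply/eqP; apply: eq_bigr => c _; rewrite chiM.
by move/eqP; rewrite mulf_eq0 subr_eq0 (negPf chi_v) => /eqP.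
Qed.

Variable chi : Fq -> C.
Hypotheses (chi_char : mulchar chi) (chi_Fp : trivial_on_Fp iota chi).

Lemma sum_trace0 : \sum_(u | (u != 0) && (trace_Fp iota u == 0)) chi u =
  chi s *+ p.-1.
Proof.
have s0 := s_neq0 quadH.
rewrite (reindex_onto (fun c => iota c * s) (imF iota s)) /=; last first.
  by move=> u /andP[_]; rewrite trace_Fp_eq0 => /eqP.
have imE c : imF iota s (iota c * s) = c.
  by rewrite -{2}(coord_imF quadH 0 c) rmorph0 add0r.
rewrite (eq_bigl (fun c => c != 0)) => [|c]; last first.
  by rewrite trace_Fp_eq0 imE !eqxx !andbT mulf_eq0 fmorph_eq0 (negPf s0) orbF.
under eq_bigr => c c0 do rewrite (mulcharM chi_char) chi_Fp // mul1r.
by rewrite sumr_const card_finField_neq0 (card_Fp p_pr).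
Qed.

(** Averaging over the substitutions u |-> c u, for c in the prime field, makes
psi(tr u) the indicator function of the trace zero elements u, up to a constant
that does not contribute, and chi is constant on trace zero elements. *)
Lemma gauss_sumE : chi <> triv_char Fq C -> gauss_sum iota psi chi = chi s * p%:R.
Proof.
move=> chi_nontriv; have p1_neq0 : p.-1%:R != 0 :> C.
  by rewrite pnatr_eq0 -lt0n -subn1 subn_gt0 (prime_gt1 p_pr).
apply: (mulfI p1_neq0).
transitivity (\sum_(c : 'F_p | c != 0) gauss_sum iota psi chi).
  by rewrite sumr_const card_finField_neq0 (card_Fp p_pr) mulr_natl.
transitivity (\sum_(c : 'F_p | c != 0) \sum_(u : Fq | u != 0)
    chi u * psi (c * trace_Fp iota u)).
  apply: eq_bigr => c c0; have ic0 : iota c != 0 by rewrite fmorph_eq0.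
  rewrite /gauss_sum -(reindex_mulf _ ic0); apply: eq_bigr => u _.
  by rewrite (mulcharM chi_char) chi_Fp // mul1r trace_Fp_scale.
rewrite exchange_big /=.
under eq_bigr do rewrite -mulr_sumr sum_addchar mulrBr mulr1.
rewrite sumrB (sum_mulchar chi_char chi_nontriv) subr0.
transitivity ((\sum_(u | (u != 0) && (trace_Fp iota u == 0)) chi u) * p%:R).
  rewrite big_mkcondr /= mulr_suml; apply: eq_bigr => u _.
  by case: eqP => _; rewrite ?mul1r // !mul0r mulr0.
by rewrite sum_trace0 mulrnAl mulr_natl.
Qed.

Lemma epsilonE : epsilon iota psi s chi = chi s.
Proof.
rewrite /epsilon; case: asboolP => // not_quad.
rewrite gauss_sumE => [|chi_triv]; last by apply: not_quad; left.
by rewrite mulfK // pnatr_eq0 -lt0n (prime_gt0 p_pr).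
Qed.

End GaussSum.

(** * p-adic integers and numbers *)

Lemma fraction_repr (R : idomainType) (x : {fraction R}) :
  exists n d : R, d != 0 /\ tofrac d * x = tofrac n.
Proof.
elim/quotW: x => r; exists r.1, r.2; split; first exact: denom_ratioP.
rewrite /tofrac; unlock FracField.tofrac; rewrite -[LHS]FracField.pi_mul.
apply/eqmodP; rewrite /= FracField.equivfE.
by rewrite !numden_Ratio ?(oner_eq0, mulf_neq0, denom_ratioP) // !mul1r mulr1 mulrC.
Qed.

Lemma common_denominator (F : fieldType) (c d x a q x0 : F) :
  c != 0 -> d != 0 -> c * x = a -> d * a = q * x0 -> x = q / (c * d) * x0.
Proof.
move=> c0 d0 <- e; apply: (mulfI d0); apply: (mulfI c0).
by rewrite mulrCA e; field; rewrite c0 d0.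
Qed.

Section PadicIntegers.
Variables (p : nat) (p_pr : prime p).
Local Notation Zp := (padic_int p_pr).
Local Notation res := (@padic_residue p p_pr).

Lemma padic_digits_nat (m n : nat) :
  padic_digits (m%:R : Zp) n = (m%:Z %% (p ^ n)%N%:Z)%Z.
Proof.
elim: m => [|m IHm]; first by rewrite mod0z /= mod0z.
by rewrite -natr1 /= IHm /= modzDm -PoszD addn1.
Qed.

Lemma residue_surj (x : 'F_p) : exists X : Zp, res X = x.
Proof. by exists (nat_of_ord x)%:R; rewrite rmorph_nat natr_Zp. Qed.

Lemma intr_Fp_eq0 (z : int) : (z%:~R == 0 :> 'F_p) = (p %| `|z|)%N.
Proof.
case: z => n; rewrite ?NegzE ?mulrNz ?oppr_eq0 ?abszN /= -pmulrn;
  exact/esym/(dvdn_pcharf (pchar_Fp p_pr)).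
Qed.

Lemma residue_eq0 (x : Zp) : (res x == 0) = (p%:Z %| padic_digits x 1)%Z.
Proof. by rewrite /padic_residue intr_Fp_eq0 dvdzE. Qed.

Lemma digits_coprime (x : Zp) n : res x != 0 ->
  coprimez (padic_digits x n) (p ^ n)%N%:Z.
Proof.
rewrite residue_eq0 dvdzE => ndvd.
case: n => [|n]; first by rewrite expn0 coprimezE coprimen1.
rewrite coprimezE coprimeXr // coprime_sym prime_coprime //.
apply: contra ndvd; have := padic_digits_le x (ltn0Sn n).
rewrite expn1 => <- dvd_n.
by rewrite -dvdzE; apply/dvdz_mod0P; rewrite modz_mod; apply/dvdz_mod0P; rewrite dvdzE.
Qed.

(** The inverse is computed modulo p^n by Bezout for each n. *)
Lemma residue_neq0_unit (x : Zp) : res x != 0 -> x \is a GRing.unit.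
Proof.
move=> rx; pose f n := (egcdz (padic_digits x n) (p ^ n)%N%:Z).1.
have fP n : (f n * padic_digits x n = 1 %[mod (p ^ n)%N])%Z.
  have := digits_coprime n rx; rewrite /coprimez /f => /eqP.
  case: egcdzP => u v /= <- _ bezout.
  apply/eqP; rewrite eqz_mod_dvd; apply/dvdzP; exists (- v).
  by rewrite -bezout opprD addNKr mulNr.
have cf n : (f n.+1 = f n %[mod (p ^ n)%N])%Z.
  set x0 := padic_digits x n; set x1 := padic_digits x n.+1.
  have inv0 : ((p ^ n)%N %| f n * x0 - 1)%Z by rewrite -eqz_mod_dvd fP.
  have inv1 : ((p ^ n)%N %| f n.+1 * x1 - 1)%Z.
    apply: dvdz_trans (_ : ((p ^ n.+1)%N%:Z %| _)%Z).
      by rewrite dvdzE /= dvdn_exp2l.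
    by rewrite -eqz_mod_dvd fP.
  have comp : ((p ^ n)%N %| x1 - x0)%Z.
    by rewrite -eqz_mod_dvd /x0 -(padic_compat x n) modz_mod.
  apply/eqP; rewrite eqz_mod_dvd.
  have -> : f n.+1 - f n = f n * (f n.+1 * x1 - 1) - f n.+1 * (f n * x0 - 1)
      - f n * f n.+1 * (x1 - x0) by ring.
  by rewrite !rpredB // dvdz_mull.
apply/unitrP; exists (padic_of p_pr cf).
suff e : padic_of p_pr cf * x = 1 by split; rewrite // mulrC.
by apply: padic_intP => n /=; rewrite modzMml fP.
Qed.

Lemma unit_residue_neq0 (x : Zp) : x \is a GRing.unit -> res x != 0.
Proof.
move=> ux; have : res x^-1 * res x = 1 by rewrite -rmorphM mulVr ?rmorph1.
by apply: contra_eq_neq => ->; rewrite mulr0 eq_sym oner_eq0.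
Qed.

(** The digits of the quotient by p are those of x shifted by one and divided by
p. *)
Lemma residue_eq0_dvd (x : Zp) : res x = 0 -> exists y, x = p%:R * y.
Proof.
move=> /eqP; rewrite residue_eq0 => dvd1.
have p0 : p%:Z != 0 by rewrite eqz_nat -lt0n prime_gt0.
pose y n := (padic_digits x n.+1 %/ p)%Z.
have yP n : y n * p = padic_digits x n.+1.
  rewrite /y divzK //; apply/dvdz_mod0P.
  have := padic_digits_le x (ltn0Sn n); rewrite expn1 => ->.
  by have := padic_digits_mod x 1; rewrite expn1 => <-; apply/dvdz_mod0P.
have cy n : (y n.+1 = y n %[mod (p ^ n)%N])%Z.
  apply/eqP; rewrite eqz_mod_dvd -(dvdz_mul2r p0) mulrBl !yP -PoszM -expnSr.
  by rewrite -eqz_mod_dvd padic_compat padic_digits_mod.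
exists (padic_of p_pr cy); apply: padic_intP => n /=.
by rewrite padic_digits_nat modzMml modzMmr mulrC yP padic_compat.
Qed.

Lemma padic_pow_digits (N : nat) (y : Zp) : padic_digits (p%:R ^+ N * y) N = 0.
Proof.
rewrite -natrX /= padic_digits_nat modzz mul0r mod0z //.
Qed.

(** Divide both by p as long as both residues are zero. This stops, as a nonzero
p-adic integer is not divisible by all the powers of p. *)
Lemma primitive_Zp (x y : Zp) : (x, y) != (0, 0) ->
  exists n x0 y0, [/\ (res x0, res y0) != (0, 0), x = p%:R ^+ n * x0 & y = p%:R ^+ n * y0].
Proof.
move=> xy0; have step N : (exists n x0 y0,
    [/\ (res x0, res y0) != (0, 0), x = p%:R ^+ n * x0 & y = p%:R ^+ n * y0]) \/
    exists x0 y0, x = p%:R ^+ N * x0 /\ y = p%:R ^+ N * y0.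
  elim: N => [|N [|[x0 [y0 [ex ey]]]]]; [|by left|].
    by right; exists x, y; rewrite expr0 !mul1r.
  have [/eqP[rx ry] | prim] := boolP ((res x0, res y0) == (0, 0)); last first.
    by left; exists N, x0, y0.
  have [x1 ex1] := residue_eq0_dvd rx; have [y1 ey1] := residue_eq0_dvd ry.
  by right; exists x1, y1; rewrite ex ey ex1 ey1 exprSr !mulrA.
have bound (z : Zp) : z != 0 -> exists N, forall z', z <> p%:R ^+ N * z'.
  move=> z0; have [N zN] := padic_neq0 z0; exists N => z' ez.
  by have := zN N (leqnn N); rewrite ez padic_pow_digits dvdn0.
have [x0 | x0] := eqVneq x 0.
  have y0 : y != 0 by move: xy0; rewrite xpair_eqE x0 eqxx.
  have [N noN] := bound y y0.
  by case: (step N) => // [[x1 [y1 [_ ey]]]]; case: (noN y1).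
have [N noN] := bound x x0.
by case: (step N) => // [[x1 [y1 [ex _]]]]; case: (noN x1).
Qed.

Lemma primitive_Qp (x y : padic p_pr) : (x, y) != (0, 0) ->
  exists l x0 y0, [/\ l != 0, (res x0, res y0) != (0, 0),
    x = l * tofrac x0 & y = l * tofrac y0].
Proof.
move=> xy0; have [a [c [c0 ex]]] := fraction_repr x.
have [b [d [d0 ey]]] := fraction_repr y.
have fc0 : tofrac c != 0 :> padic p_pr by rewrite tofrac_eq0.
have fd0 : tofrac d != 0 :> padic p_pr by rewrite tofrac_eq0.
have ab0 : (d * a, c * b) != (0, 0).
  apply: contraNneq xy0 => e.
  have da0 : d * a = 0 := congr1 fst e; have cb0 : c * b = 0 := congr1 snd e.
  have a0 : a = 0 by apply: (mulfI d0); rewrite da0 mulr0.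
  have b0 : b = 0 by apply: (mulfI c0); rewrite cb0 mulr0.
  move/eqP: ex; rewrite a0 rmorph0 mulf_eq0 (negPf fc0) => /eqP ->.
  by move/eqP: ey; rewrite b0 rmorph0 mulf_eq0 (negPf fd0) => /eqP ->.
have [n [x0 [y0 [prim eda ecb]]]] := primitive_Zp ab0.
have p0 : p%:R != 0 :> Zp.
  apply/eqP => /(congr1 (fun z : Zp => padic_digits z 2)); rewrite padic_digits_nat.
  rewrite /= mod0z modz_small => [/eqP|]; first by rewrite eqz_nat (gtn_eqF (prime_gt0 p_pr)).
  have p_lt : (p < p ^ 2)%N by rewrite -[X in (X < _)%N]expn1 ltn_exp2l ?prime_gt1.
  by rewrite le0z_nat ltz_nat p_lt.
have l0 : tofrac (p%:R ^+ n) / (tofrac c * tofrac d) != 0 :> padic p_pr.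
  apply: mulf_neq0; first by rewrite tofrac_eq0 expf_neq0.
  by rewrite invr_eq0; apply: mulf_neq0.
exists (tofrac (p%:R ^+ n) / (tofrac c * tofrac d)), x0, y0; split.
- exact: l0.
- exact: prim.
- by apply: common_denominator fc0 fd0 ex _; rewrite -!tofracM eda.
rewrite [tofrac c * _]mulrC.
by apply: common_denominator fd0 fc0 ey _; rewrite -!tofracM ecb.
Qed.

End PadicIntegers.

(** * The unramified quadratic extension and its residue field *)

Section QuadraticFieldExtension.
Variables (F : fieldType) (K : fieldExtType F) (r : K) (d : F).
Hypothesis r2 : r ^+ 2 = d%:A.

Definition coordK (x y : F) : K := x%:A + y *: r.

Lemma coordKM x y x' y' :
  coordK x y * coordK x' y' = coordK (x * x' + y * y' * d) (x * y' + y * x').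
Proof.
rewrite /coordK mulrDl !mulrDr -!scalerAl -!scalerAr !mul1r mulr1 -expr2 r2.
by rewrite !scalerA !scalerDl [X in _ + X = _]addrC addrACA.
Qed.

Lemma coordKB x y x' y' : coordK x y - coordK x' y' = coordK (x - x') (y - y').
Proof. by rewrite /coordK opprD addrACA -!scalerBl. Qed.

Lemma coordKZ l x y : coordK (l * x) (l * y) = l *: coordK x y.
Proof. by rewrite /coordK scalerDr !scalerA. Qed.

Lemma coordK_algr x : coordK x 0 = x%:A.
Proof. by rewrite /coordK scale0r addr0. Qed.

Lemma coordK01 : coordK 0 1 = r.
Proof. by rewrite /coordK scale0r add0r scale1r. Qed.

Lemma coordK_eq0 x y : coordK x y = 0 -> x ^+ 2 - y ^+ 2 * d = 0.
Proof.
move=> xy0; have := coordKM x y x (- y); rewrite xy0 mul0r.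
have -> : x * - y + y * x = 0 by ring.
rewrite coordK_algr => /esym/eqP; rewrite scaler_eq0 oner_eq0 orbF => /eqP <-.
by ring.
Qed.

Lemma coordK_surj : \dim {:K} = 2%N -> (forall x y, coordK x y = 0 -> y = 0) ->
  forall z, exists x y, z = coordK x y.
Proof.
move=> dimK coord0 z.
have r0 : r != 0.
  apply: contraNneq (oner_neq0 F) => r0; apply/eqP; apply: (coord0 0).
  by rewrite coordK01.
have free_1r : free [:: 1; r].
  rewrite free_cons seq1_free r0 andbT span_seq1; apply/negP => /vlineP[k ek].
  have : coordK 1 (- k) = 0 by rewrite /coordK scale1r scaleNr -ek subrr.
  move/coord0/eqP; rewrite oppr_eq0 => /eqP k0.
  by move/eqP: ek; rewrite k0 scale0r oner_eq0.
have : z \in span [:: 1; r].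
  suff -> : span [:: 1; r] = {:K}%VS by rewrite memvf.
  apply/eqP; rewrite eqEdim subvf dimK.
  by move: free_1r; rewrite /free => /eqP ->.
rewrite span_cons span_seq1 => /memv_addP[_ /vlineP[x ->] [_ /vlineP[y ->] ->]].
by exists x, y.
Qed.

End QuadraticFieldExtension.

Lemma proportional (F : fieldType) (x y x' y' : F) :
  (x, y) != (0, 0) -> (x', y') != (0, 0) -> x * y' = x' * y ->
  exists2 c, c != 0 & x' = c * x /\ y' = c * y.
Proof.
rewrite !xpair_eqE !negb_and => xy0 xy0' cross.
have [x0 | x0] := eqVneq x 0.
  move: xy0 cross; rewrite x0 eqxx /= mul0r => y0 /esym/eqP.
  rewrite mulf_eq0 (negPf y0) orbF => /eqP ex'.
  exists (y' / y); last by rewrite ex' mulr0 divfK.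
  by move: xy0'; rewrite ex' eqxx /= => y0'; rewrite mulf_neq0 ?invr_eq0.
have ey' : y' = x' / x * y by rewrite mulrAC -cross mulrAC divff ?mul1r.
exists (x' / x); last by rewrite divfK.
rewrite mulf_neq0 ?invr_eq0 //; apply: contraTneq xy0' => ex'.
by rewrite ey' ex' !mul0r eqxx.
Qed.

Lemma cross_multiply (R : comNzRingType) (l l' x x' y y' : R) :
  l * x - l' * x' = 0 -> l * y - l' * y' = 0 -> l * l' * (x * y') = l * l' * (x' * y).
Proof.
move=> /subr0_eq ex /subr0_eq ey.
have -> : l * l' * (x * y') = (l * x) * (l' * y') by ring.
by rewrite ex -ey; ring.
Qed.

Lemma norm_scale (R : comNzRingType) (l x y d : R) :
  (l * x) ^+ 2 - (l * y) ^+ 2 * d = l ^+ 2 * (x ^+ 2 - y ^+ 2 * d).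
Proof. ring. Qed.

Section UnramifiedReduction.
Variables (p : nat) (p_pr : prime p).
Local Notation Zp := (padic_int p_pr).
Local Notation Qp := (padic p_pr).
Local Notation res := (@padic_residue p p_pr).
Variables (Fq : finFieldType) (iota : {rmorphism 'F_p -> Fq}) (xi : Zp) (s : Fq).
Hypothesis quadH : quadratic_data iota (res xi) s.
Variables (K : fieldExtType Qp) (sqrtxi : K).
Hypothesis dimK : \dim {:K} = 2%N.
Hypothesis sqrtxi2 : sqrtxi ^+ 2 = (tofrac xi)%:A.
Local Notation coordK := (coordK sqrtxi).

Definition coordF (X Y : Zp) : Fq := iota (res X) + iota (res Y) * s.

(** The residue of z in Fq^*, up to F_p^*: remove from z a factor in Q_p so that
its coordinates are p-adic integers, not both divisible by p, and reduce. The
removed factor is unique up to a p-adic unit only. *)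
Definition reduces (z : K) (t : Fq) := exists l X Y,
  [/\ l != 0, (res X, res Y) != (0, 0), z = l *: coordK (tofrac X) (tofrac Y)
    & t = coordF X Y].

Lemma coordF_neq0 X Y : ((res X, res Y) != (0, 0)) = (coordF X Y != 0).
Proof.
apply/idP/idP; apply: contraNneq; first by move/(coord_eq0 quadH) => [-> ->].
by case=> rX rY; rewrite /coordF rX rY !rmorph0 mul0r addr0.
Qed.

Lemma coordFM X Y X' Y' : coordF X Y * coordF X' Y' =
  coordF (X * X' + Y * Y' * xi) (X * Y' + Y * X').
Proof.
rewrite /coordF !rmorphD !rmorphM /= -(qd_sqr quadH); ring.
Qed.

Lemma residue_norm X Y :
  iota (res (X ^+ 2 - Y ^+ 2 * xi)) = coordF X Y * coordF X Y ^+ p.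
Proof.
have -> : res (X ^+ 2 - Y ^+ 2 * xi) = res X ^+ 2 - res Y ^+ 2 * res xi.
  by rewrite !expr2 rmorphB !rmorphM.
rewrite /coordF (frob_coord quadH) !(expr2 (res _)) rmorphB !rmorphM -(qd_sqr quadH); ring.
Qed.

Lemma primitive_norm_unit X Y : (res X, res Y) != (0, 0) ->
  X ^+ 2 - Y ^+ 2 * xi \is a GRing.unit.
Proof.
rewrite coordF_neq0 => t0; apply: residue_neq0_unit.
by rewrite -(fmorph_eq0 iota) residue_norm mulf_neq0 ?expf_neq0.
Qed.

Lemma primitive_norm_neq0 X Y : (res X, res Y) != (0, 0) ->
  tofrac X ^+ 2 - tofrac Y ^+ 2 * tofrac xi != 0 :> Qp.
Proof.
move/primitive_norm_unit => uN.
rewrite -!tofracXn -tofracM -tofracB tofrac_eq0.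
by apply: contraTneq uN => ->; rewrite unitr0.
Qed.

Lemma norm_neq0 (x y : Qp) : (x, y) != (0, 0) -> x ^+ 2 - y ^+ 2 * tofrac xi != 0.
Proof.
move/primitive_Qp => [l [X [Y [l0 prim -> ->]]]].
rewrite norm_scale; apply: mulf_neq0; first exact: expf_neq0.
exact: primitive_norm_neq0.
Qed.

(** Such an element is nonzero because its norm is: for primitive coordinates,
the norm reduces to the norm of a nonzero element of Fq. *)
Lemma coordQ_neq0 (x y : Qp) : (x, y) != (0, 0) -> coordK x y != 0.
Proof. by move/norm_neq0; apply: contra_neq => /(coordK_eq0 sqrtxi2). Qed.

Lemma coordQ_surj z : exists x y : Qp, z = coordK x y.
Proof.
apply: (coordK_surj dimK) => x y xy0; apply/eqP.
have : (x, y) == (0, 0).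
  by apply/negPn/negP => /coordQ_neq0; rewrite xy0 eqxx.
by rewrite xpair_eqE => /andP[].
Qed.

Lemma reduces_exists z : z != 0 -> exists t, reduces z t.
Proof.
have [x [y ->]] := coordQ_surj z => z0.
have xy0 : (x, y) != (0, 0).
  by apply: contraNneq z0 => -[-> ->]; rewrite coordK_algr scale0r.
have [l [X [Y [l0 prim ex ey]]]] := primitive_Qp xy0.
exists (coordF X Y), l, X, Y; split => //.
by rewrite ex ey coordKZ.
Qed.

Lemma reduces_neq0 z t : reduces z t -> z != 0 /\ t != 0.
Proof.
move=> [l [X [Y [l0 prim -> ->]]]]; rewrite -coordF_neq0; split => //.
rewrite scaler_eq0 negb_or l0; apply: coordQ_neq0.
have := primitive_norm_neq0 prim; apply: contra_neq => -[-> ->].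
by rewrite !expr0n mul0r subr0.
Qed.

Lemma reduces_lift t : t != 0 -> exists X Y,
  [/\ (res X, res Y) != (0, 0), t = coordF X Y & reduces (coordK (tofrac X) (tofrac Y)) t].
Proof.
move=> t0; have [X eX] := residue_surj p_pr (reF iota t).
have [Y eY] := residue_surj p_pr (imF iota s t).
have et : t = coordF X Y by rewrite /coordF eX eY -(Fq_coord quadH).
have prim : (res X, res Y) != (0, 0) by rewrite coordF_neq0 -et.
exists X, Y; split => //; exists 1, X, Y; split => //; first exact: oner_neq0.
by rewrite scale1r.
Qed.

Lemma reducesM z z' t t' : reduces z t -> reduces z' t' -> reduces (z * z') (t * t').
Proof.
move=> [l [X [Y [l0 prim -> ->]]]] [l' [X' [Y' [l0' prim' -> ->]]]].
exists (l * l'), (X * X' + Y * Y' * xi), (X * Y' + Y * X'); split.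
- exact: mulf_neq0.
- by rewrite coordF_neq0 -coordFM mulf_neq0 -?coordF_neq0.
- by rewrite -scalerAl -scalerAr scalerA (coordKM sqrtxi2) !tofracD !tofracM.
- by rewrite coordFM.
Qed.

(** Two primitive coordinate vectors of z are proportional, and so are their
reductions. *)
Lemma reduces_unique z t t' : reduces z t -> reduces z t' ->
  exists2 c : 'F_p, c != 0 & t' = iota c * t.
Proof.
move=> [l [X [Y [l0 prim ez et]]]] [l' [X' [Y' [l0' prim' ez' et']]]].
have eK : coordK (l * tofrac X - l' * tofrac X') (l * tofrac Y - l' * tofrac Y') = 0.
  by rewrite -coordKB !coordKZ -ez -ez' subrr.
have [/eqP eX /eqP eY] : l * tofrac X - l' * tofrac X' == 0 /\
    l * tofrac Y - l' * tofrac Y' == 0.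
  apply/andP; rewrite -xpair_eqE; apply/negPn/negP => /coordQ_neq0.
  by rewrite eK eqxx.
have cross : X * Y' = X' * Y.
  apply/eqP; rewrite -tofrac_eq !tofracM; apply/eqP.
  apply: (mulfI (mulf_neq0 l0 l0')).
  exact: cross_multiply eX eY.
have {}cross : res X * res Y' = res X' * res Y by rewrite -!rmorphM cross.
have [c c0 [eX' eY']] := proportional prim prim' cross.
by exists c => //; rewrite et et' /coordF eX' eY' !rmorphM mulrDr mulrA.
Qed.

Section InflatedCharacters.
Variable C : numFieldType.
Implicit Types (chiK : K -> C) (chi : Fq -> C).

Definition inflates chiK chi :=
  mulchar chiK /\ forall z t, reduces z t -> chiK z = chi t.

(** The character of K^* trivial on Q_p^* that extends chi along reduces. *)
Definition lift_char chi (z : K) : C :=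
  if pselect (exists t, reduces z t) is left e then chi (sval (cid e)) else 0.

Lemma reduces1 : reduces 1 1.
Proof.
exists 1, 1, 0; split.
- exact: oner_neq0.
- by rewrite xpair_eqE rmorph1 oner_eq0.
- by rewrite scale1r tofrac0 coordK_algr tofrac1 scale1r.
- by rewrite /coordF rmorph1 !rmorph0 rmorph1 mul0r addr0.
Qed.

Lemma lift_char_inflates chi : mulchar chi -> trivial_on_Fp iota chi ->
  inflates (lift_char chi) chi.
Proof.
move=> chi_char chi_Fp; have [chi0 chi1 chiM] := chi_char.
have lift_red z t : reduces z t -> lift_char chi z = chi t.
  move=> zt; rewrite /lift_char; case: pselect => [e|]; last by case; exists t.
  case: (cid e) => t' zt' /=; have [c c0 ->] := reduces_unique zt' zt.
  by rewrite chiM chi_Fp // mul1r.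
have lift0 : lift_char chi 0 = 0.
  rewrite /lift_char; case: pselect => // e; exfalso.
  by case: e => t /reduces_neq0[]; rewrite eqxx.
split => //; split => //; first by rewrite (lift_red _ _ reduces1).
move=> z z'; have [-> | z0] := eqVneq z 0; first by rewrite mul0r lift0 mul0r.
have [-> | z0'] := eqVneq z' 0; first by rewrite mulr0 lift0 mulr0.
have [t zt] := reduces_exists z0; have [t' zt'] := reduces_exists z0'.
by rewrite (lift_red _ _ zt) (lift_red _ _ zt') (lift_red _ _ (reducesM zt zt')).
Qed.

Lemma triv_inflates : inflates (triv_char K C) (triv_char Fq C).
Proof.
split; first exact: triv_mulchar.
by move=> z t /reduces_neq0[z0 t0]; rewrite /triv_char z0 t0.
Qed.

Lemma tame_inflates chiK chi : tame_char sqrtxi iota s chiK chi ->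
  [/\ inflates chiK chi, mulchar chi & trivial_on_Fp iota chi].
Proof.
case=> chiK_char chiK_Qp _ chi_char chi_res; have [_ _ chiKM] := chiK_char.
split => //; first split => //.
  move=> _ _ [l [X [Y [l0 prim -> ->]]]].
  by rewrite -mulr_algl chiKM chiK_Qp // mul1r chi_res.
move=> x x0; have [X eX] := residue_surj p_pr x.
have resX : (res X, res 0) != (0, 0) by rewrite xpair_eqE eX (negPf x0).
have := chi_res X 0 resX.
rewrite tofrac0 scale0r addr0 chiK_Qp; last first.
  rewrite tofrac_eq0; apply: contraNneq x0 => X0.
  by rewrite -eX X0 rmorph0.
by rewrite eX !rmorph0 mul0r addr0.
Qed.

Lemma inflates_neq chiK chiK' chi chi' t : inflates chiK chi -> inflates chiK' chi' ->
  t != 0 -> chi t != chi' t -> chiK <> chiK'.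
Proof.
move=> [_ infl] [_ infl'] t0 /eqP neq eq_chi; apply: neq.
have [X [Y [_ _ zt]]] := reduces_lift t0.
by rewrite -(infl _ _ zt) -(infl' _ _ zt) eq_chi.
Qed.

Lemma quad_char_inflated chiK chi : inflates chiK chi -> mulchar chi ->
  quad_char chiK -> quad_char chi.
Proof.
move=> [[chiK0 _ _] infl] chi_char [_ chiK_nontriv chiK_sqr]; split => //.
  move=> chi_triv; apply: chiK_nontriv; apply/funext => z; rewrite /triv_char.
  have [-> | z0] := eqVneq z 0; first by rewrite chiK0.
  have [t zt] := reduces_exists z0.
  by have [_ t0] := reduces_neq0 zt; rewrite (infl _ _ zt) chi_triv /triv_char t0.
apply/funext => t; rewrite /triv_char; have [-> | t0] := eqVneq t 0.
  by case: chi_char => -> _ _; rewrite expr0n.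
have [X [Y [_ _ zt]]] := reduces_lift t0; have [z0 _] := reduces_neq0 zt.
by rewrite -(infl _ _ zt) (congr1 (fun f => f _) chiK_sqr) /triv_char z0.
Qed.

End InflatedCharacters.
End UnramifiedReduction.

(** * The characters of the residue field trivial on the prime field *)

Lemma prim_root_exists (C : numClosedFieldType) n : (0 < n)%N ->
  exists z : C, n.-primitive_root z.
Proof.
move=> n_gt0; pose q : {poly C} := 'X^n - 1; have [r def_q] := closed_field_poly_normal q.
have q_monic : q \is monic by rewrite /q -[1]polyC1 monicXnsubC.
rewrite (monicP q_monic) scale1r in def_q.
have root_r : all n.-unity_root r.
  by apply/allP => z; rewrite -root_prod_XsubC -def_q.
have sz_r : (n <= size r)%N.
  by rewrite -ltnS -(size_prod_XsubC r id) -def_q /q size_XnsubC.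
have uniq_r : uniq r.
  by rewrite -separable_prod_XsubC -def_q separable_Xn_sub_1 // pnatr_eq0 -lt0n.
by have /hasP[z _ zP] := has_prim_root n_gt0 root_r uniq_r sz_r; exists z.
Qed.

Section CharacterFamily.
Variables (p : nat) (Fq : finFieldType).
Variables (iota : {rmorphism 'F_p -> Fq}) (xi : 'F_p) (s : Fq).
Hypothesis quadH : quadratic_data iota xi s.
Local Notation p_pr := (qd_prime quadH).
Variable C : numClosedFieldType.

(** Take chi1 mapping a generator of Fq^* to a primitive (p+1)-st root of unity.
The exponents are i + 1, so that all the powers vanish at 0. *)
Lemma char_family : exists chi1 : Fq -> C,
  [/\ mulchar chi1, trivial_on_Fp iota chi1,
    forall t, t != 0 -> chi1 t = 1 -> exists x, t = iota x,
    exists2 t0, t0 != 0 & p.+1.-primitive_root (chi1 t0) &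
    forall chi, mulchar chi -> trivial_on_Fp iota chi ->
      exists i : 'I_p.+1, forall t, chi t = chi1 t ^+ i.+1].
Proof.
have [zeta zetaP] := prim_root_exists C (ltn0Sn p).
have [g gP] := finField_generator Fq.
have cardE := pred_card_Fq quadH.
have g0 : g != 0 by rewrite (prim_root_eq0 gP) -lt0n (prim_order_gt0 gP).
have p1_gt0 : (0 < p.-1)%N by rewrite -subn1 subn_gt0 (prime_gt1 p_pr).
have log t : {i : nat | t != 0 -> t = g ^+ i}.
  have [-> | t0] := eqVneq t 0; first by exists 0%N; rewrite ?eqxx.
  by have [[i _] /= ei] := prim_rootP gP (expf_card1 t0); exists i.
pose chi1 t : C := if t == 0 then 0 else zeta ^+ sval (log t).
have chi1_g i : chi1 (g ^+ i) = zeta ^+ i.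
  have gi0 := expf_neq0 i g0.
  rewrite /chi1; case: (log _) => i' /= /(_ gi0)/eqP; rewrite (negPf gi0).
  rewrite (eq_prim_root_expr gP) cardE => /eqP ei.
  apply/eqP; rewrite (eq_prim_root_expr zetaP); apply/eqP.
  by rewrite -(modn_dvdm i' (dvdn_mull p.-1 (dvdnn p.+1))) -ei modn_dvdm // dvdn_mull.
have log_ex t : t != 0 -> exists i, t = g ^+ i.
  by move=> t0; case: (log t) => i ei; exists i; apply: ei.
have chi10 : chi1 0 = 0 by rewrite /chi1; case: (log 0) => i _ /=; rewrite eqxx.
exists chi1; split.
- split => //; first by rewrite -(expr0 g) chi1_g expr0.
  move=> x y; have [-> | x0] := eqVneq x 0; first by rewrite mul0r chi10 mul0r.
  have [-> | y0] := eqVneq y 0; first by rewrite mulr0 chi10 mulr0.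
  have [i ->] := log_ex x x0; have [i' ->] := log_ex y y0.
  by rewrite -exprD !chi1_g exprD.
- move=> x x0; have ix0 : iota x != 0 by rewrite fmorph_eq0.
  have [i ei] := log_ex _ ix0; rewrite ei chi1_g; apply/eqP.
  rewrite -(prim_order_dvd zetaP) -(dvdn_pmul2l p1_gt0) -cardE (prim_order_dvd gP).
  rewrite mulnC exprM -ei -rmorphXn.
  by rewrite -[p.-1](congr1 predn (card_Fp p_pr)) expf_card1 // rmorph1.
- move=> t t0; have [i ->] := log_ex t t0; rewrite chi1_g => /eqP.
  rewrite -(prim_order_dvd zetaP) => dvd_i; apply: (frob_fixed quadH).
  apply: (mulIf (invr_neq0 (expf_neq0 i g0))); rewrite divff ?expf_neq0 //.
  rewrite -[p in LHS](prednK (prime_gt0 p_pr)) exprSr mulfK ?expf_neq0 //.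
  apply/eqP; rewrite -exprM -(prim_order_dvd gP) cardE mulnC dvdn_pmul2r //.
- by exists g => //; rewrite -(expr1 g) chi1_g expr1.
move=> chi chi_char chi_Fp.
have chi_g : chi g ^+ p.+1 = 1.
  rewrite -(mulcharX _ _ chi_char); have [x ex] := norm_in_Fp quadH g.
  by rewrite ex chi_Fp // -(fmorph_eq0 iota) -ex expf_neq0.
have [[i lt_i] /= ei] := prim_rootP zetaP chi_g.
have lt_i' : ((i + p) %% p.+1 < p.+1)%N by rewrite ltn_pmod.
exists (Ordinal lt_i') => t /=.
have [-> | t0] := eqVneq t 0; first by case: chi_char => -> _ _; rewrite chi10 exprS mul0r.
have zeta_i : zeta ^+ ((i + p) %% p.+1).+1 = zeta ^+ i.
  apply/eqP; rewrite (eq_prim_root_expr zetaP) -addn1 modnDml -addnA addn1.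
  by rewrite modnDr.
have [e ->] := log_ex t t0.
by rewrite (mulcharX _ _ chi_char) chi1_g ei -zeta_i -!exprM mulnC.
Qed.

End CharacterFamily.

(** * Eigenvectors of the nonsplit torus *)

Section TorusProjections.
Variables (p : nat) (Fq : finFieldType).
Variables (iota : {rmorphism 'F_p -> Fq}) (xi : 'F_p) (s : Fq).
Variables (C : numClosedFieldType) (nu : Fq -> C).
Variable rho : mx_representation C [set: {'GL_2['F_p]}] p.-1.
Hypothesis cuspH : cuspidal_data iota xi s nu rho.
Local Notation quadH := (cd_quad cuspH).
Local Notation rhoM := (rhoM rho).
Local Notation torus_mx := (torus_mx iota xi s).
Local Notation torus_sum_op := (torus_sum_op iota xi s rho).

Lemma torus_sum_op_eigen chi t : mulchar chi -> t != 0 ->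
  rhoM (torus_mx t) *m torus_sum_op chi = chi t *: torus_sum_op chi.
Proof.
move=> chi_char t0; have [_ chi1 chiM] := chi_char.
rewrite /torus_sum_op mulmx_sumr scaler_sumr.
rewrite -[RHS](reindex_mulf _ t0) /=; apply: eq_bigr => u u0.
rewrite -scalemxAr -(rhoM_mul rho (torus_unit quadH t0) (torus_unit quadH u0)).
rewrite -(torus_mxM quadH) scalerA; congr (_ *: _).
by rewrite invfM chiM mulrA -chiM divff // chi1 mul1r.
Qed.

(** The sum over i of chi1(t^-1)^(i+1) is p + 1 or 0 according to whether
chi1(t^-1) = 1, that is, whether t is in the prime field, where the matrix of t
is scalar and acts trivially. *)
Lemma torus_sum_op_complete (chi1 : Fq -> C) : mulchar chi1 ->
  trivial_on_Fp iota chi1 -> (forall t, t != 0 -> chi1 t = 1 -> exists x, t = iota x) ->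
  exists2 N : C, N != 0 &
    \sum_(i < p.+1) torus_sum_op (fun t => chi1 t ^+ i.+1) = N%:M.
Proof.
move=> chi1_char chi1_Fp chi1_ker; have [_ chi11 _] := chi1_char.
pose A := [pred t : Fq | (t != 0) && (chi1 t^-1 == 1)].
exists (p.+1 * #|A|)%:R.
  rewrite pnatr_eq0 muln_eq0 /= -lt0n; apply/card_gt0P; exists 1.
  by rewrite inE oner_eq0 invr1 chi11 eqxx.
rewrite /torus_sum_op exchange_big /=.
have term t : t != 0 -> \sum_(i < p.+1) chi1 t^-1 ^+ i.+1 *: rhoM (torus_mx t) =
    (if chi1 t^-1 == 1 then (p.+1%:R)%:M else 0).
  move=> t0; rewrite -scaler_suml; case: eqP => [w1 | /eqP w1].
    have tV0 : t^-1 != 0 by rewrite invr_eq0.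
    have [x ex] := chi1_ker _ tV0 w1.
    have x0 : x != 0 by rewrite -(fmorph_eq0 iota) -ex.
    have -> : t = iota x^-1 by rewrite fmorphV -ex invrK.
    rewrite (torus_mx_iota quadH) (rhoM_scalar cuspH) ?invr_eq0 //.
    rewrite scalemx1 fmorphV invrK -ex w1; congr (_%:M).
    under eq_bigr do rewrite expr1n.
    by rewrite sumr_const card_ord.
  have wn : chi1 t^-1 ^+ p.+1 = 1.
    have [x ex] := norm_in_Fp quadH t^-1.
    rewrite -(mulcharX _ _ chi1_char) ex chi1_Fp // -(fmorph_eq0 iota) -ex.
    by rewrite expf_neq0 // invr_eq0.
  have : (chi1 t^-1 - 1) * \sum_(i < p.+1) chi1 t^-1 ^+ i = 0.
    by rewrite -subrX1 wn subrr.
  move/eqP; rewrite mulf_eq0 subr_eq0 (negPf w1) => /eqP sum0.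
  under eq_bigr do rewrite exprS.
  by rewrite -mulr_sumr sum0 mulr0 scale0r.
rewrite (eq_bigr _ term) -big_mkcondr /= sumr_const.
by rewrite -scaler_nat scale_scalar_mx -natrM mulnC.
Qed.

End TorusProjections.

(** * Test vectors *)

Section TestVectors.
Variables (p : nat) (p_pr : prime p).
Local Notation Zp := (padic_int p_pr).
Local Notation Qp := (padic p_pr).
Local Notation res := (@padic_residue p p_pr).
Variables (Fq : finFieldType) (iota : {rmorphism 'F_p -> Fq}) (xi : Zp) (s : Fq).
Variables (K : fieldExtType Qp) (sqrtxi : K).
Hypothesis dimK : \dim {:K} = 2%N.
Hypothesis sqrtxi2 : sqrtxi ^+ 2 = (tofrac xi)%:A.
Variables (C : numClosedFieldType) (nu : Fq -> C).
Variable rho : mx_representation C [set: {'GL_2['F_p]}] p.-1.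
Hypothesis cuspH : cuspidal_data iota (res xi) s nu rho.
Local Notation quadH := (cd_quad cuspH).
Local Notation rhoM := (rhoM rho).
Local Notation torus_mx := (torus_mx iota (res xi) s).
Local Notation torus_sum_op := (torus_sum_op iota (res xi) s rho).
Local Notation inflates := (inflates iota s sqrtxi).
Local Notation coordK := (coordK sqrtxi).
Variables (V : lmodType C) (Pi : 'M[Qp]_2 -> V -> V).
Hypotheses (Pi_repr : is_repr Pi) (Pi_central : trivial_central_char Pi).

Local Notation torusQ x y := (mx2 x y (y * tofrac xi) x).

Lemma torusQ_unit (x y : Qp) : (x, y) != (0, 0) -> torusQ x y \in unitmx.
Proof.
move=> xy0; rewrite mx2_unit; have := norm_neq0 quadH xy0.
by rewrite !expr2 mulrA.
Qed.

Lemma Pi0 g : g \in unitmx -> Pi g 0 = 0.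
Proof.
move=> ug; have := repr_linear Pi_repr ug 1 0 0; rewrite !scale1r addr0 => /eqP.
by rewrite -subr_eq0 opprD addNKr oppr_eq0 => /eqP.
Qed.

Lemma Pi_scale g a v : g \in unitmx -> Pi g (a *: v) = a *: Pi g v.
Proof. by move=> ug; have := repr_linear Pi_repr ug a v 0; rewrite Pi0 // !addr0. Qed.

Lemma Pi_add g u v : g \in unitmx -> Pi g (u + v) = Pi g u + Pi g v.
Proof. by move=> ug; have := repr_linear Pi_repr ug 1 u v; rewrite !scale1r. Qed.

Lemma Pi_sum g (I : Type) (r : seq I) (u : I -> V) : g \in unitmx ->
  Pi g (\sum_(i <- r) u i) = \sum_(i <- r) Pi g (u i).
Proof.
move=> ug; elim/big_rec2: _ => [|i v w _ <-]; last exact: Pi_add.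
exact: Pi0.
Qed.

Lemma torus_eigenvectorZ chi a w : torus_eigenvector Pi xi sqrtxi chi w ->
  torus_eigenvector Pi xi sqrtxi chi (a *: w).
Proof.
move=> w_eig x y xy0; rewrite Pi_scale ?torusQ_unit // w_eig //.
by rewrite !scalerA mulrC.
Qed.

(** Choose z in K^* where the last character differs from chi, and apply to the
sum the operator of z minus the value of that character: this kills the last
eigenvector and multiplies the others by scalars, by a nonzero one for w. *)
Lemma torus_eigenvectors_independent chi d (c : 'I_d -> K -> C) w (u : 'I_d -> V) :
  mulchar chi -> torus_eigenvector Pi xi sqrtxi chi w ->
  (forall i, [/\ mulchar (c i), c i <> chi &
                 torus_eigenvector Pi xi sqrtxi (c i) (u i)]) ->
  w + \sum_(i < d) u i = 0 -> w = 0.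
Proof.
move=> chi_char; elim: d c w u => [|d IHd] c w u w_eig u_eig sum0.
  by move: sum0; rewrite big_ord0 addr0.
have [c_char c_neq c_eig] := u_eig ord_max.
have [z z_neq] : exists z, c ord_max z != chi z.
  by apply: contrapT => none; apply: c_neq; apply/funext => z;
     apply: contrapT => /eqP neq; apply: none; exists z.
have [x [y ez]] := coordQ_surj quadH dimK sqrtxi2 z.
have xy0 : (x, y) != (0, 0).
  apply: contraNneq z_neq => -[x0 y0]; rewrite ez x0 y0 coordK_algr scale0r.
  by case: c_char => -> _ _; case: chi_char => -> _ _.
have ug := torusQ_unit xy0.
have w_act : Pi (torusQ x y) w = chi z *: w by rewrite ez; apply: w_eig.
have u_act i : Pi (torusQ x y) (u i) = c i z *: u i.
  by have [_ _ u_eig_i] := u_eig i; rewrite ez; apply: u_eig_i.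
have zero : (chi z - c ord_max z) *: w +
    \sum_(i < d) (c (widen_ord (leqnSn d) i) z - c ord_max z) *: u (widen_ord (leqnSn d) i) = 0.
  have key : Pi (torusQ x y) (w + \sum_(i < d.+1) u i)
      - c ord_max z *: (w + \sum_(i < d.+1) u i) = 0.
    by rewrite sum0 Pi0 // scaler0 subr0.
  rewrite -[RHS]key Pi_add // Pi_sum // w_act (eq_bigr _ (fun i _ => u_act i)).
  rewrite scalerDr opprD addrACA -scalerBl; congr (_ + _).
  rewrite scaler_sumr -sumrB big_ord_recr /= subrr addr0.
  by apply: eq_bigr => i _; rewrite scalerBl.
have := IHd (fun i => c (widen_ord (leqnSn d) i)) _ _ _ _ zero.
have w_eig' := torus_eigenvectorZ (chi z - c ord_max z) w_eig.
move=> /(_ w_eig') H; apply/eqP.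
have /eqP : (chi z - c ord_max z) *: w = 0.
  apply: H => i; have [ci cn ce] := u_eig (widen_ord (leqnSn d) i).
  by split => //; apply: torus_eigenvectorZ.
by rewrite scaler_eq0 subr_eq0 eq_sym (negPf z_neq).
Qed.

(** Applying sqrt(xi) to a decomposition of v and subtracting la v gives a
vanishing sum of torus eigenvectors whose component along chiK is
(chiK(sqrt xi) - la) w. *)
Lemma not_test_vector chiK la v : mulchar chiK ->
  Pi (torusQ 0 1) v = la *: v -> chiK sqrtxi != la ->
  ~ test_vector Pi xi sqrtxi chiK v.
Proof.
move=> chi_char v_act neq [w [d [c [u [w0 w_eig u_eig ev]]]]].
have xy0 : (0, 1) != (0, 0) :> Qp * Qp by rewrite xpair_eqE oner_eq0 andbF.
have ug := torusQ_unit xy0.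
have w_act : Pi (torusQ 0 1) w = chiK sqrtxi *: w.
  by rewrite -[X in chiK X](coordK01 sqrtxi); apply: w_eig.
have u_act i : Pi (torusQ 0 1) (u i) = c i sqrtxi *: u i.
  have [_ _ u_eig_i] := u_eig i.
  by rewrite -[X in c i X](coordK01 sqrtxi); apply: u_eig_i.
have zero : (chiK sqrtxi - la) *: w + \sum_(i < d) (c i sqrtxi - la) *: u i = 0.
  move: v_act; rewrite ev Pi_add // Pi_sum // w_act.
  under eq_bigr => i _ do rewrite u_act.
  move=> v_act; under eq_bigr => i _ do rewrite scalerBl.
  by rewrite sumrB scalerBl addrACA -opprD -scaler_sumr -scalerDr v_act subrr.
have u_eig' i : [/\ mulchar (c i), c i <> chiK &
    torus_eigenvector Pi xi sqrtxi (c i) ((c i sqrtxi - la) *: u i)].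
  by have [ci cn ce] := u_eig i; split => //; apply: torus_eigenvectorZ.
have w_eig' := torus_eigenvectorZ (chiK sqrtxi - la) w_eig.
have /eqP := torus_eigenvectors_independent chi_char w_eig' u_eig' zero.
by rewrite scaler_eq0 subr_eq0 (negPf neq) (negPf w0).
Qed.

Variable f : {linear 'cV[C]_(p.-1) -> V}.
Hypothesis f_inj : injective f.
Hypothesis f_equiv : forall (g : 'M[Zp]_2) (g' : {'GL_2['F_p]}), g \in unitmx ->
  GLval g' = map_mx res g ->
  forall u, Pi (map_mx (@tofrac _) g) (f u) = f (rho g' *m u).

Lemma Pi_primitive (X Y : Zp) u : (res X, res Y) != (0, 0) ->
  Pi (torusQ (tofrac X) (tofrac Y)) (f u) =
  f (rhoM (torus_mx (coordF iota s X Y)) *m u).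
Proof.
move=> prim; have t0 : coordF iota s X Y != 0 by rewrite -(coordF_neq0 quadH).
have uG : mx2 X Y (Y * xi) X \in unitmx.
  rewrite unitmxE det_mx2; have := primitive_norm_unit quadH prim.
  by rewrite !expr2 mulrA.
have eG : map_mx res (mx2 X Y (Y * xi) X) = torus_mx (coordF iota s X Y).
  rewrite map_mx2 /torus_mx /coordF (coord_reF quadH) (coord_imF quadH).
  by rewrite rmorphM.
have ug := torus_unit quadH t0.
rewrite -tofracM -(map_mx2 (@tofrac _)) (f_equiv uG (g' := gl (torus_mx (coordF iota s X Y)))) //.
by rewrite glK // eG.
Qed.

Lemma torus_eigenvector_f chiK chi u : inflates chiK chi ->
  (forall t, t != 0 -> rhoM (torus_mx t) *m u = chi t *: u) ->
  torus_eigenvector Pi xi sqrtxi chiK (f u).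
Proof.
move=> [_ infl] u_eig x y xy0.
have [l [X [Y [l0 prim ex ey]]]] := primitive_Qp xy0.
have red_xy : reduces iota s sqrtxi (coordK x y) (coordF iota s X Y).
  by exists l, X, Y; split => //; rewrite ex ey coordKZ.
have act : chiK (x%:A + y *: sqrtxi) = chi (coordF iota s X Y) := infl _ _ red_xy.
rewrite act.
have XY0 : (tofrac X, tofrac Y) != (0, 0) :> Qp * Qp.
  by apply: contraNneq xy0 => -[X0 Y0]; rewrite ex ey X0 Y0 !mulr0.
have -> : torusQ x y = l%:M *m torusQ (tofrac X) (tofrac Y).
  by rewrite scalar_mul_mx2 mulrA -ex -ey.
rewrite (reprM Pi_repr (scalar_unit l0) (torusQ_unit XY0)) Pi_central //.
rewrite Pi_primitive // u_eig ?linearZ //.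
by rewrite -(coordF_neq0 quadH).
Qed.

(** The components of f u are the images of its projections along the p + 1
characters of Fq^* trivial on the prime field, which lift to K^*. *)
Lemma test_vector_of_projection chiK chi u : inflates chiK chi -> mulchar chi ->
  trivial_on_Fp iota chi -> torus_sum_op chi *m u != 0 ->
  test_vector Pi xi sqrtxi chiK (f u).
Proof.
move=> infl chi_char chi_Fp proj_neq0.
have [chi1 [chi1_char chi1_Fp chi1_ker [t0 t0_neq0 t0P] chi_fam]] := char_family quadH C.
have [i0 chiE] := chi_fam chi chi_char chi_Fp.
have [N N0 complete] := torus_sum_op_complete cuspH chi1_char chi1_Fp chi1_ker.
pose chi_ (i : 'I_p.+1) t := chi1 t ^+ i.+1.
have chi_char' i : mulchar (chi_ i).
  have [c0 c1 cM] := chi1_char; split; rewrite /chi_.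
  - by rewrite c0 exprS mul0r.
  - by rewrite c1 expr1n.
  - by move=> x y; rewrite cM exprMn.
have chi_Fp' i : trivial_on_Fp iota (chi_ i).
  by move=> x x0; rewrite /chi_ chi1_Fp // expr1n.
have eq_chi : chi = chi_ i0 by apply/funext.
pose comp i := N^-1 *: (torus_sum_op (chi_ i) *m u).
have comp_eig i t : t != 0 -> rhoM (torus_mx t) *m comp i = chi_ i t *: comp i.
  move=> tn0; rewrite /comp -scalemxAr mulmxA (torus_sum_op_eigen cuspH) //.
  by rewrite -scalemxAl !scalerA mulrC.
exists (f (comp i0)), p, (fun i => lift_char iota s sqrtxi (chi_ (lift i0 i))),
  (fun i => f (comp (lift i0 i))); split.
- rewrite -(raddf0 f) (inj_eq f_inj) /comp scaler_eq0 invr_eq0 negb_or N0.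
  by rewrite -eq_chi.
- by apply: torus_eigenvector_f infl _ => t tn0; rewrite eq_chi comp_eig.
- move=> i; have infl_i := lift_char_inflates quadH dimK sqrtxi2
    (chi_char' (lift i0 i)) (chi_Fp' (lift i0 i)).
  split; first by case: infl_i.
    apply: (inflates_neq quadH infl_i infl t0_neq0).
    rewrite eq_chi /chi_ (eq_prim_root_expr t0P) -[i0.+1]addn1 -[(lift i0 i).+1]addn1.
    rewrite eqn_modDr !modn_small // eq_sym; exact: neq_lift.
  by apply: torus_eigenvector_f infl_i _ => t tn0; rewrite comp_eig.
rewrite -raddf_sum -raddfD -(bigD1_ord i0 (P := xpredT)) //=; congr (f _).
rewrite /comp -scaler_sumr -mulmx_suml complete mul_scalar_mx scalerA mulVf //.
by rewrite scale1r.
Qed.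

End TestVectors.

(** * Types and exponents *)

(** Such a projector is the product of u and a row vector. *)
Lemma rank1_projector_image (K : numFieldType) n (A M : 'M[K]_n) (u : 'cV[K]_n) :
  A *m A = A -> \tr A = 1 -> A *m u = u -> u != 0 -> M *m A != 0 -> M *m u != 0.
Proof.
move=> AA trA Au u0; apply: contra_neq => Mu.
have [i ui] : exists i, u i 0 != 0.
  apply: contrapT => none; case/eqP: u0; apply/colP => i; rewrite mxE.
  by apply: contrapT => /eqP ui; apply: none; exists i.
pose r : 'rV[K]_n := (u i 0)^-1 *: delta_mx 0 i.
have ru : r *m u = 1%:M.
  by rewrite /r -scalemxAl -rowE [row i u]mx11_scalar mxE scale_scalar_mx mulVf.
have <- : u *m (r *m A) = A.
  have := idempotent_tr1_sandwich (u *m r) AA trA.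
  rewrite !mulmxA Au -(mulmxA u r A) => ->.
  by rewrite mxtrace_mulC -mulmxA Au ru mxtrace1 scale1r.
by rewrite mulmxA Mu mul0mx.
Qed.

Lemma quad_char_sqr (F C : fieldType) (c : F -> C) x :
  quad_char c -> x != 0 -> c x ^+ 2 = 1.
Proof.
by move=> [_ _ c2] x0; rewrite (congr1 (fun f => f x) c2) /triv_char x0.
Qed.

Section Types.
Variables (p : nat) (Fq : finFieldType).
Variables (iota : {rmorphism 'F_p -> Fq}) (xi : 'F_p) (s : Fq).
Variables (C : numFieldType) (nu : Fq -> C).
Variable rho : mx_representation C [set: {'GL_2['F_p]}] p.-1.
Variables (k : fieldType) (red : C -> k) (j : {rmorphism Fq -> k}) (a b : nat).
Hypothesis rdH : reduction_data iota xi s nu rho red j a b.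
Local Notation cuspH := (rd_cusp rdH).
Local Notation redH := (rd_red rdH).
Local Notation quadH := (cd_quad cuspH).
Local Notation p_pr := (qd_prime quadH).

(** As a + b = p - 1, one has a + p b = (p - 1) (b + 1). *)
Lemma nu_exponent : red_exponent p red j nu b.+1.
Proof.
have [m [ea ep]] := half_diff rdH.
move=> t t0; rewrite (rd_nu rdH) //; congr (_ ^+ _).
by rewrite (_ : p = (a + b).+1) /= ?mulSn ?mulnS; lia.
Qed.

(** The bounds a + p b and b + p a are (p - 1) (b + 1) and (p - 1) (a + 1). *)
Lemma type1E chi e : (e <= p)%N -> red_exponent p red j chi e ->
  type1 p red j a b chi <-> (b.+1 < e < a.+1)%N.
Proof.
move=> le_e exp_e; have [m [ea ep]] := half_diff rdH.
have pE : p = (a + b).+1 by lia.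
have eL : (a + p * b = p.-1 * b.+1)%N by rewrite pE /= mulSn mulnS; lia.
have eR : (b + p * a = p.-1 * a.+1)%N by rewrite pE /= mulSn mulnS; lia.
have p1_gt0 : (0 < p.-1)%N by lia.
split=> [[r [r' [lab]]] | lt_e].
  by rewrite (label_exponent quadH le_e exp_e lab) eL eR !ltn_pmul2l.
have [r [r' [lab er]]] := exponent_label quadH le_e exp_e.
by exists r, r'; split => //; rewrite er eL eR !ltn_pmul2l.
Qed.

Lemma odd_exponent chi e : mulchar chi -> trivial_on_Fp iota chi ->
  red_exponent p red j chi e -> chi s != nu s -> odd e = odd b.
Proof.
move=> chi_char chi_Fp exp_e neq.
have := chi_s_neq quadH redH chi_char chi_Fp exp_e (cd_char cuspH) (cd_iota cuspH) nu_exponent neq.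
by rewrite /=; case: (odd e); case: (odd b).
Qed.

Lemma triv_exponent : red_exponent p red j (triv_char Fq C) 0.
Proof.
by move=> t t0; rewrite /triv_char t0 (prime_over1 redH) muln0 expr0.
Qed.

Lemma sign_red (x : C) : x ^+ 2 = 1 -> red x = 1 -> x = 1.
Proof.
move/eqP; rewrite sqrf_eq1 => /orP[] /eqP -> //.
rewrite (redN redH) ?(prime_over1 redH); last exact: (integral1 intr).
by move/eqP; rewrite (negPf (j_neg1 quadH j)).
Qed.

(** The square of chi is trivial, so p + 1 divides 2 e. If e were 0, the values of
chi would be signs reducing to 1, hence chi would be trivial. *)
Lemma quad_exponent chi e : quad_char chi -> (e <= p)%N ->
  red_exponent p red j chi e -> (2 * e = p.+1)%N.
Proof.
move=> chi_quad le_e exp_e; have [chi_char chi_nontriv _] := chi_quad.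
have [m [ea ep]] := half_diff rdH.
have p1_gt0 : (0 < p.-1)%N by lia.
have : (p.+1 %| 2 * e)%N.
  have [g gP] := finField_generator Fq.
  have g0 : g != 0 by rewrite (prim_root_eq0 gP) -lt0n (prim_order_gt0 gP).
  rewrite -(dvdn_pmul2l p1_gt0) -(pred_card_Fq quadH) (prim_order_dvd gP).
  rewrite -(inj_eq (fmorph_inj j)) rmorph1 rmorphXn mulnCA mulnC exprM -exp_e //.
  rewrite -(redX redH _ (integral_mulchar g chi_char)) quad_char_sqr //.
  by rewrite (prime_over1 redH).
case/dvdnP => [[|[|q]]] e2; [|by lia|by lia].
case: chi_nontriv; apply/funext => t; rewrite /triv_char.
have [-> | t0] := eqVneq t 0; first by case: chi_char.
apply: sign_red; first exact: quad_char_sqr.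
by rewrite exp_e // (_ : e = 0)%N ?muln0 ?expr0 //; lia.
Qed.

(** Both sides are - 1 at a generator of F_p^*. *)
Lemma quad_Fp_red (quad : 'F_p -> C) x : quad_char quad -> x != 0 ->
  red (quad x) = j (iota x ^+ p.-1./2).
Proof.
move=> quadP x0; have [quad_char' quad_nontriv _] := quadP.
have [m [ea ep]] := half_diff rdH.
have [g gP] := finField_generator ('F_p : finFieldType).
rewrite (card_Fp p_pr) in gP.
have g0 : g != 0 by rewrite (prim_root_eq0 gP) -lt0n (prim_order_gt0 gP).
have log y : y != 0 -> exists i, y = g ^+ i.
  move=> y0; have yp : y ^+ p.-1 = 1.
    by rewrite -[p.-1](congr1 predn (card_Fp p_pr)) expf_card1.
  by have [[i _] /= ei] := prim_rootP gP yp; exists i.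
have quad_g : quad g = -1.
  have /eqP := quad_char_sqr quadP g0; rewrite sqrf_eq1 => /orP[] /eqP // g1.
  case: quad_nontriv; apply/funext => y; rewrite /triv_char.
  have [-> | y0] := eqVneq y 0; first by case: quad_char'.
  by have [i ->] := log y y0; rewrite (mulcharX _ _ quad_char') g1 expr1n.
have half_g : g ^+ p.-1./2 = -1.
  have /eqP : (g ^+ p.-1./2) ^+ 2 = 1.
    by rewrite -exprM (_ : _ * 2 = p.-1)%N ?(prim_expr_order gP) //; lia.
  rewrite sqrf_eq1 => /orP[|/eqP //].
  by rewrite -(prim_order_dvd gP) => /dvdnP[[|q]]; nia.
have [i ->] := log x x0; rewrite (mulcharX _ _ quad_char') quad_g.
have -> : iota (g ^+ i) ^+ p.-1./2 = (-1) ^+ i.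
  by rewrite -rmorphXn exprAC half_g rmorphXn rmorphN1.
rewrite rmorphXn rmorphN1.
have int1 := integral1 (intr : {rmorphism int -> C}).
by rewrite (redX redH) ?(redN redH) ?(prime_over1 redH) //; apply: integral_opp.
Qed.

End Types.

(** * The theorem *)

Section DepthZeroVectors.
Variables (p : nat) (p_pr : prime p).
Local Notation Zp := (padic_int p_pr).
Local Notation Qp := (padic p_pr).
Local Notation res := (@padic_residue p p_pr).
Variable C : numClosedFieldType.
Variable rho : mx_representation C [set: {'GL_2['F_p]}] p.-1.
Variables (V : lmodType C) (Pi : 'M[Qp]_2 -> V -> V).
Variable f : {linear 'cV[C]_(p.-1) -> V}.
Hypothesis f_inj : injective f.
Hypothesis f_fixed : forall v, fixed_vector Pi 1 v <-> exists u, f u = v.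
Hypothesis f_equiv : forall (g : 'M[Zp]_2) (g' : {'GL_2['F_p]}), g \in unitmx ->
  GLval g' = map_mx res g ->
  forall u, Pi (map_mx (@tofrac _) g) (f u) = f (rho g' *m u).

Lemma mu_vector_coord mu v : mu_vector Pi mu v -> exists u,
  [/\ f u = v, u != 0 &
      forall x, x != 0 -> rhoM rho (split_mx x) *m u = mu x *: u].
Proof.
move=> [v0 /f_fixed[u fu] v_mu]; exists u; split => //.
  by apply: contraNneq v0 => u0; rewrite -fu u0 raddf0.
move=> x; have [X <-] := residue_surj p_pr x => {x} x0.
have uX := residue_neq0_unit x0.
have ug : mx2 X 0 0 1 \in unitmx by rewrite unitmxE det_mx2 mulr1 mulr0 subr0.
have eg : GLval (gl (split_mx (res X))) = map_mx res (mx2 X 0 0 1).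
  by rewrite (glK (split_unit x0)) map_mx2 !rmorph0 rmorph1.
apply: f_inj; rewrite linearZ /= fu -(v_mu X uX) -fu.
have := f_equiv ug eg u; rewrite map_mx2 !rmorph0 rmorph1 => ->.
by rewrite -rhoM_GLval (glK (split_unit x0)).
Qed.

Lemma central_char_trivial (Fq : finFieldType) (iota : {rmorphism 'F_p -> Fq})
    (nu : Fq -> C) (u : 'cV[C]_(p.-1)) : cuspidal_repr iota nu rho -> trivial_central_char Pi ->
  u != 0 -> forall x : 'F_p, x != 0 -> nu (iota x) = 1.
Proof.
move=> rho_cusp Pi_central u0 x x0; have [X eX] := residue_surj p_pr x.
have uX : X \is a GRing.unit by apply: residue_neq0_unit; rewrite eX.
have ug : (X%:M : 'M_2) \in unitmx by rewrite unitmxE det_scalar unitrX.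
have eg : GLval (gl x%:M) = map_mx res X%:M.
  by rewrite (glK (scalar_unit x0)) map_scalar_mx /= eX.
have := f_equiv ug eg u; rewrite map_scalar_mx /= Pi_central; last first.
  by rewrite tofrac_eq0; apply: contraTneq uX => ->; rewrite unitr0.
move/f_inj; rewrite (cuspidal_central rho_cusp (glK (scalar_unit x0))).
rewrite mul_scalar_mx => /eqP; rewrite -subr_eq0 -{1}[u]scale1r -scalerBl.
by rewrite scaler_eq0 (negPf u0) orbF subr_eq0 => /eqP.
Qed.

End DepthZeroVectors.

(** The reduction of nu at a generator y of F_p^* is y^(a + p b) = y^(a + b), so
that p - 1 divides a + b. *)
Lemma label_sum (p : nat) (Fq : finFieldType) (iota : {rmorphism 'F_p -> Fq})
    (C : numFieldType) (k : fieldType) (red : C -> k) (j : {rmorphism Fq -> k})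
    (nu : Fq -> C) (a b : nat) : prime p -> prime_over p red ->
  (forall x : 'F_p, x != 0 -> nu (iota x) = 1) ->
  label p red j nu a b -> (b < a)%N -> (a + b = p.-1)%N.
Proof.
move=> p_pr redH nu_Fp [le_a le_b _ lab] lt_ba.
have [g gP] := finField_generator ('F_p : finFieldType).
rewrite (card_Fp p_pr) in gP.
have g0 : g != 0 by rewrite (prim_root_eq0 gP) -lt0n (prim_order_gt0 gP).
have ig0 : iota g != 0 by rewrite fmorph_eq0.
have : (p.-1 %| a + b)%N.
  have gp : g ^+ p = g by rewrite -[X in _ ^+ X](card_Fp p_pr) expf_card.
  rewrite (prim_order_dvd gP) exprD -{2}gp -exprM -exprD.
  rewrite -(inj_eq (fmorph_inj iota)) -(inj_eq (fmorph_inj j)) !rmorph1 !rmorphXn.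
  by rewrite -lab // nu_Fp // (prime_over1 redH).
by case/dvdnP => [[|[|q]]]; rewrite ?mulSn; try move: (q * p.-1)%N => u; lia.
Qed.

Local Open Scope complex_scope.

Theorem theorem1p2 (R : realType) (p : nat) (p_pr : prime p) (p_odd : odd p)
  (* the field with p^2 elements *)
  (Fq : finFieldType) (cardFq : #|Fq| = (p ^ 2)%N)
  (iota : {rmorphism 'F_p -> Fq})
  (psi : 'F_p -> R[i]) (psi_char : addchar psi)
  (psi_nontriv : exists x, psi x <> 1)
  (* the prime above p *)
  (k : fieldType) (red : R[i] -> k) (red_prime : prime_over p red)
  (j : {rmorphism Fq -> k})
  (* xi, K = Q_p(sqrt xi), and square roots of xi in K and in Fq *)
  (xi : padic_int p_pr) (xi_unit : xi \is a GRing.unit)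
  (xi_nonsquare : ~ exists y : padic_int p_pr, y ^+ 2 = xi)
  (K : fieldExtType (padic p_pr)) (dimK : \dim {:K} = 2%N)
  (sqrtxi : K) (sqrtxi2 : sqrtxi ^+ 2 = (tofrac xi)%:A)
  (s : Fq) (s2 : s ^+ 2 = iota (padic_residue xi)) (s_tr0 : s + s ^+ p = 0)
  (* nu = nu(a, b) *)
  (nu : Fq -> R[i]) (nu_char : mulchar nu)
  (nu_regular : nu <> (fun x => nu x ^+ p))
  (a b : nat) (nu_label : label p red j nu a b) (ba : (b < a)%N)
  (* the representation Pi *)
  (V : lmodType R[i]) (Pi : 'M[padic p_pr]_2 -> V -> V)
  (Pi_depth_zero : depth_zero_supercuspidal Pi iota nu)
  (Pi_central : trivial_central_char Pi)
  (v_triv : V) (hv_triv : mu_vector Pi (triv_char 'F_p R[i]) v_triv)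
  (quad : 'F_p -> R[i]) (hquad : quad_char quad)
  (v_quad : V) (hv_quad : mu_vector Pi quad v_quad) :
  let eps := epsilon iota psi s in
  let test := test_vector Pi xi sqrtxi in
  let tame := tame_char sqrtxi iota s in
  let Type1 := type1 p red j a b in
  let Type2 := type2 p red j a b in
  (a + b = p.-1)%N /\
  [/\ (test (triv_char K R[i]) v_triv <-> eps (triv_char Fq R[i]) <> eps nu) /\
        Type2 (triv_char Fq R[i]),
      forall chiK chi, tame chiK chi -> quad_char chiK ->
        (test chiK v_quad <-> eps chi <> eps nu) /\ Type1 chi,
      forall chiK chi, tame chiK chi -> eps chi <> eps nu ->
        (Type2 chi -> test chiK v_triv) /\ (Type1 chi -> test chiK v_quad)
    & forall chiK chi, tame chiK chi -> eps chi = eps nu ->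
        ~ test chiK v_triv /\ ~ test chiK v_quad].
Proof.
move=> eps test tame Type1 Type2.
case: Pi_depth_zero => Pi_repr _ _ _ [rho rho_cusp [f [f_inj f_fixed f_equiv]]].
have xi0 : padic_residue xi != 0 by apply: unit_residue_neq0.
have quadH : quadratic_data iota (padic_residue xi) s by split.
have [u_triv [f_triv u_triv0 u_triv_mu]] := mu_vector_coord f_inj f_fixed f_equiv hv_triv.
have [u_quad [f_quad u_quad0 u_quad_mu]] := mu_vector_coord f_inj f_fixed f_equiv hv_quad.
have nu_Fp := central_char_trivial f_inj f_equiv rho_cusp Pi_central u_triv0.
have ab := label_sum p_pr red_prime nu_Fp nu_label ba.
have cuspH : cuspidal_data iota (padic_residue xi) s nu rho by split.
have rdH : reduction_data iota (padic_residue xi) s nu rho red j a b.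
  by split => //; case: nu_label.
have epsE chi : mulchar chi -> trivial_on_Fp iota chi -> eps chi = chi s.
  by move=> chi_char chi_Fp; apply: (epsilonE quadH).
have eps_nu : eps nu = nu s by apply: epsE.
have triv_char_Fp := triv_mulchar 'F_p R[i].
have triv_sqr x : x != 0 -> triv_char 'F_p R[i] x ^+ 2 = 1.
  by move=> x0; rewrite /triv_char x0 expr1n.
have [quad_char_Fp _ _] := hquad.
have quad_sqr x : x != 0 -> quad x ^+ 2 = 1 by apply: quad_char_sqr.
pose infl (chiK : K -> R[i]) chi := [/\ inflates iota s sqrtxi chiK chi, mulchar chi
  & trivial_on_Fp iota chi].
have no_test mu v u chiK chi : mulchar mu ->
    (forall x, x != 0 -> mu x ^+ 2 = 1) -> f u = v ->
    (forall x, x != 0 -> rhoM rho (split_mx x) *m u = mu x *: u) ->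
    infl chiK chi -> eps chi = eps nu -> ~ test chiK v.
  move=> mu_char mu_sqr fu u_mu [[chiK_char chiK_res] chi_char chi_Fp].
  rewrite epsE // eps_nu => chi_nu.
  have u_fix := split_proj_fix cuspH mu_sqr u_mu.
  have prim01 : (padic_residue (0 : padic_int p_pr),
      padic_residue (1 : padic_int p_pr)) != (0, 0).
    by rewrite rmorph1 xpair_eqE oner_eq0 andbF.
  have s_coord : coordF iota s (0 : padic_int p_pr) 1 = s.
    by rewrite /coordF !rmorph0 !rmorph1 add0r mul1r.
  have w_act : Pi (mx2 0 1 (1 * tofrac xi) 0) v = - nu s *: v.
    have := Pi_primitive cuspH f_equiv u prim01.
    rewrite s_coord (torus_mx_s quadH) tofrac0 tofrac1 fu => ->.
    by rewrite -u_fix mulmxA (w_split_proj_eigen cuspH mu_char mu_sqr) -scalemxAl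
      u_fix linearZ /= fu.
  apply: (not_test_vector dimK sqrtxi2 cuspH Pi_repr chiK_char w_act).
  have red_s : reduces iota s sqrtxi sqrtxi s.
    exists 1, 0, 1; split => //.
      exact: oner_neq0.
    by rewrite scale1r tofrac0 tofrac1 coordK01.
  rewrite (chiK_res _ _ red_s) chi_nu -subr_eq0 opprK -mulr2n -mulr_natl.
  rewrite mulf_neq0 ?pnatr_eq0 //.
  by apply: contra_eq_neq (nu_s_sqr cuspH) => ->; rewrite expr0n /= eq_sym oner_eq0.
have yes_test mu v u chiK chi : mulchar mu ->
    (forall x, x != 0 -> mu x ^+ 2 = 1) -> f u = v -> u != 0 ->
    (forall x, x != 0 -> rhoM rho (split_mx x) *m u = mu x *: u) ->
    infl chiK chi ->
    torus_sum_op iota (padic_residue xi) s rho chi *m split_proj rho mu != 0 ->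
    test chiK v.
  move=> mu_char mu_sqr <- u0 u_mu [chiK_infl chi_char chi_Fp] op0.
  apply: (test_vector_of_projection dimK sqrtxi2 cuspH Pi_repr Pi_central f_inj f_equiv
    chiK_infl chi_char chi_Fp).
  apply: (rank1_projector_image _ _ _ u0 op0).
  - exact: split_proj_idem cuspH _ mu_char mu_sqr.
  - exact: split_proj_tr cuspH _ mu_char.
  - exact: split_proj_fix cuspH _ mu_sqr _ u_mu.
have type_test chiK chi : infl chiK chi -> eps chi <> eps nu ->
    (Type2 chi -> test chiK v_triv) /\ (Type1 chi -> test chiK v_quad).
  move=> chi_infl; have [_ chi_char chi_Fp] := chi_infl.
  rewrite epsE // eps_nu => /eqP chi_nu.
  have [e le_e exp_e] := exponent_exists quadH j red_prime chi_char chi_Fp.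
  have odd_e := odd_exponent rdH chi_char chi_Fp exp_e chi_nu.
  have type1P := type1E rdH le_e exp_e.
  split => [type2 | /type1P type1].
    apply: (yes_test _ _ _ _ _ triv_char_Fp triv_sqr f_triv u_triv0 u_triv_mu chi_infl).
    apply: (nonvanishing_triv rdH chi_char exp_e triv_char_Fp) => //.
      by move=> x x0; rewrite /triv_char x0 (prime_over1 red_prime).
    by apply/negP => /type1P.
  apply: (yes_test _ _ _ _ _ quad_char_Fp quad_sqr f_quad u_quad0 u_quad_mu chi_infl).
  apply: (nonvanishing_quad rdH chi_char exp_e quad_char_Fp) => // x x0.
  exact: quad_Fp_red rdH _ _ hquad x0.
have tame_infl chiK chi : tame chiK chi -> infl chiK chi.
  by case/tame_inflates => *; split.
have triv_infl : infl (triv_char K R[i]) (triv_char Fq R[i]).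
  split; first exact: (triv_inflates quadH sqrtxi2).
    exact: triv_mulchar.
  by move=> x x0; rewrite /triv_char fmorph_eq0 x0.
split => //; split.
- have triv_type2 : Type2 (triv_char Fq R[i]).
    by move/(type1E rdH (leq0n p) (triv_exponent rdH)).
  split => //; split=> [tst eps_eq | eps_neq].
    exact: no_test triv_char_Fp triv_sqr f_triv u_triv_mu triv_infl eps_eq tst.
  by have [+ _] := type_test _ _ triv_infl eps_neq; apply.
- move=> chiK chi /tame_infl chi_infl chiK_quad.
  have [infl_chi chi_char chi_Fp] := chi_infl.
  have chi_quad := quad_char_inflated quadH dimK sqrtxi2 infl_chi chi_char chiK_quad.
  have [e le_e exp_e] := exponent_exists quadH j red_prime chi_char chi_Fp.
  have e2 := quad_exponent rdH chi_quad le_e exp_e.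
  have chi_type1 : Type1 chi.
    apply/(type1E rdH le_e exp_e); have [m [ea ep]] := half_diff rdH.
    by lia.
  split => //; split=> [tst eps_eq | eps_neq].
    exact: no_test quad_char_Fp quad_sqr f_quad u_quad_mu chi_infl eps_eq tst.
  by have [_] := type_test _ _ chi_infl eps_neq; apply.
- by move=> chiK chi /tame_infl; apply: type_test.
move=> chiK chi /tame_infl chi_infl eps_eq; split.
  exact: no_test triv_char_Fp triv_sqr f_triv u_triv_mu chi_infl eps_eq.
exact: no_test quad_char_Fp quad_sqr f_quad u_quad_mu chi_infl eps_eq.
Qed.
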